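(* Let $\Xi=(\xi_n)$ be a time-homogeneous Markov chain on $\mathbb X\subseteq\mathbb R^2$ with $\mathbb P_{\mathbf 0}[\theta=\mathbf 0]<1$, such that given $\xi_0=\mathbf x\ne\mathbf 0$ the jump is $\theta=\chi\mathbf u_{\mathbf x}\theta^{\mathcal R}+(1-\chi)\mathbf v_{\mathbf x}\theta^{\mathcal T}$, where $\chi\in\{0,1\}$ and $\theta^{\mathcal R},\theta^{\mathcal T}\in\mathbb R$ are independent of $\chi$, and assume: (A) for all $\mathbf x\neq\mathbf 0$, $\mathbb P_{\mathbf x}[\chi=1]=p^{\mathcal R}\in(0,1)$ and $\mathbb P_{\mathbf x}[\chi=0]=p^{\mathcal T}=1-p^{\mathcal R}$; (B) for all $\mathbf x\ne\mathbf 0$, $\mathbb E_{\mathbf x}[\theta^{\mathcal R}]=\mathbb E_{\mathbf x}[\theta^{\mathcal T}]=0$; (C) there are $\alpha\in(1,2)$, $c^{\mathcal R}\in(0,\infty)$ with $\lim_{y\to\infty}\sup_{\mathbf x\ne\mathbf 0}|y^\alpha\mathbb P_{\mathbf x}[\theta^{\mathcal R}_+>y]-c^{\mathcal R}|=0$; (D) there is $\beta>\alpha$ with $\sup_{\mathbf x\ne\mathbf 0}\mathbb E_{\mathbf x}[(\theta^{\mathcal R}_-)^\beta]<\infty$; (E) for all $\mathbf x\ne\mathbf 0$ and $y\ge0$, $\mathbb P_{\mathbf x}[\theta^{\mathcal T}_->y]=\mathbb P_{\mathbf x}[\theta^{\mathcal T}_+>y]$, and there is $c^{\mathcal T}\in(0,\infty)$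 with $\lim_{y\to\infty}\sup_{\mathbf x\ne\mathbf 0}|y^\alpha\mathbb P_{\mathbf x}[\theta^{\mathcal T}_+>y]-c^{\mathcal T}|=0$. Then: (i) if $p^{\mathcal R}c^{\mathcal R}+2p^{\mathcal T}c^{\mathcal T}\cos(\frac{\pi\alpha}2)>0$, $\Xi$ is null recurrent; (ii) if $p^{\mathcal R}c^{\mathcal R}+2p^{\mathcal T}c^{\mathcal T}\cos(\frac{\pi\alpha}2)<0$, $\Xi$ is transient. Moreover, in case (i), for all $a$ sufficiently large and all $\mathbf x$ with $\|\mathbf x\|>a$, $\mathbb E_{\mathbf x}[\tau_a^q]<\infty$ for $q<\nu^\star/\alpha$ and $\mathbb E_{\mathbf x}[\tau_a^q]=\infty$ for $q>\nu^\star/\alpha$, where $\nu^\star$ is the unique solution in $(0,1)$ of $$p^{\mathcal R}c^{\mathcal R}\frac{\Gamma(\alpha-\nu^\star)\Gamma(1-\alpha)}{\Gamma(1-\nu^\star)}+p^{\mathcal T}c^{\mathcal T}\frac{\Gamma(\frac{\alpha-\nu^\star}2)\Gamma(1-\frac\alpha2)}{\Gamma(1-\frac{\nu^\star}2)}=0.$$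
   Context: $\mathbb X$ is an infinite, unbounded, measurable subset of $\mathbb R^2$; $\theta:=\xi_1-\xi_0$; $\mathbb P_{\mathbf x},\mathbb E_{\mathbf x}$ refer to the chain started at $\mathbf x$. For $\mathbf x\ne\mathbf 0$, $\mathbf u_{\mathbf x}:=\mathbf x/\|\mathbf x\|$ and $\mathbf v_{\mathbf x}$ is the unit vector obtained by rotating $\mathbf u_{\mathbf x}$ anticlockwise by $\pi/2$. For $y\in\mathbb R$, $y_+:=y\mathbf 1\{y\ge0\}$, $y_-:=-y\mathbf 1\{y<0\}$. $\tau_a:=\min\{n\ge0:\|\xi_n\|\le a\}$. $\Xi$ is transient if $\|\xi_n\|\to\infty$ a.s.; recurrent if $\liminf_n\|\xi_n\|\le r_0$ a.s. for some constant $r_0$; null recurrent if recurrent and $\mathbb E_{\mathbf x}[\tau_a]=\infty$ for all large $a$ and $\|\mathbf x\|>a$. $\Gamma$ is the gamma function. *)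

(* Defs.v *)
From HB Require Import structures.
From mathcomp Require Import all_boot all_order all_algebra.
From mathcomp Require Import all_classical all_reals all_analysis.
Set Implicit Arguments. Unset Strict Implicit. Unset Printing Implicit Defensive.
Import Order.TTheory GRing.Theory Num.Theory.
Import numFieldNormedType.Exports.
Local Open Scope classical_set_scope.
Local Open Scope ring_scope.

Section Defs.
Variable R : realType.

Definition nrm (x : R * R) : R := Num.sqrt (x.1 ^+ 2 + x.2 ^+ 2).
Definition vadd (x y : R * R) : R * R := (x.1 + y.1, x.2 + y.2).
Definition vsub (x y : R * R) : R * R := (x.1 - y.1, x.2 - y.2).
Definition smul (t : R) (x : R * R) : R * R := (t * x.1, t * x.2).
Definition origin : R * R := (0, 0).
End Defs.
Arguments origin {R}.
Section Defs2.
Variable R : realType.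
(* u_x = x / ||x|| and v_x = u_x rotated anticlockwise by pi/2 *)
Definition uvec (x : R * R) : R * R := smul (nrm x)^-1 x.
Definition vvec (x : R * R) : R * R := (- (uvec x).2, (uvec x).1).

Definition pospart (y : R) : R := if 0 <= y then y else 0.
Definition negpart (y : R) : R := if y < 0 then - y else 0.

(* Euler's integral, valid for s > 0 *)
Definition EulerGammaInt (s : R) : R :=
  fine (\int[lebesgue_measure]_(t in `]0%R, +oo[%classic)
          ((t `^ (s - 1)) * expR (- t))%:E)%E.
(* The Gamma function on R (away from its poles 0,-1,-2,...), defined via
   the functional equation Gamma s = Gamma (s+n) / (s (s+1) ... (s+n-1)). *)
Definition Gamma (s : R) : R :=
  let n := (Num.truncn (- s)).+1 in
  EulerGammaInt (s + n%:R) / \prod_(k < n) (s + k%:R).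

End Defs2.

Section Chain.
Context {R : realType} {d : measure_display} {Omega : measurableType d}.

Definition hist (xi : nat -> Omega -> R * R) (A : nat -> set (R * R)) (n : nat)
  : set Omega := [set w | forall i, (i <= n)%N -> A i (xi i w)].

Definition is_markov_chain (X : set (R * R)) (P : R * R -> probability Omega R)
  (xi : nat -> Omega -> R * R) (K : R.-pker (R * R)%type ~> (R * R)%type) : Prop :=
  (forall n, measurable_fun setT (xi n)) /\
  forall x, X x ->
    P x [set w | xi 0%N w = x] = 1%E /\
    (forall n, P x (xi n @^-1` X) = 1%E) /\
    (forall n (A : nat -> set (R * R)) (B : set (R * R)),
      (forall i, measurable (A i)) -> measurable B ->
      P x (hist xi A n `&` xi n.+1 @^-1` B) =
      (\int[P x]_(w in hist xi A n) K (xi n w) B)%E).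

(* tau_a = min { n >= 0 : ||xi_n|| <= a } (= +oo if the set is empty) *)
Definition tau (xi : nat -> Omega -> R * R) (a : R) (w : Omega) : \bar R :=
  ereal_inf [set (n%:R)%:E | n in [set n : nat | nrm (xi n w) <= a]].

Definition transient (X : set (R * R)) (P : R * R -> probability Omega R)
  (xi : nat -> Omega -> R * R) : Prop :=
  forall x, X x -> {ae P x, forall w, (fun n => nrm (xi n w)) @ \oo --> +oo}.

Definition recurrent (X : set (R * R)) (P : R * R -> probability Omega R)
  (xi : nat -> Omega -> R * R) : Prop :=
  exists r0 : R, forall x, X x ->
    {ae P x, forall w, (limn_einf (fun n => (nrm (xi n w))%:E) <= r0%:E)%E}.

Definition null_recurrent (X : set (R * R)) (P : R * R -> probability Omega R)
  (xi : nat -> Omega -> R * R) : Prop :=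
  recurrent X P xi /\
  exists a0 : R, forall a, a0 <= a -> forall x, X x -> a < nrm x ->
    (\int[P x]_w tau xi a w = +oo)%E.

End Chain.

(* Main.v *)
(* Write r = ||x||. The Lyapunov functions are the powers max(r, 1)^nu. By the tail
   conditions (C) and (E), uniformly in x, one step changes r^nu on average by
   nu r^(nu - alpha) (D(nu) + o(1)), where
     D(nu) = - pR cR JR(nu) + pT cT JT(nu),
     JR(nu) = int_0^oo (1 - (1 + u)^(nu - 1)) u^(-alpha) du,
     JT(nu) = int_0^oo (1 + u)^(nu/2 - 1) u^(-alpha/2) du;
   centering removes the linear term of the radial jump, and its negative part,
   having a moment of order beta > alpha, contributes only to the error.
   On (0, 1), Beta integrals identify D with the Gamma function expression of the
   statement. D is continuous and strictly increasing on (-1, 1) and positive near 1;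
   rotating an integral of z^(s-1) / (1 + z) by a quarter turn gives
   D(0) = - I (pR cR + 2 pT cT cos(pi alpha / 2)) with I > 0.
   If D(nu) < 0 with 0 < nu < 1, then r^nu loses at least a multiple of r^(nu - alpha)
   per step outside a ball, which bounds P(tau > n) by a multiple of n^(-nu/alpha).
   If D(nu) > 0 with 0 < nu < 1, then a multiple of r^nu, saturated at the scale
   n^(1/alpha), loses on average at most a fraction 1/(2n) of its value per step, which
   bounds P(tau > n) below by a multiple of n^(-nu/alpha). If D(nu) > 0 with nu < 0,
   then r^nu is a supermartingale away from the origin and the expected number of
   visits to each ball is finite. *)

Require Import Defs.
From HB Require Import structures.
From mathcomp Require Import all_boot all_order all_algebra.
From mathcomp Require Import all_classical all_reals all_analysis.
From mathcomp Require Import measurable_realfun ring lra.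
Set Implicit Arguments. Unset Strict Implicit. Unset Printing Implicit Defensive.
Import Order.TTheory GRing.Theory Num.Theory.
Import numFieldNormedType.Exports.
Local Open Scope classical_set_scope.
Local Open Scope ring_scope.

(** * Integrals over the half-line *)

Section Integrals.
Context {R : realType}.
Local Notation mu := (@lebesgue_measure R).
Local Open Scope ereal_scope.

(** One radius [a0] must serve every exponent q, whereas the radius beyond which the drift of r^nu
    takes the sign of D(nu) depends on nu and is not controlled as nu approaches the root of D. The
    upper bounds therefore add a bounded radial function ([kernel_contraction]) whose drift has a
    sign beyond a radius L fixed once and for all. The lower bounds hold above any given radius: one
    jump escapes as far as desired with positive probability ([kernel_escape]), and the chain then
    survives outside a larger ball. Stopping times and martingales are replaced by expectations over
    the event that the path has stayed in prescribed sets ([occupation]); on these the Markov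
    property is an integral identity for the last step. The jump from the origin is only known to be
    nondegenerate, so the origin stays outside all drift estimates, and the visits to it are counted
    through the state that follows. The quarter turn is real analysis: Tonelli's theorem on a
    rectangle in polar coordinates, with the Cauchy-Riemann equation as the common integrand. *)

Lemma fubini_tonelli_setX d1 d2 (T1 : measurableType d1) (T2 : measurableType d2)
  (m1 : {sigma_finite_measure set T1 -> \bar R})
  (m2 : {sigma_finite_measure set T2 -> \bar R})
  (D1 : set T1) (D2 : set T2) (f : T1 -> T2 -> \bar R) :
  measurable D1 -> measurable D2 ->
  measurable_fun (D1 `*` D2) (fun z : T1 * T2 => f z.1 z.2) ->
  (forall x y, D1 x -> D2 y -> 0 <= f x y) ->
  \int[m1]_(x in D1) \int[m2]_(y in D2) f x y =
  \int[m2]_(y in D2) \int[m1]_(x in D1) f x y.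
Proof.
move=> mD1 mD2 mf f0.
pose h (z : T1 * T2) : \bar R := ((fun z : T1 * T2 => f z.1 z.2) \_ (D1 `*` D2)) z.
have h0 z : 0 <= h z.
  rewrite /h patchE; case: ifPn => // /set_mem[? ?]; exact: f0.
have mh : measurable_fun setT h.
  by apply/(measurable_restrictT _ _).1 => //; exact: measurableX.
have := @fubini_tonelli _ _ _ _ _ m1 m2 h mh h0.
have -> : \int[m1]_x \int[m2]_y h (x, y) = \int[m1]_(x in D1) \int[m2]_(y in D2) f x y.
  rewrite [RHS]integral_mkcond; apply: eq_integral => x _.
  rewrite patchE; case: ifPn => [/set_mem xD|xD].
    rewrite [RHS]integral_mkcond; apply: eq_integral => y _.
    rewrite /h !patchE /=; congr (if _ then _ else _).
    by rewrite in_setX (mem_set xD).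
  apply: integral0_eq => y _; rewrite /h patchE ifF//.
  by rewrite in_setX/= (negbTE xD).
move=> ->.
rewrite [RHS]integral_mkcond; apply: eq_integral => y _.
rewrite patchE; case: ifPn => [/set_mem yD|yD].
  rewrite [RHS]integral_mkcond; apply: eq_integral => x _.
  rewrite /h !patchE /=; congr (if _ then _ else _).
  by rewrite in_setX (mem_set yD) andbT.
apply: integral0_eq => x _; rewrite /h patchE ifF//.
by rewrite in_setX/= (negbTE yD) andbF.
Qed.

(** Lebesgue measure equals c times its image under u -> c u: both agree on half-open intervals, and
    uniqueness does the rest. The change of variables is then the image measure formula, for
    measurable h. *)
Lemma ge0_integral_scale0y (c : R) (h : R -> \bar R) : (0 < c)%R ->
  measurable_fun (`]0%R, +oo[ : set R) h -> (forall u, (0 < u)%R -> 0 <= h u) ->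
  \int[mu]_(u in `]0%R, +oo[) h u = c%:E * \int[mu]_(u in `]0%R, +oo[) h (c * u)%R.
Proof.
move=> c0 mh h0.
pose s : measurableTypeR R -> measurableTypeR R := fun u => (c * u)%R.
have ms : measurable_fun setT s by exact: mulrl_measurable.
have E A : measurable A ->
    mu A = mscale (NngNum (ltW c0)) (pushforward mu s) A.
  move=> mA; apply: lebesgue_measure_unique => // _ [[a b] _ <-].
  rewrite /= /mscale /=.
  rewrite (_ : pushforward mu s `]a, b] = mu `](a / c)%R, (b / c)%R]); last first.
    rewrite /pushforward; congr (mu _).
    apply/seteqP; split => u /=; rewrite /s !in_itv/= ltr_pdivrMr// ler_pdivlMr//;
      by rewrite (mulrC u).
  rewrite !lebesgue_measure_itv/= !lte_fin ltr_pM2r ?invr_gt0//.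
  case: ifPn => ab; last by rewrite mule0.
  rewrite -EFinB -EFinM; congr EFin; rewrite -mulrBl mulrC mulfVK ?gt_eqF//.
rewrite (@eq_measure_integral _ _ _ _ (mscale (NngNum (ltW c0)) (pushforward mu s)) mu); last first.
  by move=> A mA _; exact: E.
rewrite ge0_integral_mscale//=; last first.
  by move=> x; rewrite /= in_itv/= andbT; exact: h0.
congr (_ * _).
have sE : s @^-1` `]0%R, +oo[ = `]0%R, +oo[%classic.
  by apply/seteqP; split => u /=; rewrite /s !in_itv/= !andbT pmulr_rgt0.
rewrite ge0_integral_pushforward//=; first by rewrite sE.
by move=> y; rewrite inE/= in_itv/= andbT; exact: h0.
Qed.
End Integrals.

(** * Fundamental theorem of calculus up to 0 and infinity; integrals of powers *)

Section Calculus.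
Context {R : realType}.
Local Notation mu := (@lebesgue_measure R).

Lemma is_derive_continuous (F : R -> R) (x df : R) : is_derive x (1 : R) F df -> {for x, continuous F}.
Proof. by move=> dF; apply: differentiable_continuous; apply/derivable1_diffP; apply: ex_derive. Qed.

Lemma continuous_powR (s x : R) : 0 < x -> {for x, continuous (@powR R ^~ s)}.
Proof. by move=> x0; exact: (is_derive_continuous (is_derive1_powR _ x0)). Qed.

Lemma is_derive_FTC2 (a b : R) (f F : R -> R) : a < b ->
  (forall x, a <= x <= b -> {for x, continuous f}) ->
  (forall x, a <= x <= b -> is_derive x 1 F (f x)) ->
  (\int[mu]_(x in `[a, b]) (f x)%:E = (F b - F a)%:E)%E.
Proof.
move=> ab cf dF; rewrite EFinB; apply: continuous_FTC2 => //.
- by apply: continuous_in_subspaceT => x; rewrite inE/= in_itv/=; exact: cf.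
- split => [x| |].
  + rewrite in_itv/= => /andP[/ltW ax /ltW xb].
    by apply: ex_derive; apply: dF; rewrite ax.
  + apply: cvg_at_right_filter; apply: (@is_derive_continuous _ _ (f a)).
    by apply: dF; rewrite lexx ltW.
  + apply: cvg_at_left_filter; apply: (@is_derive_continuous _ _ (f b)).
    by apply: dF; rewrite lexx ltW.
- move=> x; rewrite in_itv/= => /andP[/ltW ax /ltW xb].
  by rewrite derive1E; apply: (@derive_val _ _ _ _ _ _ _ (dF x _)); rewrite ax.
Qed.

Lemma pos_continuous_measurable (f : R -> R) (A : set R) : measurable A ->
  A `<=` `]0, +oo[ ->
  (forall x : R, 0 < x -> {for x, continuous f}) -> measurable_fun A f.
Proof.
move=> mA A0 cf; apply: (measurable_funS _ A0) => //.
apply: open_continuous_measurable_fun => // x.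
by rewrite inE/= in_itv/= andbT; exact: cf.
Qed.

(** The integrand may blow up at 0, so the interval is exhausted by compact ones and monotone
    convergence replaces integrability. *)
Lemma ge0_FTC_at0 (w l : R) (f F : R -> R) : 0 < w ->
  (forall x : R, 0 < x -> 0 <= f x) ->
  (forall x : R, 0 < x -> {for x, continuous f}) ->
  (forall x : R, 0 < x -> is_derive x (1 : R) F (f x)) -> F x @[x --> 0^'+] --> l ->
  (\int[mu]_(x in `]0%R, w]) (f x)%:E = (F w - l)%:E)%E.
Proof.
move=> w0 f0 cf dF Fl.
(* Starting at w / 2 keeps every interval [[e n, w]] nondegenerate, as [is_derive_FTC2] requires. *)
pose e n : R := w / n.+2%:R.
have e0 n : 0 < e n by rewrite divr_gt0.
have ew n : e n < w by rewrite ltr_pdivrMr// ltr_pMr// ltr1n.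
have eni m n : (m <= n)%N -> e n <= e m.
  by move=> mn; rewrite ler_pM2l// lef_pV2 ?posrE// ler_nat.
have e_cvg0 : e n @[n --> \oo] --> 0.
  rewrite -(mulr0 w); apply: cvgMr => //.
  by have := @cvg_harmonic R; rewrite -cvg_shiftS.
have U : `]0, w]%classic = \bigcup_n `[e n, w]%classic.
  apply/seteqP; split => [x /=|x [n _ /=]].
    rewrite in_itv/= => /andP[x0 xw].
    have /cvgrPdist_lt/(_ x x0)[n _ /(_ n (leqnn n))] := e_cvg0.
    rewrite /= sub0r normrN gtr0_norm// => enx; exists n => //=.
    by rewrite in_itv/= ltW.
  by rewrite !in_itv/= => /andP[ex ->]; rewrite (lt_le_trans (e0 n)).
have H : (\int[mu]_(x in `[e n, w]) (f x)%:E @[n --> \oo] -->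
   \int[mu]_(x in \bigcup_n `[e n, w]%classic) (f x)%:E)%E.
  apply: ge0_nondecreasing_set_cvg_integral => //.
  - move=> m n mn; rewrite subsetEset => x /=; rewrite !in_itv/= => /andP[+ ->].
    by rewrite andbT; exact/le_trans/eni.
  - move=> n; apply/measurable_EFinP; apply: pos_continuous_measurable => // x /=.
    by rewrite !in_itv/= andbT => /andP[ex _]; exact: lt_le_trans ex.
  - move=> n x /=; rewrite in_itv/= => /andP[ex _]; rewrite lee_fin f0//.
    exact: lt_le_trans ex.
have E n : (\int[mu]_(x in `[e n, w]) (f x)%:E)%E = (F w - F (e n))%:E.
  by apply: is_derive_FTC2 => // x /andP[ex _]; [apply: cf|apply: dF]; exact: lt_le_trans ex.
have H2 : (\int[mu]_(x in `[e n, w]) (f x)%:E)%E @[n --> \oo] --> (F w - l)%:E.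
  rewrite (eq_cvg _ _ E); apply: cvg_EFin; first exact: nearW.
  apply: cvgB; first exact: cvg_cst.
  by move/cvg_at_rightP : Fl; exact.
rewrite U; exact: (cvg_unique _ H H2).
Qed.

Lemma ge0_FTC_aty (w l : R) (f F : R -> R) : 0 < w ->
  (forall x : R, 0 < x -> 0 <= f x) ->
  (forall x : R, 0 < x -> {for x, continuous f}) ->
  (forall x : R, 0 < x -> is_derive x (1 : R) F (f x)) -> F x @[x --> +oo] --> l ->
  (\int[mu]_(x in `]w, +oo[) (f x)%:E = (l - F w)%:E)%E.
Proof.
move=> w0 f0 cf dF Fl.
have mf : measurable_fun `]w, +oo[ f.
  apply: pos_continuous_measurable => // x /=; rewrite !in_itv/= !andbT.
  exact: lt_trans.
rewrite integral_itv_obnd_cbnd; last exact/measurable_EFinP.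
rewrite EFinB; apply: ge0_continuous_FTC2y => //.
- by move=> x wx; apply: f0; exact: lt_le_trans wx.
- apply: continuous_in_subspaceT => x; rewrite inE/= in_itv/= andbT => wx.
  by apply: cf; exact: lt_le_trans wx.
- by move=> x wx; apply: ex_derive; apply: dF; exact: lt_trans wx.
- by apply: cvg_at_right_filter; apply: is_derive_continuous (dF _ _).
- move=> x; rewrite in_itv/= andbT => wx.
  by rewrite derive1E; apply: (@derive_val _ _ _ _ _ _ _ (dF x _)); exact: lt_trans wx.
Qed.

Lemma gtr0_ltr_powRN (s x y : R) : s < 0 -> 0 < x -> x < y -> y `^ s < x `^ s.
Proof.
move=> s0 x0 xy; rewrite -(opprK s) powRN (powRN x).
have y0 := lt_trans x0 xy.
rewrite ltf_pV2 ?posrE ?powR_gt0//; apply: gt0_ltr_powR => //; rewrite ?oppr_gt0//; exact: ltW.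
Qed.

Lemma gtr0_ler_powRN (s x y : R) : s <= 0 -> 0 < x -> x <= y -> y `^ s <= x `^ s.
Proof.
rewrite le_eqVlt => /predU1P[->|s0] x0; first by rewrite !powRr0.
rewrite le_eqVlt => /predU1P[->//|xy]; exact/ltW/gtr0_ltr_powRN.
Qed.

Lemma powR_cvgy0 (s : R) : s < 0 -> x `^ s @[x --> +oo] --> (0 : R).
Proof.
move=> s0; apply/cvgrPdist_lt => e e0; near=> x.
have x0 : 0 < e `^ s^-1 by rewrite powR_gt0.
rewrite sub0r normrN ger0_norm ?powR_ge0//.
have -> : e = (e `^ s^-1) `^ s by rewrite -powRrM mulVf ?lt_eqF// powRr1// ltW.
by apply: gtr0_ltr_powRN => //; near: x; exact: nbhs_pinfty_gt.
Unshelve. all: by end_near. Qed.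

Lemma is_derive_powR_div (s x : R) : s != 0 -> 0 < x ->
  is_derive x 1 (fun y => y `^ s / s) (x `^ (s - 1)).
Proof.
move=> s0 x0.
rewrite (_ : (fun y => y `^ s / s) = (fun y => s^-1 *: (y `^ s))); last first.
  by apply/funext => y; rewrite mulrC.
have -> : x `^ (s - 1) = s^-1 *: (s * x `^ (s - 1)).
  by rewrite /GRing.scale/= mulrA mulVf// mul1r.
by apply: is_deriveZ; exact: is_derive1_powR.
Qed.

Lemma integral_powR_at0 (w s : R) : 0 < w -> 0 < s ->
  (\int[mu]_(x in `]0%R, w]) (x `^ (s - 1))%:E = (w `^ s / s)%:E)%E.
Proof.
move=> w0 s0; rewrite -[X in X%:E]subr0; apply: (@ge0_FTC_at0 w 0 _ (fun y => y `^ s / s)) => // [x x0|x x0|x x0|].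
- exact: powR_ge0.
- exact: continuous_powR.
- by apply: is_derive_powR_div => //; rewrite gt_eqF.
- by rewrite -[X in _ --> X](mul0r s^-1); apply: cvgMl; exact: powR_cvg0.
Qed.

Lemma integral_powR_aty (w s : R) : 0 < w -> s < 0 ->
  (\int[mu]_(x in `]w, +oo[) (x `^ (s - 1))%:E = (- (w `^ s / s))%:E)%E.
Proof.
move=> w0 s0; rewrite -[X in _ = X%:E]sub0r; apply: (@ge0_FTC_aty w 0 _ (fun y => y `^ s / s)) => // [x x0|x x0|x x0|].
- exact: powR_ge0.
- exact: continuous_powR.
- by apply: is_derive_powR_div => //; rewrite lt_eqF.
- by rewrite -[X in _ --> X](mul0r s^-1); apply: cvgMl; exact: powR_cvgy0.
Qed.

(* Dividing by nu makes the sign of the drift independent of the sign of nu. *)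
Definition boxcox (nu y : R) := (y `^ nu - 1) / nu.

Lemma integral_powR_boxcox (nu t : R) : nu != 0 -> 0 <= t ->
  (\int[mu]_(u in `]0%R, t]) ((1 + u) `^ (nu - 1))%:E = (boxcox nu (1 + t))%:E)%E.
Proof.
move=> nu0; rewrite le_eqVlt => /predU1P[<-|t0].
  by rewrite set_itv_ge ?bnd_simp ?ltxx// integral_set0 addr0 /boxcox powR1 subrr mul0r.
have dF (x : R) : 0 <= x -> is_derive x (1 : R) (fun y => (1 + y) `^ nu / nu) ((1 + x) `^ (nu - 1)).
  move=> x0.
  have x1 : 0 < 1 + x by rewrite ltr_wpDr.
  have d1 : is_derive (1 + x) (1 : R) (fun y : R => y `^ nu / nu) ((1 + x) `^ (nu - 1)).
    exact: is_derive_powR_div.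
  have d2 : is_derive x (1 : R) (fun y : R => 1 + y) 1.
    have : is_derive x (1 : R) ((cst 1 : R -> R) + id) (0 + 1) by apply: is_deriveD.
    by rewrite add0r.
  have := @is_derive1_comp _ _ _ _ _ _ d1 d2.
  by rewrite mulr1.
have cf (x : R) : 0 <= x -> {for x, continuous (fun y : R => (1 + y) `^ (nu - 1))}.
  move=> x0; apply: (@continuous_comp _ _ _ (fun y : R => 1 + y) (fun y => y `^ (nu - 1))).
    by apply: cvgD; [exact: cvg_cst|exact: cvg_id].
  by apply: continuous_powR; rewrite ltr_wpDr.
rewrite integral_itv_obnd_cbnd; last first.
  apply/measurable_EFinP; apply: pos_continuous_measurable => //.
    by move=> x /=; rewrite !in_itv/= => /andP[->].
  by move=> x x0; apply: cf; exact: ltW.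
have -> : boxcox nu (1 + t) = (1 + t) `^ nu / nu - (1 + 0) `^ nu / nu.
  by rewrite addr0 powR1 /boxcox mulrBl.
apply: (@is_derive_FTC2 _ _ _ (fun y => (1 + y) `^ nu / nu)) => // x /andP[x0 _].
- exact: cf.
- exact: dF.
Qed.
End Calculus.

(** * Gamma and Beta integrals *)

Section MeasurableComp.
Context {R : realType} d (T : measurableType d).
Implicit Types f g : T -> R.

Lemma measurableT_expR f : measurable_fun setT f -> measurable_fun setT (fun z => expR (f z)).
Proof. by move=> mf; exact: (measurableT_comp (@measurable_expR R) mf). Qed.

Lemma measurableT_powR p f : measurable_fun setT f -> measurable_fun setT (fun z => f z `^ p).
Proof. by move=> mf; exact: (measurableT_comp (@measurable_powR R p) mf). Qed.

Lemma measurableT_opp f : measurable_fun setT f -> measurable_fun setT (fun z => - f z).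
Proof. by move=> mf; exact: measurable_funN. Qed.

Lemma measurableT_norm f : measurable_fun setT f -> measurable_fun setT (fun z => `|f z|).
Proof. by move=> mf; exact: (measurableT_comp (@normr_measurable R setT) mf). Qed.

Lemma measurableT_exp f n : measurable_fun setT f -> measurable_fun setT (fun z => f z ^+ n).
Proof. by move=> mf; exact: measurable_funX. Qed.

Lemma measurableT_sqrt f : measurable_fun setT f -> measurable_fun setT (fun z => Num.sqrt (f z)).
Proof.
move=> mf; apply: (measurableT_comp _ mf).
by apply: continuous_measurable_fun; exact: sqrt_continuous.
Qed.

Lemma measurable_addl (c : R) D : measurable_fun D (+%R c).
Proof. by apply: measurable_funD; [exact: measurable_cst|exact: measurable_id]. Qed.
End MeasurableComp.

Ltac measurability := repeat
  lazymatch goal with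
  | |- measurable_fun _ (fun z => (_)%:E) => apply/measurable_EFinP => /=
  | |- measurable_fun _ (fun z => expR _) => apply: measurableT_expR
  | |- measurable_fun _ (fun z => (_ `^ _)%R) => apply: measurableT_powR
  | |- measurable_fun _ (fun z => - _) => apply: measurableT_opp
  | |- measurable_fun _ (fun z => (_ + _)%R) => apply: measurable_funD
  | |- measurable_fun _ (fun z => (_ * _)%R) => apply: measurable_funM
  | |- measurable_fun _ (fun z => (_ ^+ _)%R) => apply: measurableT_exp
  | |- measurable_fun _ (fun z => `|_|) => apply: measurableT_norm
  | |- measurable_fun _ (fun z => Num.sqrt _) => apply: measurableT_sqrt
  | |- measurable_fun _ (fun z => Num.max _ _) => apply: measurable_maxr
  | |- measurable_fun _ (fun z => Num.min _ _) => apply: measurable_minr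
  | |- measurable_fun _ (fun z => z) => exact: measurable_id
  | |- measurable_fun _ (fun z => z.1) => exact: measurable_fst
  | |- measurable_fun _ (fun z => z.2) => exact: measurable_snd
  | |- _ => first [done | exact: measurable_cst | assumption | exact: measurable_addl | exact: mulrl_measurable]
  end.

(** Values in the extended reals let the identities obtained from Tonelli's theorem hold before
    finiteness is known, and then imply it. *)
HB.lock Definition Gamma_integral {R : realType} (s : R) : \bar R :=
  (\int[@lebesgue_measure R]_(t in `]0%R, +oo[) (t `^ (s - 1) * expR (- t))%:E)%E.

(* This is the Beta function B(gam - m, 1 - gam). *)
HB.lock Definition int_tan {R : realType} (gam m : R) : \bar R :=
  (\int[@lebesgue_measure R]_(u in `]0%R, +oo[) ((1 + u) `^ (m - 1) * u `^ (- gam))%:E)%E.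

(** Minus the analytic continuation of the Beta integral B(a - nu, 1 - a) to 1 < a < 2: subtracting
    the power from its value 1 at u = 0 restores convergence there. *)
HB.lock Definition int_rad {R : realType} (a nu : R) : \bar R :=
  (\int[@lebesgue_measure R]_(u in `]0%R, +oo[)
    ((1 - (1 + u) `^ (nu - 1)) * u `^ (- a))%:E)%E.

Section GammaBeta.
Context {R : realType}.
Local Notation mu := (@lebesgue_measure R).
Local Notation Rpos := (`]0%R, +oo[%classic : set R).
Local Open Scope ereal_scope.

Lemma Rpos_gt0 (x : R) : Rpos x -> (0 < x)%R.
Proof. by rewrite /= in_itv/= andbT. Qed.

Lemma ge0_integralZlR (D : set R) (k : R) (f : R -> \bar R) : measurable D -> (0 <= k)%R ->
  measurable_fun D f -> (forall x, D x -> 0 <= f x) ->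
  \int[mu]_(x in D) (k%:E * f x) = k%:E * \int[mu]_(x in D) f x.
Proof. by move=> mD k0 mf f0; rewrite ge0_integralZl. Qed.

(* Integration over the triangle 0 < w <= t in both orders. *)
Lemma fubini_tonelli_triangle (f : R -> R -> R) :
  measurable_fun setT (fun z : R * R => f z.1 z.2) ->
  (forall t w, 0 < t -> 0 < w -> 0 <= f t w)%R ->
  \int[mu]_(t in Rpos) \int[mu]_(w in `]0%R, t]) (f t w)%:E =
  \int[mu]_(w in Rpos) \int[mu]_(t in `]w, +oo[) (f t w)%:E.
Proof.
move=> mf f0.
pose g (t w : R) : \bar R := if (w <= t)%R then (f t w)%:E else 0.
have mg : measurable_fun (setT : set (R * R)) (fun z : R * R => g z.1 z.2).
  apply: measurable_fun_ifT => //; last exact/measurable_EFinP.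
  by apply: measurable_fun_ler; [exact: measurable_snd|exact: measurable_fst].
transitivity (\int[mu]_(t in Rpos) \int[mu]_(w in Rpos) g t w).
  apply: eq_integral => t /set_mem/Rpos_gt0 t0.
  rewrite integral_mkcond [RHS]integral_mkcond; apply: eq_integral => w _.
  rewrite !patchE /g !mem_setE !in_itv/= andbT.
  by case: (0 < w)%R => //=; case: (w <= t)%R.
transitivity (\int[mu]_(w in Rpos) \int[mu]_(t in Rpos) g t w).
  apply: fubini_tonelli_setX => //; first exact: measurable_funTS.
  move=> t w /Rpos_gt0 t0 /Rpos_gt0 w0; rewrite /g; case: ifPn => // _.
  by rewrite lee_fin f0.
apply: eq_integral => w /set_mem/Rpos_gt0 w0.
rewrite [RHS]integral_itv_obnd_cbnd; last first.
  apply/measurable_EFinP; apply: measurable_funTS.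
  exact: (measurableT_comp mf (measurable_pair2 w)).
rewrite integral_mkcond [RHS]integral_mkcond; apply: eq_integral => t _.
rewrite !patchE /g !mem_setE !in_itv/= !andbT.
have [wt|wt] := leP w t; first by rewrite (lt_le_trans w0 wt).
by case: ifP.
Qed.

Lemma integral_expRN (w : R) : (0 < w)%R ->
  \int[mu]_(t in `]w, +oo[) (expR (- t))%:E = (expR (- w))%:E.
Proof.
move=> w0; rewrite -[X in _ = X%:E]opprK -[X in _ = X%:E]sub0r.
apply: (@ge0_FTC_aty _ w 0 (fun t => expR (- t)) (fun t => - expR (- t))%R) => //.
- move=> x _; apply: (@continuous_comp _ _ _ -%R expR).
    exact: opp_continuous.
  exact: continuous_expR.
- move=> x _.
  have d1 : is_derive x (1%R : R) (fun t : R => (- t)%R) (- 1)%R by apply: is_deriveN.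
  have d2 := @is_derive1_comp _ _ _ _ _ _ (is_derive_expR (- x)%R) d1.
  by have := is_deriveN d2; rewrite mulrN1 opprK.
- rewrite -[X in _ --> X]oppr0; apply: cvgN.
  exact: cvgr_expR.
Qed.

Lemma Gamma_integral_ge0 (s : R) : 0 <= Gamma_integral s.
Proof.
rewrite Gamma_integral.unlock; apply: integral_ge0 => t _; rewrite lee_fin mulr_ge0 ?powR_ge0//; exact: expR_ge0.
Qed.

(** Integration by parts in the form of Tonelli's theorem: t^s is written as the integral of s
    w^(s-1) over 0 < w <= t, and the triangle is integrated in the other order. *)
Lemma Gamma_integralD1 (s : R) : (0 < s)%R ->
  Gamma_integral (s + 1) = s%:E * Gamma_integral s.
Proof.
move=> s0; rewrite !Gamma_integral.unlock addrK.
transitivity (\int[mu]_(t in Rpos) \int[mu]_(w in `]0%R, t])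
   (s * (w `^ (s - 1)) * expR (- t))%:E).
  apply: eq_integral => t /set_mem/Rpos_gt0 t0.
  transitivity (\int[mu]_(w in `]0%R, t]) ((s * expR (- t))%:E * (w `^ (s - 1))%:E)).
    rewrite ge0_integralZlR//; first last.
    - by move=> x _; rewrite lee_fin powR_ge0.
    - by apply: measurable_funTS; measurability.
    - by rewrite mulr_ge0 ?expR_ge0// ltW.
    rewrite integral_powR_at0// -EFinM; congr EFin.
    by field; rewrite gt_eqF.
  by apply: eq_integral => w _; rewrite -EFinM mulrAC.
rewrite (@fubini_tonelli_triangle (fun t w => s * w `^ (s - 1) * expR (- t))%R); first last.
- by move=> t w _ _; rewrite !mulr_ge0 ?powR_ge0 ?expR_ge0// ltW.
- by measurability.
rewrite -ge0_integralZlR//; first last.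
- by move=> x _; rewrite lee_fin mulr_ge0 ?powR_ge0 ?expR_ge0.
- by apply: measurable_funTS; measurability.
- exact: ltW.
apply: eq_integral => w /set_mem/Rpos_gt0 w0.
rewrite -EFinM mulrA EFinM -integral_expRN// -ge0_integralZlR//.
- by rewrite mulr_ge0 ?powR_ge0// ltW.
- by apply: measurable_funTS; measurability.
Qed.

Lemma Gamma_integral_lty (s : R) : (0 < s)%R -> Gamma_integral s < +oo.
Proof.
move=> s0; rewrite !Gamma_integral.unlock.
have mG : measurable_fun (setT : set R) (fun t => (t `^ (s - 1) * expR (- t))%:E : \bar R).
  by measurability.
have -> : Rpos = `]0%R, 1%R] `|` `]1%R, +oo[.
  apply/seteqP; split => x /=; rewrite !in_itv/= !andbT.
    by move=> ->/=; case: leP => //; [left|right].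
  by move=> [/andP[]//|]; exact: lt_trans.
have mG' A : measurable A ->
   measurable_fun A (fun t => (t `^ (s - 1) * expR (- t))%:E : \bar R).
  by move=> mA; exact: measurable_funS mG.
have G0 (x : R) : 0 <= (x `^ (s - 1) * expR (- x))%:E.
  by rewrite lee_fin mulr_ge0 ?powR_ge0 ?expR_ge0.
rewrite ge0_integral_setU//; first last.
- rewrite disj_set2E; apply/eqP/seteqP; split => // x [] /=; rewrite !in_itv/= andbT.
  by move=> /andP[_ x1] /(le_lt_trans x1); rewrite ltxx.
- by apply: mG'; exact: measurableU.
rewrite lte_add_pinfty//.
  apply: (@le_lt_trans _ _ (\int[mu]_(t in `]0%R, 1%R]) (t `^ (s - 1))%:E)).
    apply: ge0_le_integral => //; first exact: mG'.
    - by apply: measurable_funTS; measurability.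
    - move=> x /=; rewrite in_itv/= => /andP[x0 x1]; rewrite lee_fin.
      by rewrite ler_piMr ?powR_ge0// -expR0 ler_expR oppr_le0 ltW.
  by rewrite integral_powR_at0// ltry.
(* The maximum of t^(s+1) e^(-t), attained at t = s + 1; hence the integrand is at most C t^(-2)
   beyond 1. *)
pose C := expR ((s + 1) * (ln (s + 1) - 1)).
apply: (@le_lt_trans _ _ (\int[mu]_(t in `]1%R, +oo[) (C%:E * (t `^ (- 1 - 1))%:E))).
  apply: ge0_le_integral => //; first exact: mG'.
  - by apply: measurable_funeM; apply: measurable_funTS; measurability.
  move=> x /=; rewrite in_itv/= andbT => x1; rewrite -EFinM lee_fin.
  have x0 : (0 < x)%R by exact: lt_trans x1.
  have s10 : (0 < s + 1)%R by rewrite ltr_wpDl ?ltW.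
  rewrite /powR gt_eqF// -!expRD ler_expR.
  have : (ln (x / (s + 1)) <= x / (s + 1) - 1)%R.
    have := @le_ln1Dx R (x / (s + 1) - 1); rewrite subrKC; apply.
    by rewrite ltrBrDl subrr divr_gt0.
  rewrite ln_div ?posrE//.
  rewrite -(ler_pM2l s10) => H.
  have H2 : ((s + 1) * (x / (s + 1)) = x)%R by rewrite mulrC mulfVK ?gt_eqF.
  nra.
rewrite ge0_integralZlR//; first last.
- by move=> x _; rewrite lee_fin powR_ge0.
- by apply: measurable_funTS; measurability.
- exact: expR_ge0.
by rewrite integral_powR_aty// ?ltry// ?ltrN10// -EFinM ltry.
Qed.


Lemma integral_powR_scale (a t : R) (h : R -> R) : (0 < t)%R ->
  measurable_fun setT h -> (forall x, 0 < x -> 0 <= h x)%R ->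
  \int[mu]_(u in Rpos) (h (t * u) * u `^ (- a))%:E =
  (t `^ (a - 1))%:E * \int[mu]_(v in Rpos) (h v * v `^ (- a))%:E.
Proof.
move=> t0 mh h0; have pos u : Rpos u -> (0 <= h (t * u) * u `^ (- a))%R.
  by move=> /Rpos_gt0 u0; rewrite mulr_ge0 ?powR_ge0// h0// mulr_gt0.
rewrite [in RHS](@ge0_integral_scale0y _ t)//; first last.
- by move=> u u0; rewrite lee_fin mulr_ge0 ?powR_ge0// h0.
- by apply: measurable_funTS; measurability.
have mhu : measurable_fun setT (fun u => h (t * u)%R).
  exact: (measurableT_comp mh (mulrl_measurable _)).
transitivity ((t `^ (a - 1))%:E * (t%:E * ((t `^ (- a))%:E *
   \int[mu]_(u in Rpos) (h (t * u) * u `^ (- a))%:E))).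
  rewrite !muleA -!EFinM mulrAC -mulrA powRD ?(gt_eqF t0) ?implybT//.
  rewrite powR_inv1 ?ltW// powRN.
  have -> : (t `^ a * t^-1 * ((t `^ a)^-1 * t) = 1)%R.
    by field; rewrite !gt_eqF ?powR_gt0.
  by rewrite mul1e.
congr (_ * (_ * _)); rewrite -ge0_integralZlR ?powR_ge0//; last first.
  by apply: measurable_funTS; measurability.
apply: eq_integral => u /set_mem/Rpos_gt0 u0.
by rewrite -EFinM mulrCA powRM ?ltW.
Qed.

Lemma integral_expR_powR (a t : R) : (0 < t)%R ->
  \int[mu]_(u in Rpos) (expR (- (t * u)) * u `^ (- a))%:E =
  (t `^ (a - 1))%:E * Gamma_integral (1 - a).
Proof.
move=> t0; rewrite (@integral_powR_scale a t (fun x => expR (- x)%R))//.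
- rewrite Gamma_integral.unlock; congr (_ * _); apply: eq_integral => v _; rewrite mulrC.
  by congr (_ `^ _ * _)%:E; rewrite addrAC subrr add0r.
- by measurability.
Qed.

(** Again Tonelli on the triangle, with 1 - e^(-v) as the integral of e^(-w) up to v. The conditions
    a > 1 and a < 2 give convergence at infinity and at 0. *)
Lemma integral_1subexpR (a : R) : (1 < a < 2)%R ->
  \int[mu]_(v in Rpos) ((1 - expR (- v)) * v `^ (- a))%:E =
  ((a - 1)^-1)%:E * Gamma_integral (2 - a).
Proof.
move=> /andP[a1 a2].
have E v : (0 < v)%R -> \int[mu]_(w in `]0%R, v]) (expR (- w))%:E = (1 - expR (- v))%:E.
  move=> v0; have -> : (1 - expR (- v) = - expR (- v) - (- 1))%R by rewrite opprK addrC.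
  apply: (@ge0_FTC_at0 _ v (- 1) (fun t => expR (- t)%R) (fun t => - expR (- t))%R) => //.
  - move=> x _; apply: (@continuous_comp _ _ _ -%R expR); first exact: opp_continuous.
    exact: continuous_expR.
  - move=> x _.
    have d1 : is_derive x (1%R : R) (fun t : R => (- t)%R) (- 1)%R by apply: is_deriveN.
    have d2 := @is_derive1_comp _ _ _ _ _ _ (is_derive_expR (- x)%R) d1.
    by have := is_deriveN d2; rewrite mulrN1 opprK.
  - apply: cvg_at_right_filter; rewrite -expR0 -[X in expR X]oppr0.
    apply: cvgN; apply: (@continuous_comp _ _ _ -%R expR); first exact: opp_continuous.
    exact: continuous_expR.
transitivity (\int[mu]_(t in Rpos) \int[mu]_(w in `]0%R, t])
   (t `^ (- a) * expR (- w))%:E).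
  apply: eq_integral => t /set_mem/Rpos_gt0 t0.
  rewrite mulrC EFinM -E// -ge0_integralZlR ?powR_ge0//.
  by apply: measurable_funTS; measurability.
rewrite (@fubini_tonelli_triangle (fun t w => t `^ (- a) * expR (- w))%R); first last.
- by move=> t w _ _; rewrite mulr_ge0 ?powR_ge0 ?expR_ge0.
- by measurability.
rewrite !Gamma_integral.unlock -ge0_integralZlR; first last.
- by move=> x _; rewrite lee_fin mulr_ge0 ?powR_ge0 ?expR_ge0.
- by apply: measurable_funTS; measurability.
- by rewrite invr_ge0 subr_ge0 ltW.
- by [].
apply: eq_integral => w /set_mem/Rpos_gt0 w0.
transitivity (\int[mu]_(t in `]w, +oo[) ((expR (- w))%:E * (t `^ ((1 - a) - 1))%:E)).
  apply: eq_integral => t _; rewrite -EFinM mulrC; congr (_ * _ `^ _)%:E.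
  by rewrite addrAC subrr add0r.
rewrite ge0_integralZlR ?expR_ge0//; first last.
- by move=> x _; rewrite lee_fin powR_ge0.
- by apply: measurable_funTS; measurability.
rewrite integral_powR_aty ?subr_lt0// -!EFinM; congr EFin.
have -> : (2 - a - 1 = 1 - a)%R by ring.
have an0 : (a - 1 != 0)%R by rewrite subr_eq0 gt_eqF.
have -> : (1 - a = - (a - 1))%R by ring.
by field.
Qed.

Lemma Gamma_integral_fin (s : R) : (0 < s)%R -> Gamma_integral s \is a fin_num.
Proof. by move=> s0; rewrite ge0_fin_numE ?Gamma_integral_lty// Gamma_integral_ge0. Qed.

(** The factor Gamma(1 - m) (1 + u)^(m-1) is the integral of e^(-(1+u)t) t^(-m) over t; integrating
    over u first leaves two Gamma integrals. Both sides live in the extended reals, which makes the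
    identity a source of finiteness in [int_tan_fin]. *)
Lemma int_tanE (gam m : R) : (m < 1)%R -> (gam < 1)%R ->
  Gamma_integral (1 - m) * int_tan gam m = Gamma_integral (gam - m) * Gamma_integral (1 - gam).
Proof.
move=> m1 g1; rewrite -(fineK (Gamma_integral_fin (_ : 0 < 1 - m)%R)) ?subr_gt0//.
rewrite !int_tan.unlock -ge0_integralZlR//; first last.
- by move=> x /Rpos_gt0 x0; rewrite lee_fin mulr_ge0 ?powR_ge0.
- by apply: measurable_funTS; measurability.
- exact/fine_ge0/Gamma_integral_ge0.
transitivity (\int[mu]_(u in Rpos) \int[mu]_(t in Rpos)
    (expR (- ((1 + u) * t)) * t `^ (- m) * u `^ (- gam))%:E).
  apply: eq_integral => u /set_mem/Rpos_gt0 u0.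
  rewrite EFinM muleA fineK ?Gamma_integral_fin ?subr_gt0//.
  have u1 : (0 < 1 + u)%R by rewrite addr_gt0.
  rewrite [X in X * _]muleC -integral_expR_powR//.
  rewrite muleC -ge0_integralZlR ?powR_ge0//; last 2 first.
  - by apply: measurable_funTS; measurability.
  - by move=> x _; rewrite lee_fin mulr_ge0 ?powR_ge0 ?expR_ge0.
  by apply: eq_integral => t _; rewrite muleC.
transitivity (\int[mu]_(t in Rpos) \int[mu]_(u in Rpos)
    (expR (- ((1 + u) * t)) * t `^ (- m) * u `^ (- gam))%:E).
  apply: fubini_tonelli_setX => //; first by apply: measurable_funTS; measurability.
  by move=> u t _ _; rewrite lee_fin !mulr_ge0 ?powR_ge0 ?expR_ge0.
transitivity (\int[mu]_(t in Rpos)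
    ((fine (Gamma_integral (1 - gam)))%:E * (t `^ (gam - m - 1) * expR (- t))%:E)).
  apply: eq_integral => t /set_mem/Rpos_gt0 t0.
  transitivity ((t `^ (- m) * expR (- t))%:E *
      \int[mu]_(u in Rpos) (expR (- (t * u)) * u `^ (- gam))%:E).
    rewrite -ge0_integralZlR ?mulr_ge0 ?powR_ge0 ?expR_ge0//; last 2 first.
    - by apply: measurable_funTS; measurability.
    - by move=> u _; rewrite lee_fin mulr_ge0 ?powR_ge0 ?expR_ge0.
    apply: eq_integral => u _; rewrite -EFinM mulrDl mul1r opprD expRD (mulrC u).
    by congr EFin; ring.
  rewrite integral_expR_powR// muleA muleC -EFinM fineK; last first.
    by rewrite Gamma_integral_fin// subr_gt0.
  congr (_ * _%:E).
  rewrite (_ : gam - m - 1 = - m + (gam - 1))%R; last by ring.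
  by rewrite [(t `^ (- m + _))%R]powRD ?(gt_eqF t0) ?implybT//; ring.
rewrite ge0_integralZlR; first last.
- by move=> x _; rewrite lee_fin mulr_ge0 ?powR_ge0 ?expR_ge0.
- by apply: measurable_funTS; measurability.
- exact/fine_ge0/Gamma_integral_ge0.
- by [].
have g1' : (0 < 1 - gam)%R by rewrite subr_gt0.
by rewrite (fineK (Gamma_integral_fin g1')) [RHS]muleC; congr (_ * _);
  rewrite Gamma_integral.unlock.
Qed.

Lemma integral_1subexpRM (nu u : R) : (nu < 1)%R -> (0 < u)%R ->
  \int[mu]_(t in Rpos) ((1 - expR (- (t * u))) * (t `^ (- nu) * expR (- t)))%:E =
  (1 - (1 + u) `^ (nu - 1))%:E * Gamma_integral (1 - nu).
Proof.
move=> nu1 u0; have nup : (0 < 1 - nu)%R by rewrite subr_gt0.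
have u1 : (0 < 1 + u)%R by rewrite ltr_wpDl ?ltW.
set J := LHS.
have mJ : measurable_fun Rpos
   (fun t => ((1 - expR (- (t * u))) * (t `^ (- nu) * expR (- t)))%:E : \bar R).
  by apply: measurable_funTS; measurability.
have J0 t : Rpos t -> 0 <= ((1 - expR (- (t * u))) * (t `^ (- nu) * expR (- t)))%:E.
  move=> /Rpos_gt0 t0; rewrite lee_fin !mulr_ge0 ?powR_ge0 ?expR_ge0//.
  by rewrite subr_ge0 -expR0 ler_expR oppr_le0 mulr_ge0// ltW.
have E : Gamma_integral (1 - nu) = J + ((1 + u) `^ (nu - 1))%:E * Gamma_integral (1 - nu).
  rewrite -integral_expR_powR// -ge0_integralD//; last 2 first.
  - by move=> t _; rewrite lee_fin mulr_ge0 ?powR_ge0 ?expR_ge0.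
  - by apply: measurable_funTS; measurability.
  rewrite Gamma_integral.unlock; apply: eq_integral => t _; rewrite -EFinD; congr EFin.
  rewrite (_ : - ((1 + u) * t) = - t + - (t * u))%R; last by ring.
  by rewrite expRD (_ : 1 - nu - 1 = - nu)%R; ring.
rewrite EFinB muleBl ?Gamma_integral_fin// mul1e [in X in X - _]E addeK//.
by rewrite fin_numM// Gamma_integral_fin.
Qed.

(** The method of [int_tanE] with e^(-tu) replaced by 1 - e^(-tu), so that the inner integral over u
    is [integral_1subexpR] after scaling. *)
Lemma int_radE (a nu : R) : (1 < a < 2)%R -> (nu < 1)%R ->
  Gamma_integral (1 - nu) * int_rad a nu =
  ((a - 1)^-1)%:E * (Gamma_integral (a - nu) * Gamma_integral (2 - a)).
Proof.
move=> /andP[a1 a2] nu1.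
have nup : (0 < 1 - nu)%R by rewrite subr_gt0.
have P1u u : (0 < u)%R -> (0 <= 1 - (1 + u) `^ (nu - 1))%R.
  move=> u0; have := @gtr0_ler_powRN R (nu - 1)%R 1%R (1 + u)%R.
  by rewrite powR1 subr_ge0; apply; rewrite ?lerDl ?subr_le0 ?ltW.
rewrite -(fineK (Gamma_integral_fin nup)) !int_rad.unlock -ge0_integralZlR//; first last.
- by move=> x /Rpos_gt0 x0; rewrite lee_fin mulr_ge0 ?powR_ge0 ?P1u.
- by apply: measurable_funTS; measurability.
- exact/fine_ge0/Gamma_integral_ge0.
have P2 (t u : R) : (0 < t)%R -> (0 < u)%R -> (0 <= 1 - expR (- (t * u)))%R.
  by move=> t0 u0; rewrite subr_ge0 -expR0 ler_expR oppr_le0 mulr_ge0// ltW.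
transitivity (\int[mu]_(u in Rpos) \int[mu]_(t in Rpos)
    (u `^ (- a) * ((1 - expR (- (t * u))) * (t `^ (- nu) * expR (- t))))%:E).
  apply: eq_integral => u /set_mem/Rpos_gt0 u0.
  rewrite EFinM muleA fineK ?Gamma_integral_fin//.
  rewrite [X in X * _]muleC -integral_1subexpRM// muleC -ge0_integralZlR ?powR_ge0//.
  - by apply: measurable_funTS; measurability.
  - move=> t /Rpos_gt0 t0.
    by rewrite lee_fin !mulr_ge0 ?powR_ge0 ?expR_ge0 ?P2.
transitivity (\int[mu]_(t in Rpos) \int[mu]_(u in Rpos)
    (u `^ (- a) * ((1 - expR (- (t * u))) * (t `^ (- nu) * expR (- t))))%:E).
  apply: fubini_tonelli_setX => //; first by apply: measurable_funTS; measurability.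
  move=> u t /Rpos_gt0 u0 /Rpos_gt0 t0.
  by rewrite lee_fin !mulr_ge0 ?powR_ge0 ?expR_ge0 ?P2.
have Ca : (0 <= (a - 1)^-1)%R by rewrite invr_ge0 subr_ge0 ltW.
have a2' : (0 < 2 - a)%R by rewrite subr_gt0.
transitivity (\int[mu]_(t in Rpos)
    (((a - 1)^-1 * fine (Gamma_integral (2 - a)))%:E * (t `^ (a - nu - 1) * expR (- t))%:E)).
  apply: eq_integral => t /set_mem/Rpos_gt0 t0.
  transitivity ((t `^ (- nu) * expR (- t))%:E *
      \int[mu]_(u in Rpos) ((1 - expR (- (t * u))) * u `^ (- a))%:E).
    rewrite -ge0_integralZlR ?mulr_ge0 ?powR_ge0 ?expR_ge0//; last 2 first.
    - by apply: measurable_funTS; measurability.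
    - by move=> u /Rpos_gt0 u0; rewrite lee_fin mulr_ge0 ?powR_ge0 ?P2.
    by apply: eq_integral => u _; rewrite -EFinM; congr EFin; ring.
  rewrite (@integral_powR_scale a t (fun x => 1 - expR (- x))%R)//; first last.
  - by move=> x x0; rewrite subr_ge0 -expR0 ler_expR oppr_le0 ltW.
  - by measurability.
  rewrite integral_1subexpR ?a1// -[X in _ * (_ * (_ * X))](fineK (Gamma_integral_fin a2')).
  rewrite -!EFinM; congr EFin.
  rewrite (_ : a - nu - 1 = - nu + (a - 1))%R; last by ring.
  by rewrite [(t `^ (- nu + _))%R]powRD ?(gt_eqF t0) ?implybT//; ring.
rewrite ge0_integralZlR; first last.
- by move=> x _; rewrite lee_fin mulr_ge0 ?powR_ge0 ?expR_ge0.
- by apply: measurable_funTS; measurability.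
- by rewrite mulr_ge0//; exact/fine_ge0/Gamma_integral_ge0.
- by [].
by rewrite EFinM (fineK (Gamma_integral_fin a2')) -muleA [in RHS](muleC (Gamma_integral (a - nu))); congr (_ * (_ * _));
  rewrite Gamma_integral.unlock.
Qed.

End GammaBeta.

(** * Bounds on Euler's integral and the Gamma function of the statement *)

Section GammaFunction.
Context {R : realType}.
Local Notation mu := (@lebesgue_measure R).
Local Notation Rpos := (`]0%R, +oo[%classic : set R).

(** Besides positivity this records the pole at 0, which forces [int_rad] to vanish as nu tends to
    1. *)
Lemma Gamma_integral_ge (s : R) : 0 < s ->
  ((expR (- 1) / s)%:E <= Gamma_integral s)%E.
Proof.
move=> s0.
have mG : measurable_fun (setT : set R) (fun t => (t `^ (s - 1) * expR (- t))%:E : \bar R).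
  by measurability.
have -> : ((expR (- 1) / s)%:E = \int[mu]_(t in `]0%R, 1%R]) ((expR (- 1))%:E * (t `^ (s - 1))%:E))%E.
  rewrite ge0_integralZlR ?expR_ge0//; first last.
  - by move=> x _; rewrite lee_fin powR_ge0.
  - by apply: measurable_funTS; measurability.
  by rewrite integral_powR_at0// powR1 -EFinM mul1r.
apply: (@le_trans _ _ (\int[mu]_(t in `]0%R, 1%R]) (t `^ (s - 1) * expR (- t))%:E)%E).
  apply: ge0_le_integral => //.
  - by move=> x _; rewrite -EFinM lee_fin mulr_ge0 ?powR_ge0 ?expR_ge0.
  - by apply: measurable_funeM; apply: measurable_funTS; measurability.
  - by apply: measurable_funTS.
  - move=> x /=; rewrite in_itv/= => /andP[x0 x1]; rewrite -EFinM lee_fin mulrC.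
    by apply: ler_wpM2l; rewrite ?powR_ge0// ler_expR lerN2.
rewrite Gamma_integral.unlock; apply: ge0_subset_integral => //.
- by apply: measurable_funTS.
- by move=> x _; rewrite lee_fin mulr_ge0 ?powR_ge0 ?expR_ge0.
- by move=> x /=; rewrite !in_itv/= andbT => /andP[].
Qed.

Lemma Gamma_integral_le_add (s1 s s2 : R) : s1 <= s <= s2 ->
  (Gamma_integral s <= Gamma_integral s1 + Gamma_integral s2)%E.
Proof.
move=> /andP[s1s ss2]; rewrite !Gamma_integral.unlock -ge0_integralD//; last 4 first.
- by move=> x _; rewrite lee_fin mulr_ge0 ?powR_ge0 ?expR_ge0.
- by apply: measurable_funTS; measurability.
- by move=> x _; rewrite lee_fin mulr_ge0 ?powR_ge0 ?expR_ge0.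
- by apply: measurable_funTS; measurability.
apply: ge0_le_integral => //.
- by move=> x _; rewrite lee_fin mulr_ge0 ?powR_ge0 ?expR_ge0.
- by apply: measurable_funTS; measurability.
- apply: measurable_funTS; apply: emeasurable_funD; measurability.
move=> x /Rpos_gt0 x0; rewrite -EFinD lee_fin -mulrDl ler_wpM2r ?expR_ge0//.
have [x1|x1] := leP x 1.
  rewrite -[leLHS]addr0 lerD ?powR_ge0//; apply: ger_powR; rewrite ?x0//.
  by rewrite lerB.
rewrite -[leLHS]add0r lerD ?powR_ge0//; apply: ler_powR; first exact: ltW.
by rewrite lerB.
Qed.

Lemma int_tan_ge0 (gam m : R) : (0 <= int_tan gam m)%E.
Proof. by rewrite int_tan.unlock; apply: integral_ge0 => u _; rewrite lee_fin mulr_ge0 ?powR_ge0. Qed.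

Lemma powRDx_le1 (nu u : R) : nu <= 1 -> 0 < u -> 0 <= 1 - (1 + u) `^ (nu - 1).
Proof.
move=> nu1 u0; have := @gtr0_ler_powRN R (nu - 1) 1 (1 + u).
by rewrite powR1 subr_ge0; apply; rewrite ?lerDl ?subr_le0// ltW.
Qed.

Lemma int_rad_ge0 (a nu : R) : nu <= 1 -> (0 <= int_rad a nu)%E.
Proof.
move=> nu1; rewrite int_rad.unlock; apply: integral_ge0 => u /Rpos_gt0 u0.
by rewrite lee_fin mulr_ge0 ?powR_ge0// powRDx_le1.
Qed.

Lemma EulerGammaIntE (s : R) : EulerGammaInt s = fine (Gamma_integral s).
Proof. by rewrite Gamma_integral.unlock. Qed.

Lemma fine_Gamma_integral_ge (s : R) : 0 < s -> expR (- 1) / s <= fine (Gamma_integral s).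
Proof.
by move=> s0; rewrite -lee_fin fineK ?Gamma_integral_fin//; exact: Gamma_integral_ge.
Qed.

Lemma fine_Gamma_integral_gt0 (s : R) : 0 < s -> 0 < fine (Gamma_integral s).
Proof.
move=> s0; apply: lt_le_trans (fine_Gamma_integral_ge s0).
by rewrite divr_gt0 ?expR_gt0.
Qed.

(** Here -s < 1, so the truncation is 0 and the definition shifts the argument exactly once. The
    only negative argument met for nu in (0, 1) is 1 - alpha, in (-1, 0). *)
Lemma GammaN1E (s : R) : -1 < s -> Gamma s = fine (Gamma_integral (s + 1)) / s.
Proof.
move=> s1; have -> : Gamma s = EulerGammaInt (s + 1) / s.
  rewrite /Gamma; have -> : Num.truncn (- s) = 0%N.
    by apply/truncn0Pn; rewrite -ltNge ltrNl.
  by rewrite big_ord_recl big_ord0 addr0 mulr1.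
by rewrite EulerGammaIntE.
Qed.

Lemma Gamma_gt0E (s : R) : 0 < s -> Gamma s = fine (Gamma_integral s).
Proof.
move=> s0; rewrite GammaN1E; last by rewrite (lt_trans _ s0)// ltrN10.
by rewrite Gamma_integralD1// fineM ?Gamma_integral_fin//= mulrAC mulfV ?gt_eqF// mul1r.
Qed.




Lemma int_tan_fin (gam m : R) : m < gam -> gam < 1 -> int_tan gam m \is a fin_num.
Proof.
move=> mg g1; have m1 := lt_trans mg g1.
rewrite ge0_fin_numE ?int_tan_ge0// ltNge leye_eq; apply/eqP => E.
have /(congr1 (fun x => x \is a fin_num)) := int_tanE m1 g1.
rewrite E gt0_muley; last first.
  by apply: lt_le_trans (Gamma_integral_ge _); rewrite ?subr_gt0// lte_fin divr_gt0 ?expR_gt0 ?subr_gt0.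
by rewrite fin_numM ?Gamma_integral_fin ?subr_gt0.
Qed.

Lemma int_rad_fin (a nu : R) : 1 < a < 2 -> nu < 1 -> int_rad a nu \is a fin_num.
Proof.
move=> a12 nu1; have /andP[a1 a2] := a12.
rewrite ge0_fin_numE ?int_rad_ge0 ?ltW// ltNge leye_eq; apply/eqP => E.
have /(congr1 (fun x => x \is a fin_num)) := int_radE a12 nu1.
rewrite E gt0_muley; last first.
  by apply: lt_le_trans (Gamma_integral_ge _); rewrite ?subr_gt0// lte_fin divr_gt0 ?expR_gt0 ?subr_gt0.
rewrite !fin_numM ?Gamma_integral_fin ?subr_gt0//.
exact: lt_trans a1.
Qed.

Lemma GammaM_tan (gam m : R) : m < gam -> 0 < gam < 1 ->
  Gamma (gam - m) * Gamma (1 - gam) / Gamma (1 - m) = fine (int_tan gam m).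
Proof.
move=> mg /andP[g0 g1]; have m1 := lt_trans mg g1.
rewrite !Gamma_gt0E ?subr_gt0//.
have /(congr1 fine) := int_tanE m1 g1.
rewrite !fineM ?Gamma_integral_fin ?int_tan_fin ?subr_gt0// => <-.
by rewrite mulrAC mulfV ?mul1r// gt_eqF// fine_Gamma_integral_gt0// subr_gt0.
Qed.

Let GammaM_rad_alg (A B C J a : R) : C != 0 -> a - 1 != 0 ->
  C * J = (a - 1)^-1 * (A * B) -> A * (B / (1 - a)) / C = - J.
Proof.
move=> C0 a0 E; have a0' : 1 - a != 0 by rewrite -opprB oppr_eq0.
by apply: (mulfI C0); rewrite mulrN E; field; rewrite a0' a0 C0.
Qed.

Let fine_mulE (w x y z : \bar R) (k : R) : w \is a fin_num -> x \is a fin_num ->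
  y \is a fin_num -> z \is a fin_num -> (w * x = k%:E * (y * z))%E ->
  fine w * fine x = k * (fine y * fine z).
Proof.
by move: w x y z => [w| |]// [x| |]// [y| |]// [z| |]// _ _ _ _; rewrite -!EFinM => -[].
Qed.

Lemma fine_int_radE (a nu : R) : 1 < a < 2 -> nu < 1 ->
  fine (Gamma_integral (1 - nu)) * fine (int_rad a nu) =
  (a - 1)^-1 * (fine (Gamma_integral (a - nu)) * fine (Gamma_integral (2 - a))).
Proof.
move=> a12 nu1; have /andP[a1 a2] := a12.
apply: (fine_mulE _ _ _ _ (int_radE a12 nu1)).
- by apply: Gamma_integral_fin; rewrite subr_gt0.
- exact: int_rad_fin.
- by apply: Gamma_integral_fin; rewrite subr_gt0 (lt_trans nu1).
- by apply: Gamma_integral_fin; rewrite subr_gt0.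
Qed.

Lemma fine_Gamma_integral_le_add (s1 s s2 : R) : 0 < s1 -> s1 <= s <= s2 ->
  fine (Gamma_integral s) <= fine (Gamma_integral s1) + fine (Gamma_integral s2).
Proof.
move=> s10 /[dup] /andP[s1s ss2] H.
have s0 : 0 < s by exact: lt_le_trans s1s.
have s20 : 0 < s2 by exact: lt_le_trans ss2.
have := Gamma_integral_le_add H.
have := Gamma_integral_fin s0; have := Gamma_integral_fin s10; have := Gamma_integral_fin s20.
by move: (Gamma_integral s) (Gamma_integral s1) (Gamma_integral s2) => [x| |]// [y| |]// [z| |]//.
Qed.

Lemma GammaM_rad (a nu : R) : 1 < a < 2 -> nu < 1 ->
  Gamma (a - nu) * Gamma (1 - a) / Gamma (1 - nu) = - fine (int_rad a nu).
Proof.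
move=> a12 nu1; have /andP[a1 a2] := a12.
have na : 0 < a - nu by rewrite subr_gt0 (lt_trans nu1).
rewrite (Gamma_gt0E na) (Gamma_gt0E (_ : 0 < 1 - nu)) ?subr_gt0// GammaN1E; last first.
  by rewrite ltrBrDl; lra.
rewrite (_ : 1 - a + 1 = 2 - a); last by ring.
apply: GammaM_rad_alg (fine_int_radE a12 nu1).
  by rewrite gt_eqF// fine_Gamma_integral_gt0// subr_gt0.
by rewrite subr_eq0 gt_eqF.
Qed.


(** In the Gamma quotient for [int_rad] the denominator Gamma(1 - nu) is at least a multiple of 1 /
    (1 - nu), while Gamma(a - nu) stays below Gamma(a - 1) + Gamma(a). *)
Lemma int_rad_near1 (a : R) : 1 < a < 2 -> exists C : R, forall nu, 0 <= nu < 1 ->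
  fine (int_rad a nu) <= C * (1 - nu).
Proof.
move=> a12; have /andP[a1 a2] := a12.
have aa : 0 < a - 1 by rewrite subr_gt0.
have a0 : 0 < a by exact: lt_trans a1.
have a2' : 0 < 2 - a by rewrite subr_gt0.
pose B := fine (Gamma_integral (a - 1)) + fine (Gamma_integral a).
pose A := fine (Gamma_integral (2 - a)).
exists ((a - 1)^-1 * (B * A) / expR (- 1)) => nu /andP[nu0 nu1].
have nup : 0 < 1 - nu by rewrite subr_gt0.
have na : 0 < a - nu by rewrite subr_gt0 (lt_trans nu1).
have H1 : fine (Gamma_integral (a - nu)) <= B.
  apply: fine_Gamma_integral_le_add => //; apply/andP; split; lra.
have E := fine_int_radE a12 nu1.
have H2 := fine_Gamma_integral_ge nup.
have A0 : 0 <= A by exact/ltW/fine_Gamma_integral_gt0.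
have e0 : 0 < expR (- 1) :> R by exact: expR_gt0.
have J0 : 0 <= fine (int_rad a nu) by apply: fine_ge0; exact/int_rad_ge0/ltW.
rewrite mulrAC ler_pdivlMr//.
have : expR (- 1) / (1 - nu) * fine (int_rad a nu) <= (a - 1)^-1 * (B * A).
  apply: (le_trans (ler_wpM2r J0 H2)); rewrite E.
  apply: ler_wpM2l; first by rewrite invr_ge0 ltW.
  exact: ler_wpM2r.
by rewrite mulrAC ler_pdivrMr// mulrC.
Qed.

End GammaFunction.

(** * The drift exponent *)

(* The function D of the header, with a = alpha, A = pR cR and B = pT cT. *)
HB.lock Definition drift_exp {R : realType} (a A B nu : R) : R :=
  - (A * fine (int_rad a nu)) + B * fine (int_tan (a / 2) (nu / 2)).

Section DriftExponent.
Context {R : realType}.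
Local Notation mu := (@lebesgue_measure R).
Local Notation Rpos := (`]0%R, +oo[%classic : set R).

Lemma le_int_rad (a nu nu' : R) : nu <= nu' <= 1 -> (int_rad a nu' <= int_rad a nu)%E.
Proof.
move=> /andP[nunu nu1]; rewrite int_rad.unlock; apply: ge0_le_integral => //.
- by move=> u /Rpos_gt0 u0; rewrite lee_fin mulr_ge0 ?powR_ge0// powRDx_le1.
- by apply: measurable_funTS; measurability.
- by apply: measurable_funTS; measurability.
move=> u /Rpos_gt0 u0; rewrite lee_fin ler_wpM2r ?powR_ge0// lerB//.
by apply: ler_powR; rewrite ?lerDl ?(ltW u0)// lerB.
Qed.

Lemma lt_int_tan (gam m m' : R) : m < m' -> m' < gam -> 0 <= gam < 1 ->
  fine (int_tan gam m) < fine (int_tan gam m').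
Proof.
move=> mm' m'g /andP[g0 g1]; have m1 : m < 1 by lra.
(* A lower bound for the difference of the integrands on ]1, 2], where 1 + u lies between 2 and 3;
   the interval has length 1, so c also bounds the difference of the integrals. *)
pose c := 3 `^ (m - 1) * (2 `^ (m' - m) - 1) * 2 `^ (- gam).
have c0 : 0 < c.
  rewrite !mulr_gt0 ?powR_gt0// subr_gt0 -[ltLHS](powRr0 2).
  by rewrite /powR pnatr_eq0/= ltr_expR mul0r mulr_gt0 ?subr_gt0 ?ln_gt0// ltr1n.
have mf p : measurable_fun (setT : set R)
    (fun u : R => ((1 + u) `^ (p - 1) * u `^ (- gam))%:E).
  by measurability.
have m12 : measurable (`]1, 2]%classic : set R) by [].
suff : (int_tan gam m + c%:E <= int_tan gam m')%E.
  have := int_tan_fin (lt_trans mm' m'g) g1; have := int_tan_fin m'g g1.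
  move: (int_tan gam m) (int_tan gam m') => [x| |]// [y| |]// _ _.
  by rewrite -EFinD lee_fin /=; apply: lt_le_trans; rewrite ltrDl.
have -> : c%:E = (\int[mu]_(u in Rpos) (c * \1_(`]1, 2]%classic : set R) u)%:E)%E.
  under eq_integral do rewrite EFinM.
  rewrite ge0_integralZlR ?(ltW c0)//; last first.
    by apply/measurable_EFinP; exact: measurable_funTS.
  rewrite integral_indic// (_ : _ `&` _ = `]1, 2]%classic); last first.
    apply/seteqP; split => u /=; rewrite !in_itv/= andbT; first by case.
    by move=> /andP[u1 u2]; split; rewrite ?u1// (lt_trans _ u1).
  rewrite [X in (_ * X)%E](_ : _ = 1%E) ?mule1//.
  transitivity (mu `]1%R, 2%R]); first by [].
  rewrite lebesgue_measure_itv/= lte_fin ltr1n -EFinB; congr EFin; ring.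
rewrite !int_tan.unlock -ge0_integralD//; last 4 first.
- by move=> u _; rewrite lee_fin mulr_ge0 ?powR_ge0.
- by apply: measurable_funTS; exact: mf.
- by move=> u _; rewrite lee_fin mulr_ge0// ltW.
- apply: measurable_funTS; apply/measurable_EFinP; apply: measurable_funM => //.
apply: ge0_le_integral => //.
- by move=> u _; rewrite -EFinD lee_fin addr_ge0 ?(mulr_ge0 (ltW c0))//; rewrite mulr_ge0 ?powR_ge0.
- apply: measurable_funTS; apply: emeasurable_funD; first exact: mf.
  by apply/measurable_EFinP; apply: measurable_funM.
- by apply: measurable_funTS; exact: mf.
move=> u /Rpos_gt0 u0; rewrite -EFinD lee_fin.
have u1 : 0 < 1 + u by rewrite addr_gt0.
have mono : (1 + u) `^ (m - 1) <= (1 + u) `^ (m' - 1).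
  by apply: ler_powR; rewrite ?lerDl ?(ltW u0)// lerB// ltW.
rewrite indicE mem_setE; case: (boolP (u \in `]1, 2])); rewrite in_itv/=; last first.
  by rewrite mulr0 addr0 ler_wpM2r ?powR_ge0.
move=> /andP[ul uu]; rewrite mulr1 -lerBrDl -mulrBl.
have -> : m' - 1 = (m - 1) + (m' - m) by ring.
rewrite powRD ?(gt_eqF u1) ?implybT// -[X in _ <= (_ - X) * _]mulr1 -mulrBr.
rewrite /c; apply: ler_pM; rewrite ?mulr_ge0 ?powR_ge0//.
- rewrite subr_ge0 -[leLHS](powRr0 2); apply: ler_powR; first by rewrite ler1n.
  by rewrite subr_ge0 ltW.
- apply: ler_pM; rewrite ?powR_ge0//.
  + rewrite subr_ge0 -[leLHS](powRr0 2); apply: ler_powR; first by rewrite ler1n.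
    by rewrite subr_ge0 ltW.
  + by apply: gtr0_ler_powRN => //; lra.
  + rewrite lerB//; apply: ge0_ler_powR; rewrite ?nnegrE; lra.
- by apply: gtr0_ler_powRN => //; lra.
Qed.

Lemma lt_drift_exp (a A B nu nu' : R) : 1 < a < 2 -> 0 <= A -> 0 < B ->
  nu < nu' -> nu' < 1 -> drift_exp a A B nu < drift_exp a A B nu'.
Proof.
move=> a12 A0 B0 nunu nu1; have /andP[a1 a2] := a12.
rewrite !drift_exp.unlock; apply: ler_ltD.
  rewrite lerN2; apply: ler_wpM2l => //.
  have H : (int_rad a nu' <= int_rad a nu)%E by apply: le_int_rad; rewrite !ltW.
  have := int_rad_fin a12 nu1; have := int_rad_fin a12 (lt_trans nunu nu1).
  by move: (int_rad a nu) (int_rad a nu') H => [x| |]// [y| |]//.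
by rewrite ltr_pM2l//; apply: lt_int_tan; lra.
Qed.

Lemma continuous_powRr (b x : R) : 0 < b -> {for x, continuous (fun s : R => b `^ (s - 1))}.
Proof.
move=> b0; rewrite (_ : (fun s => b `^ (s - 1)) = expR \o (fun s => (s - 1) * ln b)); last first.
  by apply/funext => s; rewrite /= /powR gt_eqF.
apply: continuous_comp; last exact: continuous_expR.
apply: cvgM; last exact: cvg_cst.
by apply: cvgB; [exact: cvg_id|exact: cvg_cst].
Qed.

Lemma integrable_ge0_fin (f : R -> R) : measurable_fun setT f ->
  (forall u, 0 < u -> 0 <= f u) -> (\int[mu]_(u in Rpos) (f u)%:E)%E \is a fin_num ->
  mu.-integrable Rpos (EFin \o f).
Proof.
move=> mf f0 fin; apply/integrableP; split.
  by apply: measurable_funTS; exact/measurable_EFinP.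
move: fin; rewrite ge0_fin_numE; last by apply: integral_ge0 => u /Rpos_gt0/f0; rewrite lee_fin.
apply: le_lt_trans; rewrite le_eqVlt; apply/orP; left; apply/eqP.
by apply: eq_integral => u /set_mem/Rpos_gt0/f0 fu; rewrite /= ger0_norm.
Qed.

(** Dominated convergence: the integrand decreases in the exponent, so its value at the endpoint -1
    dominates. *)
Lemma continuous_int_rad (a nu : R) : 1 < a < 2 -> -1 < nu < 1 ->
  {for nu, continuous (fun p : R => fine (int_rad a p))}.
Proof.
move=> a12 nu11.
have mf p : measurable_fun (setT : set R) (fun u : R => (1 - (1 + u) `^ (p - 1)) * u `^ (- a)).
  by measurability.
have f0 p u : p <= 1 -> 0 < u -> 0 <= (1 - (1 + u) `^ (p - 1)) * u `^ (- a).
  by move=> p1 u0; rewrite mulr_ge0 ?powR_ge0// powRDx_le1.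
have intf p : p < 1 -> mu.-integrable Rpos (EFin \o (fun u : R => (1 - (1 + u) `^ (p - 1)) * u `^ (- a))).
  move=> p1; apply: integrable_ge0_fin => //; last by have := int_rad_fin a12 p1; rewrite int_rad.unlock.
  by move=> u; apply: f0; exact: ltW.
rewrite ?int_rad.unlock ?int_tan.unlock; apply: (@continuity_under_integral R _ _ mu
  (fun p (u : R) => (1 - (1 + u) `^ (p - 1)) * u `^ (- a)) Rpos _ (-1) 1 _ _
  (fun u : R => (1 - (1 + u) `^ (-1 - 1)) * u `^ (- a)) _ _ nu) => //.
- by move=> p /=; rewrite in_itv/= => /andP[_]; exact: intf.
- apply: aeW => u /Rpos_gt0 u0 p _.
  apply: cvgM; last exact: cvg_cst.
  apply: cvgB; first exact: cvg_cst.
  by apply: continuous_powRr; rewrite addr_gt0.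
- by apply: intf; rewrite (lt_trans _ ltr01)// ltrN10.
- move=> p /=; rewrite in_itv/= => /andP[p1 p2]; apply: aeW => u /Rpos_gt0 u0.
  rewrite ger0_norm ?f0 ?(ltW p2)// ler_wpM2r ?powR_ge0// lerB//.
  by apply: ler_powR; rewrite ?lerDl ?(ltW u0)// lerB// ltW.
- by rewrite inE/= in_itv.
Qed.

(** The integrand increases in the exponent, so its value at p = 1 dominates; it decays like u^(-1/2
    - gam), integrable because gam > 1/2. *)
Lemma continuous_int_tan (gam nu : R) : 1 / 2 < gam < 1 -> -1 < nu < 1 ->
  {for nu, continuous (fun p : R => fine (int_tan gam (p / 2)))}.
Proof.
move=> /andP[g0 g1] nu11.
have mf p : measurable_fun (setT : set R) (fun u : R => (1 + u) `^ (p / 2 - 1) * u `^ (- gam)).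
  by measurability.
have f0 p u : 0 < u -> 0 <= (1 + u) `^ (p / 2 - 1) * u `^ (- gam).
  by move=> u0; rewrite mulr_ge0 ?powR_ge0.
have intf p : p <= 1 -> mu.-integrable Rpos (EFin \o (fun u : R => (1 + u) `^ (p / 2 - 1) * u `^ (- gam))).
  move=> p1; apply: integrable_ge0_fin => //; last first.
    by have := @int_tan_fin R gam (p / 2); rewrite int_tan.unlock; apply => //; lra.
  by move=> u; exact: f0.
rewrite ?int_rad.unlock ?int_tan.unlock; apply: (@continuity_under_integral R _ _ mu
  (fun p (u : R) => (1 + u) `^ (p / 2 - 1) * u `^ (- gam)) Rpos _ (-1) 1 _ _
  (fun u : R => (1 + u) `^ (1 / 2 - 1) * u `^ (- gam)) _ _ nu) => //.
- by move=> p /=; rewrite in_itv/= => /andP[_ /ltW]; exact: intf.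
- apply: aeW => u /Rpos_gt0 u0 p _.
  apply: cvgM; last exact: cvg_cst.
  apply: (@continuous_comp _ _ _ (fun p : R => p / 2) (fun s => (1 + u) `^ (s - 1))).
    by apply: cvgM; [exact: cvg_id|exact: cvg_cst].
  by apply: continuous_powRr; rewrite addr_gt0.
- exact: intf.
- move=> p /=; rewrite in_itv/= => /andP[p1 p2]; apply: aeW => u /Rpos_gt0 u0.
  rewrite ger0_norm ?f0// ler_wpM2r ?powR_ge0//.
  apply: ler_powR; rewrite ?lerDl ?(ltW u0)//; lra.
- by rewrite inE/= in_itv.
Qed.


Lemma continuous_drift_exp (a A B nu : R) : 1 < a < 2 -> -1 < nu < 1 ->
  {for nu, continuous (drift_exp a A B)}.
Proof.
move=> a12 nu11; have /andP[a1 a2] := a12.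
rewrite drift_exp.unlock; apply: cvgD.
  by apply: cvgN; apply: cvgM; [exact: cvg_cst|exact: continuous_int_rad].
apply: cvgM; [exact: cvg_cst|apply: continuous_int_tan => //; lra].
Qed.

Lemma drift_exp_gt0_near1 (a A B : R) : 1 < a < 2 -> 0 <= A -> 0 < B ->
  exists2 b, 0 < b < 1 & 0 < drift_exp a A B b.
Proof.
move=> a12 A0 B0; have /andP[a1 a2] := a12.
have [C HC] := int_rad_near1 a12.
pose T := B * fine (int_tan (a / 2) 0).
have T0 : 0 < T.
  rewrite mulr_gt0//.
  have : fine (int_tan (a / 2) (-1)) < fine (int_tan (a / 2) 0) by apply: lt_int_tan; lra.
  by apply: le_lt_trans; apply: fine_ge0; exact: int_tan_ge0.
(* At nu = 1 - e the radial loss is at most A |C| e, and this e makes it less than T, which is less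
   than the tangential contribution at nu. *)
pose e := T / (A * `|C| + T + T).
have D0 : 0 < A * `|C| + T + T.
  by apply: addr_gt0 => //; apply: ltr_wpDl => //; rewrite mulr_ge0.
have e0 : 0 < e by rewrite divr_gt0.
have e1 : e < 1.
  by rewrite ltr_pdivrMr// mul1r ltrDr ltr_wpDl// mulr_ge0.
exists (1 - e); first by lra.
have H1 : fine (int_rad a (1 - e)) <= C * e.
  by apply: le_trans (HC (1 - e) _) _; [lra|rewrite opprB addrCA subrr addr0].
have H2 : fine (int_tan (a / 2) 0) < fine (int_tan (a / 2) ((1 - e) / 2)).
  by apply: lt_int_tan; lra.
have H3 : A * fine (int_rad a (1 - e)) <= A * `|C| * e.
  rewrite -mulrA; apply: ler_wpM2l => //; apply: le_trans H1 _.
  by apply: ler_wpM2r; [exact: ltW|exact: ler_norm].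
have H4 : A * `|C| * e < T.
  rewrite /e mulrA ltr_pdivrMr// mulrC ltr_pM2l// -addrA ltrDl; lra.
have H5 : T < B * fine (int_tan (a / 2) ((1 - e) / 2)) by rewrite ltr_pM2l.
rewrite !drift_exp.unlock; lra.
Qed.

Lemma drift_exp_root (a A B : R) : 1 < a < 2 -> 0 <= A -> 0 < B ->
  drift_exp a A B 0 < 0 -> exists2 nu, 0 < nu < 1 & drift_exp a A B nu = 0.
Proof.
move=> a12 A0 B0 H0; have [b /andP[b0 b1] Hb] := drift_exp_gt0_near1 a12 A0 B0.
have [||c] := @IVT R (drift_exp a A B) 0 b 0 (ltW b0).
- apply: continuous_in_subspaceT => x; rewrite inE/= in_itv/= => /andP[x0 xb].
  by apply: continuous_drift_exp => //; lra.
- by rewrite ge_min le_max (ltW H0) (ltW Hb) orbT.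
rewrite in_itv/= => /andP[c0 cb] Hc; exists c => //.
rewrite (le_lt_trans cb b1) andbT lt_neqAle c0 andbT.
by apply/eqP => E; move: H0; rewrite {1}E Hc ltxx.
Qed.

Lemma drift_exp_gt0_left (a A B e : R) : 1 < a < 2 -> 0 < drift_exp a A B 0 -> 0 < e ->
  exists2 nu, - e < nu < 0 & 0 < drift_exp a A B nu.
Proof.
move=> a12 H0 e0.
have c0 : {for 0, continuous (drift_exp a A B)} by apply: continuous_drift_exp => //; lra.
have /cvgrPdist_lt/(_ _ H0)[d /= d0 Hd] := c0.
pose x := - (Num.min d e / 2).
have m0 : 0 < Num.min d e by rewrite lt_min d0.
have md : Num.min d e <= d by rewrite ge_min lexx.
have me : Num.min d e <= e by rewrite ge_min lexx orbT.
exists x; first by rewrite /x; lra.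
have : ball (0 : R) d x by rewrite /ball/= sub0r normrN /x normrN gtr0_norm; lra.
by move=> /Hd; rewrite ltr_norml => /andP[_]; lra.
Qed.

End DriftExponent.

(** * Rotation of a contour by a quarter turn *)

Section Derivatives.
Context {R : realType}.
Implicit Types (f g : R -> R) (x df dg : R).

Lemma deriveD f g x df dg : is_derive x (1 : R) f df -> is_derive x (1 : R) g dg ->
  is_derive x (1 : R) (fun y => f y + g y) (df + dg).
Proof. by move=> Hf Hg; exact: is_deriveD. Qed.

Lemma deriveN f x df : is_derive x (1 : R) f df ->
  is_derive x (1 : R) (fun y => - f y) (- df).
Proof. by move=> Hf; exact: is_deriveN. Qed.

Lemma deriveM f g x df dg : is_derive x (1 : R) f df -> is_derive x (1 : R) g dg ->
  is_derive x (1 : R) (fun y => f y * g y) (f x * dg + g x * df).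
Proof. by move=> Hf Hg; exact: is_deriveM. Qed.

Lemma derive_sq f x df : is_derive x (1 : R) f df ->
  is_derive x (1 : R) (fun y => f y ^+ 2) (2 * f x * df).
Proof.
move=> Hf; have := deriveM Hf Hf; rewrite -mulrDl -mulr2n -(mulr_natl (f x)).
by under eq_fun do rewrite -expr2.
Qed.

Lemma derive_cos f x df : is_derive x (1 : R) f df ->
  is_derive x (1 : R) (fun y => cos (f y)) (- sin (f x) * df).
Proof. by move=> Hf; exact: (@is_derive1_comp _ _ _ _ _ _ (is_derive_cos _) Hf). Qed.

Lemma derive_sin f x df : is_derive x (1 : R) f df ->
  is_derive x (1 : R) (fun y => sin (f y)) (cos (f x) * df).
Proof. by move=> Hf; exact: (@is_derive1_comp _ _ _ _ _ _ (is_derive_sin _) Hf). Qed.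

Lemma derive_powR f x df s : 0 < f x -> is_derive x (1 : R) f df ->
  is_derive x (1 : R) (fun y => f y `^ s) (s * f x `^ (s - 1) * df).
Proof. by move=> f0 Hf; exact: (@is_derive1_comp _ _ _ _ _ _ (is_derive1_powR _ f0) Hf). Qed.

Lemma derive_cst (c x : R) : is_derive x (1 : R) (fun=> c) 0.
Proof. exact: is_derive_cst. Qed.

Lemma derive_id x : is_derive x (1 : R) (fun y => y) 1.
Proof. exact: is_derive_id. Qed.

Lemma derive_eq f x df df' : df = df' -> is_derive x (1 : R) f df ->
  is_derive x (1 : R) f df'.
Proof. by move=> ->. Qed.

End Derivatives.

Ltac derivation := repeat
  lazymatch goal with
  | |- is_derive _ _ (fun y => y) _ => exact: derive_id
  | |- is_derive _ _ (fun y => (_ + _)) _ => eapply deriveD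
  | |- is_derive _ _ (GRing.add _) _ => eapply deriveD
  | |- is_derive _ _ (fun y => - _) _ => eapply deriveN
  | |- is_derive _ _ (GRing.opp) _ => eapply deriveN
  | |- is_derive _ _ (fun y => _ * _) _ => eapply deriveM
  | |- is_derive _ _ (GRing.mul _) _ => eapply deriveM
  | |- is_derive _ _ (fun y => _ ^+ 2) _ => eapply derive_sq
  | |- is_derive _ _ (fun y => cos _) _ => eapply derive_cos
  | |- is_derive _ _ (fun y => sin _) _ => eapply derive_sin
  | |- is_derive _ _ cos _ => eapply derive_cos
  | |- is_derive _ _ sin _ => eapply derive_sin
  | |- is_derive _ _ (fun y => _ `^ _) _ => eapply derive_powR
  | |- is_derive _ _ _ _ => exact: derive_cst
  end.

Section Rotation.
Context {R : realType}.
Local Notation mu := (@lebesgue_measure R).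
Variable s : R.
Hypothesis s01 : 0 < s < 1.

(* With z = v e^(i phi) and E(z) = z^s / (1 + z), [rot_re / v] and [rot_im] are
   the real and imaginary parts of e^(-i pi s / 2) E(z) up to sign, and
   [rot_d] expresses that E is holomorphic. *)
Definition rot_arg (phi : R) : R := s * (phi - pi / 2).
Definition rot_den (v phi : R) : R := 1 + 2 * v * cos phi + v ^+ 2.
Definition rot_re (v phi : R) : R := v `^ (s - 1) *
  ((cos (rot_arg phi) + v * cos (rot_arg phi - phi)) * rot_den v phi `^ (- 1)).
Definition rot_im (v phi : R) : R := - (v `^ s *
  ((sin (rot_arg phi) + v * sin (rot_arg phi - phi)) * rot_den v phi `^ (- 1))).
Definition rot_d (v phi : R) : R := v `^ (s - 1) *
  (- (s * sin (rot_arg phi) + v * (s - 1) * sin (rot_arg phi - phi)) * rot_den v phi `^ (- 1) +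
   2 * v * sin phi * (cos (rot_arg phi) + v * cos (rot_arg phi - phi)) * rot_den v phi `^ (- 2)).

Lemma rot_den_ge1 (v phi : R) : 0 <= v -> 0 <= phi <= pi / 2 -> 1 + v ^+ 2 <= rot_den v phi.
Proof.
move=> v0 /andP[p0 p1]; rewrite /rot_den addrAC lerDl !mulr_ge0// cos_ge0_pihalf//.
by rewrite p1 andbT (le_trans _ p0)// oppr_le0 divr_ge0// pi_ge0.
Qed.

Lemma rot_den_gt0 (v phi : R) : 0 <= v -> 0 <= phi <= pi / 2 -> 0 < rot_den v phi.
Proof.
by move=> v0 p; apply: lt_le_trans (rot_den_ge1 v0 p); rewrite ltr_pwDl// sqr_ge0.
Qed.

Lemma derive_rot_re (v phi : R) : 0 < v -> 0 <= phi <= pi / 2 ->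
  is_derive phi (1 : R) (rot_re v) (rot_d v phi).
Proof.
move=> v0 p; have D0 := rot_den_gt0 (ltW v0) p.
rewrite /rot_re /rot_d /rot_arg; rewrite /rot_den in D0 *.
eapply derive_eq; last by derivation.
rewrite (_ : -1 - 1 = -2); last by ring.
ring.
Qed.

(** With [derive_rot_re] this is the Cauchy-Riemann equation in polar coordinates: the angular
    derivative of one part is the radial derivative of the other. *)
Lemma derive_rot_im (v phi : R) : 0 < v -> 0 <= phi <= pi / 2 ->
  is_derive v (1 : R) (fun w => rot_im w phi) (rot_d v phi).
Proof.
move=> v0 p; have D0 := rot_den_gt0 (ltW v0) p.
rewrite /rot_im /rot_d; set th := rot_arg phi.
rewrite /rot_den in D0 *.
eapply derive_eq; last by derivation.
rewrite (_ : -1 - 1 = -2); last by ring.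
set D := 1 + 2 * v * cos phi + v ^+ 2 in D0 *.
have -> : v `^ s = v `^ (s - 1) * v.
  by rewrite mulrC mulr_powRB1 ?ltW//; case/andP: s01.
have Dm1 : D `^ (- 1) = D^-1 by rewrite powR_inv1// ltW.
have Dm2 : D `^ (- 2) = D ^- 2 by rewrite (powR_invn 2)// ltW.
rewrite Dm1 Dm2.
have E1 : sin (th - phi) = sin th * cos phi - cos th * sin phi by exact: sinB.
have E2 : cos (th - phi) = cos th * cos phi + sin th * sin phi by exact: cosB.
(* After clearing denominators the two expressions for the derivative differ by a multiple of this
   quantity, which is a multiple of cos^2 + sin^2 - 1. *)
have Z : sin (th - phi) * D + sin phi * (cos th + v * cos (th - phi)) -
    (sin th + v * sin (th - phi)) * (cos phi + v) = 0.
  rewrite E1 E2 /D.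
  transitivity (v * sin th * (cos phi ^+ 2 + sin phi ^+ 2 - 1)); first by ring.
  by rewrite cos2Dsin2 subrr mulr0.
apply/eqP; rewrite -subr_eq0; apply/eqP.
transitivity (- (2 * v * v `^ (s - 1) / D ^+ 2) *
  (sin (th - phi) * D + sin phi * (cos th + v * cos (th - phi)) -
    (sin th + v * sin (th - phi)) * (cos phi + v))).
  by field; rewrite gt_eqF.
by rewrite Z mulr0.
Qed.

Lemma rot_im_bound (v phi : R) : 0 < v -> 0 <= phi <= pi / 2 ->
  `|rot_im v phi| <= v `^ s * ((1 + v) / (1 + v ^+ 2)).
Proof.
move=> v0 p; have D0 := rot_den_gt0 (ltW v0) p.
rewrite /rot_im normrN normrM ger0_norm ?powR_ge0// ler_wpM2l ?powR_ge0//.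
have Di0 : 0 <= (rot_den v phi)^-1 by rewrite invr_ge0 ltW.
rewrite normrM powR_inv1 ?(ltW D0)// (ger0_norm Di0).
apply: ler_pM => //.
  apply: le_trans (ler_normD _ _) _; apply: lerD; first exact: sin_max.
  by rewrite normrM gtr0_norm// ler_piMr ?sin_max// ltW.
by rewrite lef_pV2 ?posrE// ?rot_den_ge1// ?ltr_pwDl ?sqr_ge0// ltW.
Qed.

(** A crude bound, from which a constant is taken that makes the shifted integrand nonnegative on
    the rectangle, so that Tonelli's theorem applies. *)
Lemma rot_d_bound (e L v phi : R) : 0 < e -> e <= v <= L -> 0 <= phi <= pi / 2 ->
  `|rot_d v phi| <= e `^ (s - 1) * ((1 + L) + 2 * L * (1 + L)).
Proof.
move=> e0 /andP[ev vL] p; have v0 := lt_le_trans e0 ev.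
have /andP[s0 s1] := s01.
have D0 := rot_den_gt0 (ltW v0) p; have D1 : 1 <= rot_den v phi.
  by apply: le_trans (rot_den_ge1 (ltW v0) p); rewrite lerDl sqr_ge0.
rewrite /rot_d normrM ger0_norm ?powR_ge0//.
apply: ler_pM; rewrite ?powR_ge0//.
  by apply: gtr0_ler_powRN => //; rewrite subr_le0 ltW.
have Dm r : r <= 0 -> `|rot_den v phi `^ r| <= 1.
  move=> r0; rewrite ger0_norm ?powR_ge0//.
  by have := @gtr0_ler_powRN R r 1 (rot_den v phi) r0 ltr01 D1; rewrite powR1.
have sn x : `|sin x| <= 1 :> R by exact: sin_max.
have cn x : `|cos x| <= 1 :> R by exact: cos_max.
apply: le_trans (ler_normD _ _) _; apply: lerD.
  rewrite normrM -[leRHS]mulr1; apply: ler_pM => //; last by apply: Dm; rewrite oppr_le0.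
  rewrite normrN; apply: le_trans (ler_normD _ _) _; apply: lerD.
    by rewrite normrM -[leRHS]mulr1; apply: ler_pM => //; rewrite gtr0_norm// ltW.
  rewrite normrM -[leRHS]mulr1; apply: ler_pM => //.
  rewrite normrM gtr0_norm// -[leRHS]mulr1; apply: ler_pM => //; first exact: ltW.
  by rewrite ler_norml; apply/andP; split; lra.
rewrite normrM -[leRHS]mulr1; apply: ler_pM => //; last by apply: Dm; rewrite oppr_le0.
rewrite normrM; apply: ler_pM => //.
  rewrite normrM -[leRHS]mulr1; apply: ler_pM => //.
  by rewrite gtr0_norm ?mulr_gt0// ler_pM2l.
apply: le_trans (ler_normD _ _) _; apply: lerD => //.
by rewrite normrM -[leRHS]mulr1; apply: ler_pM => //; rewrite gtr0_norm.
Qed.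

Lemma rot_re_pihalf (v : R) : 0 < v -> rot_re v (pi / 2) = v `^ (s - 1) / (1 + v ^+ 2).
Proof.
move=> v0; rewrite /rot_re /rot_den /rot_arg subrr mulr0 sub0r cosN cos_pihalf cos0 !mulr0 !addr0 mul1r.
by rewrite powR_inv1// addr_ge0// sqr_ge0.
Qed.

Lemma rot_re_0 (v : R) : 0 < v ->
  rot_re v 0 = cos (s * (pi / 2)) * (v `^ (s - 1) / (1 + v)).
Proof.
move=> v0; rewrite /rot_re /rot_den /rot_arg subr0 sub0r mulrN cosN cos0 mulr1.
have -> : 1 + 2 * v + v ^+ 2 = (1 + v) ^+ 2 by ring.
rewrite powR_inv1 ?sqr_ge0//; field.
by rewrite gt_eqF// addr_gt0.
Qed.

Lemma derive_continuous (f : R -> R) x (df : R) :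
  is_derive x (1 : R) f df -> {for x, continuous f}.
Proof. exact: is_derive_continuous. Qed.

Lemma continuous_rot_d_phi (v phi : R) : 0 < v -> 0 <= phi <= pi / 2 ->
  {for phi, continuous (rot_d v)}.
Proof.
move=> v0 p; have D0 := rot_den_gt0 (ltW v0) p.
rewrite /rot_d /rot_arg; rewrite /rot_den in D0 *.
by eapply derive_continuous; derivation.
Qed.

Lemma continuous_rot_d_v (v phi : R) : 0 < v -> 0 <= phi <= pi / 2 ->
  {for v, continuous (rot_d ^~ phi)}.
Proof.
move=> v0 p; have D0 := rot_den_gt0 (ltW v0) p.
rewrite /rot_d; set th := rot_arg phi; rewrite /rot_den in D0 *.
by eapply derive_continuous; derivation.
Qed.

Lemma measurable_cos : measurable_fun setT (@cos R).
Proof. by apply: continuous_measurable_fun; exact: continuous_cos. Qed.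

Lemma measurable_sin : measurable_fun setT (@sin R).
Proof. by apply: continuous_measurable_fun; exact: continuous_sin. Qed.

Lemma measurable_rot_d : measurable_fun setT (fun z : R * R => rot_d z.1 z.2).
Proof.
have mc f : measurable_fun setT f -> measurable_fun setT (fun z : R * R => cos (f z) : R).
  by move=> mf; exact: (measurableT_comp measurable_cos mf).
have ms f : measurable_fun setT f -> measurable_fun setT (fun z : R * R => sin (f z) : R).
  by move=> mf; exact: (measurableT_comp measurable_sin mf).
have ma : measurable_fun setT (fun z : R * R => rot_arg z.2).
  by rewrite /rot_arg; measurability.
have m1 : measurable_fun setT (fun z : R * R => rot_arg z.2 - z.2) by measurability.
have mD : measurable_fun setT (fun z : R * R => rot_den z.1 z.2).
  by rewrite /rot_den; measurability; exact: (mc _ measurable_snd).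
rewrite /rot_d; measurability.
all: first [exact: (mc _ ma) | exact: (ms _ ma) | exact: (mc _ m1)
  | exact: (ms _ m1) | exact: (ms _ measurable_snd)].
Qed.

Lemma measurable_rot_im (v : R) : measurable_fun setT (rot_im v).
Proof.
have mc (f : R -> R) : measurable_fun setT f -> measurable_fun setT (fun z => cos (f z)).
  by move=> mf; exact: (measurableT_comp measurable_cos mf).
have ms (f : R -> R) : measurable_fun setT f -> measurable_fun setT (fun z => sin (f z)).
  by move=> mf; exact: (measurableT_comp measurable_sin mf).
have ma : measurable_fun setT (fun z => rot_arg z) by rewrite /rot_arg; measurability.
have m1 : measurable_fun setT (fun z => rot_arg z - z) by measurability.
have mD : measurable_fun setT (fun z => rot_den v z).
  by rewrite /rot_den; measurability; exact: measurable_cos.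
rewrite /rot_im; measurability.
all: first [exact: (mc _ ma) | exact: (ms _ ma) | exact: (mc _ m1)
  | exact: (ms _ m1)].
Qed.

Lemma pihalf_gt0 : 0 < pi / 2 :> R. Proof. by rewrite divr_gt0// pi_gt0. Qed.

Definition rot_bound (e L : R) := e `^ (s - 1) * ((1 + L) + 2 * L * (1 + L)).

Lemma derive_lin (c x : R) : is_derive x (1 : R) (fun y => c * y) c.
Proof. by eapply derive_eq; last derivation; rewrite mulr0 addr0 mulr1. Qed.

Definition rot_cos (v : R) := cos (s * (pi / 2)) * (v `^ (s - 1) / (1 + v)).
Definition rot_sq (v : R) := v `^ (s - 1) / (1 + v ^+ 2).

Lemma rot_phi (C v : R) : 0 < v ->
  (rot_sq v - rot_cos v + C * (pi / 2))%:E =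
  (\int[mu]_(phi in `[0%R, (pi / 2)%R]) (rot_d v phi + C)%:E)%E.
Proof.
move=> v0.
have -> : rot_sq v - rot_cos v + C * (pi / 2) =
    (rot_re v (pi / 2) + C * (pi / 2)) - (rot_re v 0 + C * 0).
  by rewrite rot_re_pihalf// rot_re_0// /rot_sq /rot_cos; ring.
have H1 phi : 0 <= phi <= pi / 2 -> {for phi, continuous (fun phi => rot_d v phi + C)}.
  by move=> p; apply: cvgD; [exact: continuous_rot_d_phi|exact: cvg_cst].
have H2 (phi : R) : 0 <= phi <= pi / 2 ->
    is_derive phi (1 : R) (fun phi => rot_re v phi + C * phi) (rot_d v phi + C).
  by move=> p; apply: deriveD (derive_lin _ _); exact: derive_rot_re.
by rewrite (is_derive_FTC2 pihalf_gt0 H1 H2).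
Qed.

Lemma rot_d_ge0 (e L C v phi : R) : 0 < e -> rot_bound e L <= C -> e <= v <= L ->
  0 <= phi <= pi / 2 -> 0 <= rot_d v phi + C.
Proof.
move=> e0 bC v1 p; have := rot_d_bound e0 v1 p.
by rewrite ler_norml -/(rot_bound e L) => /andP[+ _]; lra.
Qed.

(** Cauchy's theorem on a quarter annulus. The left side compares the integrals along the two
    half-lines, the right side those along the two arcs; the shift C contributes the same amount to
    both. *)
Lemma rot_fubini (e L C : R) : 0 < e -> e < L -> rot_bound e L <= C ->
  (\int[mu]_(v in `[e, L]) (rot_sq v - rot_cos v + C * (pi / 2))%:E =
   \int[mu]_(phi in `[0%R, (pi / 2)%R]) (rot_im L phi - rot_im e phi + C * (L - e))%:E)%E.
Proof.
move=> e0 eL bC.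
transitivity (\int[mu]_(v in `[e, L]) \int[mu]_(phi in `[0%R, (pi / 2)%R])
    (rot_d v phi + C)%:E)%E.
  apply: eq_integral => v /set_mem/=; rewrite in_itv/= => /andP[ev vL].
  by rewrite rot_phi// (lt_le_trans e0 ev).
transitivity (\int[mu]_(phi in `[0%R, (pi / 2)%R]) \int[mu]_(v in `[e, L])
    (rot_d v phi + C)%:E)%E.
  apply: fubini_tonelli_setX => //.
    apply: measurable_funTS; apply/measurable_EFinP; apply: measurable_funD => //.
    exact: measurable_rot_d.
  move=> v phi /=; rewrite !in_itv/= => v1 p; rewrite lee_fin.
  exact: (rot_d_ge0 e0 bC).
apply: eq_integral => phi /set_mem/=; rewrite in_itv/= => p.
have -> : rot_im L phi - rot_im e phi + C * (L - e) =
  (rot_im L phi + C * L) - (rot_im e phi + C * e) by ring.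
have H1 v : e <= v <= L -> {for v, continuous (fun v => rot_d v phi + C)}.
  move=> /andP[ev vL]; apply: cvgD; last exact: cvg_cst.
  by apply: continuous_rot_d_v => //; exact: lt_le_trans ev.
have H2 (v : R) : e <= v <= L ->
    is_derive v (1 : R) (fun v => rot_im v phi + C * v) (rot_d v phi + C).
  move=> /andP[ev vL]; apply: deriveD (derive_lin _ _); apply: derive_rot_im => //.
  exact: lt_le_trans ev.
by rewrite (is_derive_FTC2 eL H1 H2).
Qed.

Definition rot_tail (v : R) := v `^ s * ((1 + v) / (1 + v ^+ 2)).

Lemma measurable_rot_sq : measurable_fun setT rot_sq.
Proof.
rewrite (_ : rot_sq = fun v => v `^ (s - 1) * (1 + v ^+ 2) `^ (- 1)).
  by measurability.
by apply/funext => v; rewrite powR_inv1// addr_ge0// sqr_ge0.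
Qed.

Lemma measurable_rot_cos : measurable_fun (`]0%R, +oo[ : set R) rot_cos.
Proof.
apply: (eq_measurable_fun (fun v => cos (s * (pi / 2)) * (v `^ (s - 1) * (1 + v) `^ (- 1)))).
  move=> v /set_mem/Rpos_gt0 v0; rewrite /rot_cos powR_inv1//.
  by rewrite addr_ge0// ltW.
by apply: measurable_funTS; measurability.
Qed.

Lemma rot_sq_ge0 (v : R) : 0 <= rot_sq v.
Proof. by rewrite mulr_ge0 ?powR_ge0// invr_ge0 addr_ge0// sqr_ge0. Qed.

Lemma cos_s_ge0 : 0 <= cos (s * (pi / 2)).
Proof.
have /andP[s0 s1] := s01; have p0 := pihalf_gt0.
apply: cos_ge0_pihalf; apply/andP; split.
  by apply: (@le_trans _ _ 0); [rewrite oppr_le0 ltW|rewrite mulr_ge0// ltW].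
by rewrite ler_piMl// ltW.
Qed.

Lemma rot_cos_ge0 (v : R) : 0 < v -> 0 <= rot_cos v.
Proof.
move=> v0; rewrite /rot_cos mulr_ge0 ?cos_s_ge0// mulr_ge0 ?powR_ge0// invr_ge0.
by rewrite addr_ge0// ltW.
Qed.

Lemma rot_bound_ge0 (e L : R) : 0 < L -> 0 <= rot_bound e L.
Proof.
move=> L0; have L1 : 0 <= 1 + L by rewrite addr_ge0// ltW.
by rewrite mulr_ge0 ?powR_ge0// addr_ge0// mulr_ge0// mulr_ge0// ltW.
Qed.

Lemma rot_tail_ge0 (v : R) : 0 < v -> 0 <= rot_tail v.
Proof.
move=> v0; rewrite mulr_ge0 ?powR_ge0// mulr_ge0 ?invr_ge0 ?addr_ge0 ?sqr_ge0//.
exact: ltW.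
Qed.

(** The arcs of radii e and L bound the defect. Two inequalities take the place of a bound on a
    difference, which would need finite integrals. *)
Lemma rot_close (e L : R) : 0 < e -> e < L ->
  let d := (rot_tail e + rot_tail L) * (pi / 2) in
  ((\int[mu]_(v in `[e, L]) (rot_sq v)%:E <=
    \int[mu]_(v in `[e, L]) (rot_cos v)%:E + d%:E) /\
   (\int[mu]_(v in `[e, L]) (rot_cos v)%:E <=
    \int[mu]_(v in `[e, L]) (rot_sq v)%:E + d%:E))%E.
Proof.
move=> e0 eL d; have L0 : 0 < L := lt_trans e0 eL; have p0 := pihalf_gt0.
have Le0 : 0 < L - e by rewrite subr_gt0.
pose eta := rot_tail e + rot_tail L.
have eta0 : 0 <= eta.
  by rewrite addr_ge0// rot_tail_ge0.
(* The first summand makes [rot_d + C] nonnegative; the second gives [eta <= C * (L - e)], so the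
   integrand over the arcs is nonnegative too. *)
pose C := rot_bound e L + eta / (L - e).
have bC : rot_bound e L <= C by rewrite lerDl divr_ge0// ltW.
have C0 : 0 <= C.
  by apply: le_trans bC; exact: rot_bound_ge0.
have CL : eta <= C * (L - e).
  rewrite /C mulrDl mulfVK ?gt_eqF// lerDr mulr_ge0 ?rot_bound_ge0//.
  exact: ltW.
pose X1 := (\int[mu]_(v in `[e, L]) (rot_sq v)%:E)%E.
pose X0 := (\int[mu]_(v in `[e, L]) (rot_cos v)%:E)%E.
suff : ((X1 <= X0 + d%:E) /\ (X0 <= X1 + d%:E))%E by [].
pose Y := (\int[mu]_(v in `[e, L]) (rot_sq v - rot_cos v + C * (pi / 2))%:E)%E.
have sub : `[e, L] `<=` (`]0, +oo[ : set R).
  by move=> v /=; rewrite !in_itv/= andbT => /andP[ev _]; exact: lt_le_trans ev.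
have pos v : `[e, L]%classic v -> 0 < v by move=> /sub; exact: Rpos_gt0.
have ms : measurable_fun (`[e, L] : set R) rot_sq.
  by apply: measurable_funTS; exact: measurable_rot_sq.
have mc : measurable_fun (`[e, L] : set R) rot_cos by exact: measurable_funS sub measurable_rot_cos.
have E1 : (X1 + (C * (pi / 2) * (L - e))%:E = Y + X0)%E.
  transitivity (\int[mu]_(v in `[e, L]) (rot_sq v + C * (pi / 2))%:E)%E.
    under [RHS]eq_integral do rewrite EFinD.
    rewrite ge0_integralD//=; last 3 first.
    - by move=> v _; rewrite lee_fin rot_sq_ge0.
    - exact/measurable_EFinP.
    - by move=> v _; rewrite lee_fin mulr_ge0// ltW.
    congr (_ + _)%E; rewrite integral_cst//.
    have meL : mu `[e, L] = (L - e)%:E by rewrite lebesgue_measure_itv/= lte_fin eL -EFinB.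
    by rewrite [X in (_ * X)%E]meL -EFinM.
  rewrite /Y -ge0_integralD//; last 4 first.
  - move=> v /= vi; rewrite rot_phi ?pos//; apply: integral_ge0 => phi /=; rewrite in_itv/= => p.
    by rewrite lee_fin (rot_d_ge0 e0 bC)//; move: vi; rewrite in_itv.
  - apply/measurable_EFinP; apply: measurable_funD => //; exact: measurable_funB.
  - by move=> v /pos v0; rewrite lee_fin rot_cos_ge0.
  - exact/measurable_EFinP.
  by apply: eq_integral => v _; rewrite -EFinD; congr EFin; ring.
have him phi : 0 <= phi <= pi / 2 -> `|rot_im L phi - rot_im e phi| <= eta.
  move=> p; apply: le_trans (ler_normB _ _) _; rewrite /eta addrC.
  by apply: lerD; exact: rot_im_bound.
have mp : mu `[0%R, (pi / 2)%R] = (pi / 2)%:E.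
  by rewrite lebesgue_measure_itv/= lte_fin p0 -EFinB subr0.
have mim (v : R) : 0 < v -> measurable_fun (`[0%R, (pi / 2)%R] : set R) (rot_im v).
  by move=> _; apply: measurable_funTS; exact: measurable_rot_im.
have YE : Y = (\int[mu]_(phi in `[0%R, (pi / 2)%R]) (rot_im L phi - rot_im e phi + C * (L - e))%:E)%E.
  exact: rot_fubini.
have mh : measurable_fun (`[0%R, (pi / 2)%R] : set R)
    (fun phi => (rot_im L phi - rot_im e phi + C * (L - e))%:E).
  apply/measurable_EFinP; apply: measurable_funD => //.
  by apply: measurable_funB; exact: mim.
have Ycst (c : R) : (\int[mu]_(phi in `[0%R, (pi / 2)%R]) c%:E = (c * (pi / 2))%:E)%E.
  by rewrite integral_cst//= [X in (_ * X)%E]mp.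
have Yu : (Y <= ((eta + C * (L - e)) * (pi / 2))%:E)%E.
  rewrite YE -Ycst; apply: ge0_le_integral => //.
  - move=> phi /=; rewrite in_itv/= => /him; rewrite ler_norml lee_fin => /andP[+ _]; lra.
  - move=> phi /=; rewrite in_itv/= => /him; rewrite ler_norml lee_fin => /andP[_]; lra.
have Yl : (((C * (L - e) - eta) * (pi / 2))%:E <= Y)%E.
  rewrite YE -Ycst; apply: ge0_le_integral => //.
  - by move=> phi _; rewrite lee_fin subr_ge0.
  - move=> phi /=; rewrite in_itv/= => /him; rewrite ler_norml lee_fin => /andP[+ _]; lra.
have X10 : (0 <= X1)%E by apply: integral_ge0 => v _; rewrite lee_fin rot_sq_ge0.
have X00 : (0 <= X0)%E by apply: integral_ge0 => v /pos v0; rewrite lee_fin rot_cos_ge0.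
have dE : d = eta * (pi / 2) by [].
move: X1 X0 Y E1 Yu Yl X10 X00 {YE} => [x| |] [y| |] [z| |]//=; rewrite ?lee_fin ?leey//.
rewrite (_ : C * (pi / 2) * (L - e) = C * (L - e) * (pi / 2)); last by ring.
rewrite -!EFinD dE => -[E1] Yu Yl _ _.
move: E1 Yu Yl; move: (C * (L - e)) (pi / 2) => K q E1.
by rewrite mulrDl mulrBl => Yu Yl; split; lra.
Qed.


Lemma rot_tail_le (v : R) : 1 <= v -> rot_tail v <= 2 * v `^ (s - 1) /\ rot_tail v^-1 <= 2 * v `^ (- s).
Proof.
move=> v1; have v0 : 0 < v by exact: lt_le_trans v1.
have /andP[s0 s1] := s01.
have vs : v `^ s = v `^ (s - 1) * v by rewrite mulrC mulr_powRB1 ?ltW.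
split.
  rewrite /rot_tail vs -mulrA mulrC; apply: ler_wpM2r; first exact: powR_ge0.
  rewrite mulrA ler_pdivrMr; last by rewrite ltr_pwDl// sqr_ge0.
  by nra.
rewrite /rot_tail -(powR_inv1 (ltW v0)) -powRrM mulN1r mulrC.
apply: ler_wpM2r; first exact: powR_ge0.
rewrite (powR_inv1 (ltW v0)) ler_pdivrMr; last by rewrite ltr_pwDl// sqr_ge0.
have i1 : v^-1 <= 1 by rewrite invf_le1.
have := sqr_ge0 v^-1; lra.
Qed.

Lemma integral_exhaust (f : R -> R) (a b : nat -> R) :
  (forall u, 0 < u -> 0 <= f u) -> measurable_fun (`]0%R, +oo[ : set R) f ->
  nonincreasing_seq a -> nondecreasing_seq b -> (forall n, 0 < a n) ->
  (forall u, 0 < u -> exists n, a n <= u <= b n) ->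
  (\int[mu]_(u in `[a n, b n]) (f u)%:E @[n --> \oo] -->
    \int[mu]_(u in `]0%R, +oo[) (f u)%:E)%E.
Proof.
move=> f0 mf na nb a0 ex.
have -> : `]0%R, +oo[%classic = \bigcup_n `[a n, b n]%classic.
  apply/seteqP; split => u /=.
    by rewrite in_itv/= andbT => /ex[n nu]; exists n => //=; rewrite in_itv.
  by move=> [n _ /=]; rewrite !in_itv/= andbT => /andP[au _]; exact: lt_le_trans au.
have sub n : `[a n, b n] `<=` (`]0, +oo[ : set R).
  by move=> v /=; rewrite !in_itv/= andbT => /andP[ev _]; exact: lt_le_trans ev.
apply: ge0_nondecreasing_set_cvg_integral => //.
- move=> m n mn; rewrite subsetEset => u /=; rewrite !in_itv/= => /andP[mu un].
  by rewrite (le_trans (na _ _ mn) mu) (le_trans un (nb _ _ mn)).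
- by move=> n; apply/measurable_EFinP; exact: measurable_funS (sub n) mf.
- by move=> n u /sub/Rpos_gt0 u0; rewrite lee_fin f0.
Qed.

(** The radii 1/N and N are sent to 0 and infinity; the arcs disappear because v^s vanishes at 0 and
    v^(s-1) at infinity, which is where 0 < s < 1 enters. *)
Lemma rot_integral : (\int[mu]_(v in `]0%R, +oo[) (rot_sq v)%:E =
  \int[mu]_(v in `]0%R, +oo[) (rot_cos v)%:E)%E.
Proof.
have /andP[s0 s1] := s01.
pose N (n : nat) : R := n.+2%:R.
have N1 n : 1 < N n by rewrite ltr1n.
have N0 n : 0 < N n by exact: lt_trans (N1 n).
have NE : nonincreasing_seq (fun n => (N n)^-1).
  by move=> m n mn; rewrite lef_pV2 ?posrE// ler_nat.
have NI : nondecreasing_seq N by move=> m n mn; rewrite ler_nat.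
have Nex (u : R) : 0 < u -> exists n, (N n)^-1 <= u <= N n.
  move=> u0; exists (Num.truncn (u + u^-1)).
  have := truncnS_gt (u + u^-1); set k := Num.truncn _ => Hk.
  have i0 : 0 < u^-1 by rewrite invr_gt0.
  have kN : k.+1%:R < N k by rewrite ltr_nat.
  apply/andP; split; last by lra.
  by rewrite -[leRHS]invrK lef_pV2 ?posrE//; lra.
have Ni n : 0 < (N n)^-1 by rewrite invr_gt0.
have c1 := integral_exhaust (fun u _ => rot_sq_ge0 u)
  (measurable_funTS measurable_rot_sq) NE NI Ni Nex.
have c0 := integral_exhaust rot_cos_ge0 measurable_rot_cos NE NI Ni Nex.
pose d n := (rot_tail (N n)^-1 + rot_tail (N n)) * (pi / 2).
have d0 : d n @[n --> \oo] --> 0.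
  have NC : N n @[n --> \oo] --> +oo.
    apply/cvgryPge => A; near=> n; rewrite (@le_trans _ _ n%:R) ?ler_nat//; last first.
      by rewrite -addn2 leq_addr.
    by near: n; exact: nbhs_infty_ger.
  have t0 p : p < 0 -> (N n) `^ p @[n --> \oo] --> 0.
    by move=> p0; exact: (cvg_comp _ _ NC (powR_cvgy0 p0)).
  apply: (@squeeze_cvgr _ _ _ _ (fun=> 0)
     (fun n => (2 * N n `^ (- s) + 2 * N n `^ (s - 1)) * (pi / 2))).
  - near=> n; rewrite mulr_ge0 ?(ltW pihalf_gt0)//=; last first.
      by rewrite addr_ge0// rot_tail_ge0.
    rewrite ler_pM2r ?pihalf_gt0//.
    by have [? ?] := rot_tail_le (ltW (N1 n)); apply: lerD.
  - exact: cvg_cst.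
  - have E0 : (2 * 0 + 2 * 0) * (pi / 2) = 0 :> R by ring.
    rewrite -[X in _ --> X]E0; apply: cvgM; last exact: cvg_cst.
    apply: cvgD; first by apply: cvgM; [exact: cvg_cst|apply: t0; rewrite oppr_lt0].
    by apply: cvgM; [exact: cvg_cst|apply: t0; rewrite subr_lt0].
have dE : ((d n)%:E @[n --> \oo] --> 0)%E by apply: cvg_EFin => //; exact: nearW.
have iN n : (N n)^-1 < N n by rewrite (lt_trans _ (N1 n))// invf_lt1.
apply/eqP; rewrite eq_le; apply/andP; split; rewrite -[leRHS]adde0.
- apply: (lee_cvg_to c1 (cvgeD _ c0 dE)); first exact: fin_num_adde_defl.
  by apply: nearW => n; exact: (rot_close (Ni n) (iN n)).1.
- apply: (lee_cvg_to c0 (cvgeD _ c1 dE)); first exact: fin_num_adde_defl.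
  by apply: nearW => n; exact: (rot_close (Ni n) (iN n)).2.
Unshelve. all: by end_near. Qed.



(** The substitution u = v^2, made on compact intervals and passed to the limit. It relates the
    tangential integral, whose variable is a squared ratio of lengths, to the rotated half-line. *)
Lemma integral_square : (\int[mu]_(u in `]0%R, +oo[) (u `^ (s / 2 - 1) / (1 + u))%:E =
  2%:E * \int[mu]_(v in `]0%R, +oo[) (rot_sq v)%:E)%E.
Proof.
have /andP[s0 s1] := s01.
pose N (n : nat) : R := n.+2%:R.
have N1 n : 1 < N n by rewrite ltr1n.
have N0 n : 0 < N n by exact: lt_trans (N1 n).
have Ni n : 0 < (N n)^-1 by rewrite invr_gt0.
have iN n : (N n)^-1 < N n by rewrite (lt_trans _ (N1 n))// invf_lt1.
have NE : nonincreasing_seq (fun n => (N n)^-1).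
  by move=> m n mn; rewrite lef_pV2 ?posrE// ler_nat.
have NI : nondecreasing_seq N by move=> m n mn; rewrite ler_nat.
have Nex (u : R) : 0 < u -> exists n, (N n)^-1 <= u <= N n.
  move=> u0; exists (Num.truncn (u + u^-1)).
  have := truncnS_gt (u + u^-1); set k := Num.truncn _ => Hk.
  have i0 : 0 < u^-1 by rewrite invr_gt0.
  have kN : k.+1%:R < N k by rewrite ltr_nat.
  apply/andP; split; last by lra.
  by rewrite -[leRHS]invrK lef_pV2 ?posrE//; lra.
pose G (u : R) := u `^ (s / 2 - 1) / (1 + u).
have G0 u : 0 < u -> 0 <= G u.
  by move=> u0; rewrite mulr_ge0 ?powR_ge0// invr_ge0 addr_ge0// ltW.
have cG u : 0 < u -> {for u, continuous G}.
  move=> u0; apply: cvgM; first exact: continuous_powR.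
  apply: cvgV; first by rewrite gt_eqF// addr_gt0.
  by apply: cvgD; [exact: cvg_cst|exact: cvg_id].
have mG : measurable_fun (`]0%R, +oo[ : set R) G by exact: pos_continuous_measurable.
have sqle (x y : R) : 0 < x -> x <= y -> x ^+ 2 <= y ^+ 2.
  by move=> x0 xy; rewrite ler_pXn2r ?nnegrE ?(ltW x0)// (le_trans (ltW x0)).
have cG2 := @integral_exhaust G (fun n => (N n)^-1 ^+ 2) (fun n => N n ^+ 2) G0 mG.
have {}cG2 : (\int[mu]_(u in `[((N n)^-1 ^+ 2)%R, (N n ^+ 2)%R]) (G u)%:E @[n --> \oo] -->
    \int[mu]_(u in `]0%R, +oo[) (G u)%:E)%E.
  apply: cG2 => [m n mn|m n mn|n|u u0].
  - by apply: sqle => //; exact: NE.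
  - by apply: sqle => //; exact: NI.
  - exact: exprn_gt0.
  - have us0 : 0 < Num.sqrt u by rewrite sqrtr_gt0.
    have [n /andP[n1 n2]] := Nex _ us0; exists n.
    by rewrite -[u]sqr_sqrtr ?(ltW u0)// !sqle.
have cS := integral_exhaust (fun u _ => rot_sq_ge0 u)
  (measurable_funTS measurable_rot_sq) NE NI Ni Nex.
have cS2 := cvgeZl (isT : 2%:E \is a @fin_num R) cS.
apply: (cvg_unique _ cG2) => //.
suff H : (fun n => 2%:E * \int[mu]_(u in `[(N n)^-1%R, N n]) (rot_sq u)%:E)%E =
    (fun n => \int[mu]_(u in `[((N n)^-1 ^+ 2)%R, (N n ^+ 2)%R]) (G u)%:E)%E.
  by rewrite -H.
apply/funext => n.
pose F (v : R) := v ^+ 2.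
have dF (v : R) : is_derive v (1 : R) F (2 * v).
  by rewrite /F; eapply derive_eq; last derivation; rewrite mulr1.
have F'E : derive1 F = (fun v => 2 * v).
  by apply/funext => v; rewrite derive1E; exact: (@derive_val _ _ _ _ _ _ _ (dF v)).
have cF' (v : R) : (fun v => 2 * v) @ v --> 2 * v.
  by apply: cvgM; [exact: cvg_cst|exact: cvg_id].
have := @integration_by_substitution_increasing R F G (N n)^-1 (N n) (ltW (iN n)).
rewrite F'E => ->.
- rewrite -ge0_integralZlR//; first last.
  + by move=> v _; rewrite lee_fin rot_sq_ge0.
  + by apply/measurable_EFinP; apply: measurable_funTS; exact: measurable_rot_sq.
  apply: eq_integral => v /set_mem/=; rewrite in_itv/= => /andP[v0 _].
  have {}v0 : 0 < v by exact: lt_le_trans v0.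
  rewrite -EFinM /G /F /rot_sq; congr EFin.
  transitivity ((v ^+ 2) `^ (s / 2 - 1) / (1 + v ^+ 2) * (2 * v)); last by [].
  have -> : (v ^+ 2) `^ (s / 2 - 1) = v `^ (s - 1) * v^-1.
    rewrite -(powR_mulrn 2 (ltW v0)) -powRrM -(powR_inv1 (ltW v0)) -powRD ?(gt_eqF v0) ?implybT//.
    by congr (_ `^ _); field.
  have w0 : v != 0 by rewrite gt_eqF.
  have w1 : 1 + v ^+ 2 != 0 by rewrite gt_eqF// ltr_pwDl// sqr_ge0.
  by field; rewrite ?w0 ?w1.
- move=> x y; rewrite !in_itv/= => /andP[x0 _] /andP[y0 _] xy.
  rewrite /F ltr_pXn2r ?nnegrE// ?(le_trans (ltW (Ni n)))//.
- by move=> v _; exact: cF'.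
- by apply/cvg_ex; exists (2 * (N n)^-1); apply: cvg_at_right_filter; exact: cF'.
- by apply/cvg_ex; exists (2 * N n); apply: cvg_at_left_filter; exact: cF'.
- split => [v _||].
  + by apply: ex_derive; exact: dF.
  + by apply: cvg_at_right_filter; exact: is_derive_continuous (dF _).
  + by apply: cvg_at_left_filter; exact: is_derive_continuous (dF _).
- apply: continuous_in_subspaceT => u; rewrite inE/= in_itv/= => /andP[u0 _].
  by apply: cG; apply: lt_le_trans u0; exact: exprn_gt0.
Qed.

End Rotation.

(** By the reflection formula the two integrals are pi / sin(pi a / 2) and pi / sin(pi (a - 1)), so
    the ratio is the double-angle formula of the sine. The rotation yields the ratio without
    computing either value. *)
Lemma int_tan_double {R : realType} (a : R) : 1 < a < 2 ->
  fine (int_tan (a / 2) 0) = - (2 * cos (pi * a / 2)) * fine (int_tan (a - 1) 0).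
Proof.
move=> /andP[a1 a2].
have s01 : 0 < 2 - a < 1 by lra.
have E1 : int_tan (a / 2) 0 = (2%:E * \int[lebesgue_measure]_(v in `]0%R, +oo[) (rot_sq (2 - a) v)%:E)%E.
  rewrite -integral_square// int_tan.unlock; apply: eq_integral => u /set_mem/Rpos_gt0 u0.
  rewrite sub0r powR_inv1 ?addr_ge0 ?(ltW u0)// mulrC.
  by congr (_ `^ _ / _)%:E; lra.
have c0 := cos_s_ge0 s01.
have E2 : (\int[lebesgue_measure]_(v in `]0%R, +oo[) (rot_cos (2 - a) v)%:E =
    (cos ((2 - a) * (pi / 2)))%:E * int_tan (a - 1) 0)%E.
  rewrite int_tan.unlock -ge0_integralZlR//; last 2 first.
  - by apply: measurable_funTS; measurability.
  - by move=> u _; rewrite lee_fin mulr_ge0 ?powR_ge0.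
  apply: eq_integral => u /set_mem/Rpos_gt0 u0.
  rewrite -EFinM /rot_cos sub0r powR_inv1 ?addr_ge0 ?(ltW u0)// [X in _ = (_ * X)%:E]mulrC.
  by congr (_ * (_ `^ _ / _))%:E; lra.
have Ec : cos ((2 - a) * (pi / 2)) = - cos (pi * a / 2).
  rewrite (_ : (2 - a) * (pi / 2) = - (pi * a / 2) + pi); last by field.
  by rewrite cosDpi cosN.
rewrite E1 rot_integral// E2 Ec.
have : int_tan (a - 1) 0 \is a fin_num by apply: int_tan_fin; lra.
by move: (int_tan (a - 1) 0) => [x| |]//= _; rewrite mulrA mulrN.
Qed.

Lemma int_rad0 {R : realType} (a : R) : int_rad a 0 = int_tan (a - 1) 0.
Proof.
rewrite int_tan.unlock int_rad.unlock; apply: eq_integral => u /set_mem/Rpos_gt0 u0.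
rewrite sub0r powR_inv1 ?addr_ge0 ?(ltW u0)//; congr EFin.
have -> : - (a - 1) = 1 - a by ring.
have u1 : 1 + u != 0 by rewrite gt_eqF// addr_gt0.
rewrite powRD ?(gt_eqF u0) ?implybT// powRr1 ?(ltW u0)//.
by field.
Qed.

Lemma drift_exp0 {R : realType} (a A B : R) : 1 < a < 2 ->
  exists2 I, 0 < I & drift_exp a A B 0 = - (A + 2 * B * cos (pi * a / 2)) * I.
Proof.
move=> a12; have /andP[a1 a2] := a12; exists (fine (int_tan (a - 1) 0)).
  have : fine (int_tan (a - 1) (-1)) < fine (int_tan (a - 1) 0) by apply: lt_int_tan; lra.
  by apply: le_lt_trans; apply: fine_ge0; exact: int_tan_ge0.
rewrite drift_exp.unlock mul0r int_tan_double// int_rad0; ring.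
Qed.

(** * One-step drift *)

Section BoxCox.
Context {R : realType}.
Implicit Types nu x y : R.

(** Weighted arithmetic-geometric inequality for x and 1 with weights nu and 1 - nu: ln z <= z - 1
    is applied to both numbers divided by their weighted mean y. *)
Lemma powR_le_bernoulli nu x : 0 < x -> 0 <= nu <= 1 -> x `^ nu <= 1 + nu * (x - 1).
Proof.
move=> x0 /andP[n0 n1].
have [->|nu0] := eqVneq nu 0; first by rewrite powRr0 mul0r addr0.
have np : 0 < nu by rewrite lt_neqAle eq_sym nu0.
have y0 : 0 < 1 + nu * (x - 1) by nra.
pose y := 1 + nu * (x - 1).
have : nu * ln (x / y) + (1 - nu) * ln y^-1 <= 0.
  have h1 : ln (x / y) <= x / y - 1.
    have := @le_ln1Dx R (x / y - 1); rewrite subrKC; apply.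
    by rewrite ltrBrDl subrr divr_gt0.
  have h2 : ln y^-1 <= y^-1 - 1.
    have := @le_ln1Dx R (y^-1 - 1); rewrite subrKC; apply.
    by rewrite ltrBrDl subrr invr_gt0.
  have -> : 0 = nu * (x / y - 1) + (1 - nu) * (y^-1 - 1).
    rewrite /y; field; exact: lt0r_neq0.
  by apply: lerD; apply: ler_wpM2l => //; rewrite subr_ge0.
rewrite ln_div ?posrE// lnV ?posrE// => H.
rewrite /powR gt_eqF// -[leRHS](lnK (_ : _ \is Num.pos)) ?posrE// ler_expR.
by rewrite -/y; lra.
Qed.

Lemma boxcox_le nu x : 0 < x -> -1 <= nu <= 1 -> nu != 0 -> boxcox nu x <= x - 1.
Proof.
move=> x0 /andP[n1 n2] n0; rewrite /boxcox.
have [np|nn] := ltP 0 nu.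
  rewrite ler_pdivrMr// lerBlDl mulrC; apply: powR_le_bernoulli => //.
  by rewrite ltW.
have {}nn : nu < 0 by rewrite lt_neqAle n0.
rewrite ler_ndivrMr// lerBrDl.
rewrite mulrC /powR gt_eqF//; apply: le_trans (expR_ge1Dx _); rewrite lerD2l.
apply: ler_wnM2l; first exact: ltW.
have := @le_ln1Dx R (x - 1); rewrite subrKC; apply.
by rewrite ltrBrDl subrr.
Qed.

Lemma boxcoxN nu x : nu != 0 -> 0 < x -> boxcox nu x = - boxcox (- nu) x^-1.
Proof.
move=> n0 x0; rewrite /boxcox -(powR_inv1 (ltW x0)) -powRrM mulN1r opprK invrN mulrN opprK.
by [].
Qed.

Lemma le_boxcox nu x : 0 < x -> -1 <= nu <= 1 -> nu != 0 -> 1 - x^-1 <= boxcox nu x.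
Proof.
move=> x0 n1 n0; rewrite boxcoxN// lerNr opprB; apply: boxcox_le.
- by rewrite invr_gt0.
- lra.
- by rewrite oppr_eq0.
Qed.

Lemma boxcox_mono nu x y : nu != 0 -> 0 < x -> x <= y -> boxcox nu x <= boxcox nu y.
Proof.
move=> n0 x0 xy; rewrite /boxcox; have [np|nn] := ltP 0 nu.
  rewrite ler_pM2r ?invr_gt0// lerD2r; apply: ge0_ler_powR; rewrite ?nnegrE ?(ltW np)//.
    exact: ltW.
  exact/ltW/(lt_le_trans x0).
have {}nn : nu < 0 by rewrite lt_neqAle n0.
rewrite ler_nM2r ?invr_lt0// lerD2r; apply: gtr0_ler_powRN => //; exact: ltW.
Qed.

(** Bernoulli's inequality for x^nu' with exponent nu / nu'. It is what puts the maximum of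
    [power_gap] at 1. *)
Lemma boxcox_ler nu nu' x : 0 < x -> 0 < nu -> nu <= nu' -> boxcox nu x <= boxcox nu' x.
Proof.
move=> x0 n0 nn'; have n0' : 0 < nu' by exact: lt_le_trans nn'.
rewrite /boxcox ler_pdivrMr// mulrAC ler_pdivlMr//.
have y0 : 0 < x `^ nu' by rewrite powR_gt0.
have := @powR_le_bernoulli (nu / nu') (x `^ nu') y0.
rewrite -powRrM mulrCA mulfV ?gt_eqF// mulr1 => H.
have {}H : x `^ nu <= 1 + nu / nu' * (x `^ nu' - 1).
  apply: H; apply/andP; split; first exact: divr_ge0 (ltW n0) (ltW n0').
  by rewrite ler_pdivrMr ?mul1r.
move: H; rewrite -lerBlDl mulrAC ler_pdivlMr// => H.
by rewrite [leRHS]mulrC.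
Qed.

(* Powers of the norm are taken after this cut-off: nu may be negative. *)
Definition maxone (y : R) := Num.max y 1.

Lemma maxone_ge1 y : 1 <= maxone y. Proof. by rewrite le_max lexx orbT. Qed.
Lemma maxone_gt0 y : 0 < maxone y. Proof. exact: lt_le_trans (maxone_ge1 y). Qed.
Lemma maxone_ge y : y <= maxone y. Proof. by rewrite le_max lexx. Qed.
Lemma maxone_id y : 1 <= y -> maxone y = y.
Proof. by move=> y1; rewrite /maxone; apply/max_idPl. Qed.

(* The error term of the first-order expansion of the Box-Cox increment of a
   radial jump; only the negative part of the jump contributes. *)
Definition radial_rest nu r th :=
  boxcox nu (maxone `|r + th| / r) - th / r +
  (pospart th / r - boxcox nu (1 + pospart th / r)).

Lemma radial_rest_eq0 nu r th : 1 <= r -> 0 <= th -> radial_rest nu r th = 0.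
Proof.
move=> r1 th0; have r0 : 0 < r by exact: lt_le_trans r1.
rewrite /radial_rest /pospart th0 ger0_norm; last by rewrite addr_ge0// ltW.
rewrite maxone_id; last by rewrite -[leLHS]addr0 lerD.
by rewrite mulrDl divff ?gt_eqF//; ring.
Qed.

(** With s the relative size of an inward jump, the rest is of second order while s <= 1/2, and s^2
    <= s^b since b <= 2. For larger s it is at most linear in s plus a value near the origin, and
    (2s)^b exceeds both 1 and 2s. *)
Lemma radial_rest_bound nu b r th : -1 <= nu <= 1 -> nu != 0 -> 1 <= b <= 2 -> 2 <= r ->
  `|radial_rest nu r th| <= 4 * (1 + `|nu|^-1) * (1 + r `^ (- nu)) *
     (negpart th / r) `^ b.
Proof.
move=> n1 n0 /andP[b1 b2] r2.
have r0 : 0 < r by exact: lt_le_trans r2.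
have r1 : 1 <= r by lra.
have C0 : 0 < 1 + `|nu|^-1 by rewrite ltr_pwDl// invr_ge0.
have D0 : 1 <= 1 + r `^ (- nu) by rewrite lerDl powR_ge0.
have [th0|th0] := leP 0 th.
  rewrite radial_rest_eq0// normr0 !mulr_ge0 ?powR_ge0// ltW//.
  exact: lt_le_trans D0.
pose s := negpart th / r.
have sE : s = - (th / r) by rewrite /s /negpart th0 mulNr.
have s0 : 0 < s by rewrite sE oppr_gt0 pmulr_llt0 ?invr_gt0.
have ppE : pospart th = 0 by rewrite /pospart leNgt th0.
have -> : radial_rest nu r th = boxcox nu (maxone `|r + th| / r) + s.
  by rewrite /radial_rest ppE mul0r addr0 {2}/boxcox powR1 subrr mul0r subrr addr0 sE.
rewrite -/s.
have rth : r + th = r * (1 - s) by rewrite sE; field; rewrite gt_eqF.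
have K4 : 4 <= 4 * (1 + `|nu|^-1) * (1 + r `^ (- nu)).
  rewrite -mulrA ler_peMr//.
  by rewrite -[leLHS]mul1r ler_pM// lerDl invr_ge0.
have [s2|s2] := leP s (2^-1).
  have y0 : 0 < 1 - s by lra.
  rewrite rth maxone_id; last first.
    by rewrite (ger0_norm (mulr_ge0 (ltW r0) (ltW y0))); nra.
  rewrite (ger0_norm (mulr_ge0 (ltW r0) (ltW y0))) mulrAC divff ?gt_eqF// mul1r.
  have H1 := boxcox_le y0 n1 n0.
  have H2 := le_boxcox y0 n1 n0.
  have H3 : 1 - (1 - s)^-1 = - s - s ^+ 2 / (1 - s) by field; rewrite gt_eqF.
  have H4 : s ^+ 2 / (1 - s) <= 2 * s ^+ 2.
    by rewrite ler_pdivrMr//; nra.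
  have H5 : s ^+ 2 <= s `^ b.
    rewrite -powR_mulrn ?(ltW s0)//; apply: ger_powR => //; rewrite s0/=; lra.
  have sb0 : 0 <= s `^ b by exact: powR_ge0.
  rewrite ler_norml; apply/andP; split; nra.
have y1 : maxone `|r + th| / r <= 1 + s.
  rewrite ler_pdivrMr// /maxone ge_max; apply/andP; split; last by nra.
  rewrite rth normrM gtr0_norm// mulrC ler_pM2r//.
  by rewrite ler_norml; apply/andP; split; lra.
have y2 : r^-1 <= maxone `|r + th| / r.
  by rewrite -[leLHS]mul1r ler_pM2r ?invr_gt0// maxone_ge1.
have ri : 0 < r^-1 by rewrite invr_gt0.
have y0 := lt_le_trans ri y2.
have H1 := le_trans (boxcox_le y0 n1 n0) (_ : _ <= s).
have {}H1 : boxcox nu (maxone `|r + th| / r) <= s by apply: H1; lra.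
(* The cut-off keeps the ratio above 1/r. For nu < 0 the value there is of order r^(-nu); absorbing
   it is what alpha - nu < b is for. *)
have H2 : - ((1 + r `^ (- nu)) / `|nu|) <= boxcox nu (maxone `|r + th| / r).
  apply: le_trans (boxcox_mono n0 ri y2).
  rewrite /boxcox -(powR_inv1 (ltW r0)) -powRrM mulN1r.
  have pr := powR_ge0 r (- nu).
  have [np|nn] := ltP 0 nu.
    by rewrite gtr0_norm// -mulNr ler_pM2r ?invr_gt0//; lra.
  have {}nn : nu < 0 by rewrite lt_neqAle n0.
  by rewrite ltr0_norm// invrN mulrN opprK ler_nM2r ?invr_lt0//; lra.
have S1 : 1 <= (2 * s) `^ b.
  rewrite -[leLHS](powRr0 (2 * s)); apply: ler_powR; lra.
have S2 : 2 * s <= (2 * s) `^ b.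
  rewrite -[leLHS]powRr1; last lra.
  by apply: ler_powR => //; lra.
have S3 : (2 * s) `^ b <= 4 * s `^ b.
  rewrite powRM ?(ltW s0)//; apply: ler_wpM2r; first exact: powR_ge0.
  have -> : 4 = 2 `^ 2 :> R by rewrite (powR_mulrn 2)//; ring.
  by apply: ler_powR => //; lra.
set Q := (1 + r `^ (- nu)) in D0 *; set v := `|nu|^-1 in C0 *.
have v0 : 0 <= v by rewrite invr_ge0.
apply: (@le_trans _ _ ((1 + v) * Q * (2 * s) `^ b)); last first.
  by rewrite -!mulrA [leRHS]mulrCA ler_pM2l// [leRHS]mulrCA ler_pM2l//; lra.
rewrite -/v in H2.
have Qv : 0 <= Q * v by rewrite mulr_ge0// (le_trans _ D0).
have X1 : 1 + Q * v <= (1 + v) * Q by nra.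
apply: (@le_trans _ _ ((1 + Q * v) * (2 * s) `^ b)); last first.
  by rewrite ler_wpM2r ?powR_ge0.
rewrite -/Q in H2.
move: (boxcox nu _) ((2 * s) `^ b) H1 H2 S1 S2 => B T H1 H2 S1 S2.
have QvT : Q * v <= Q * v * T by rewrite ler_peMr.
by rewrite ler_norml mulrDl mul1r; apply/andP; split; lra.
Qed.

End BoxCox.

(** * Expectations at scale r under a power-law tail, uniformly in the starting point *)

Section TailAsymptotics.
Context {R : realType} {d : measure_display} {T : measurableType d} {I : Type}.
Local Notation mu := (@lebesgue_measure R).
Local Notation Rpos := (`]0%R, +oo[%classic : set R).
Variables (P : I -> probability T R) (D : set I) (Z : T -> R).
Hypotheses (mZ : measurable_fun setT Z) (Z0 : forall w, 0 <= Z w).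
Variables (gam c : R).
Hypotheses (gam0 : 0 < gam) (c0 : 0 <= c).
Local Notation tl x y := (fine (P x [set w | (y < Z w)%R])).
Hypothesis tailZ : forall eps : R, 0 < eps -> exists Y : R, forall y, Y < y ->
  forall x, D x -> `| y `^ gam * tl x y - c | <= eps.
Variables (g G : R -> R).
Hypotheses (mg : measurable_fun setT g) (g0 : forall u, 0 < u -> 0 <= g u).
Hypothesis GE : forall t, 0 <= t -> (\int[mu]_(u in `]0%R, t[) (g u)%:E = (G t)%:E)%E.

Lemma measurable_tail_set (y : R) : measurable [set w | y < Z w].
Proof.
rewrite (_ : [set w | y < Z w] = Z @^-1` `]y, +oo[%classic).
  by rewrite -[X in measurable X]setTI; exact: mZ.
by apply/seteqP; split => w /=; rewrite in_itv/= andbT.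
Qed.

Lemma tail_fin (x : I) (y : R) : P x [set w | y < Z w] \is a fin_num.
Proof. by apply: fin_num_measure; exact: measurable_tail_set. Qed.

Lemma tail_01 (x : I) (y : R) : 0 <= tl x y <= 1.
Proof.
have := probability_le1 (P x) (measurable_tail_set y).
have : (0 <= P x [set w | (y < Z w)%R])%E by exact: measure_ge0.
have := tail_fin x y.
by case: (P x _) => [p| |]//= _; rewrite !lee_fin => -> ->.
Qed.

Lemma measurable_tail (x : I) : measurable_fun setT (fun y : R => tl x y).
Proof.
apply: nonincreasing_measurable => // y z yz.
apply: fine_le; rewrite ?tail_fin//; apply: le_measure; rewrite ?inE.
- exact: measurable_tail_set.
- exact: measurable_tail_set.
- by move=> w /=; exact: le_lt_trans.
Qed.

(** G (Z / r) is the integral of g over 0 < u < Z / r; the interval in [GE] is open on the right to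
    match the strict inequality in the tail. *)
Lemma layer_cake (x : I) (r : R) : 0 < r ->
  (\int[P x]_w (G (Z w / r))%:E =
   \int[mu]_(u in Rpos) (g u * tl x (r * u))%:E)%E.
Proof.
move=> r0.
pose f (w : T) (u : R) : R := if r * u < Z w then g u else 0.
have mf : measurable_fun setT (fun z : T * R => f z.1 z.2).
  apply: measurable_fun_ifT => //.
    apply: measurable_fun_ltr.
      by apply: measurable_funM; [exact: measurable_cst|exact: measurable_snd].
    exact: (measurableT_comp mZ measurable_fst).
  exact: (measurableT_comp mg measurable_snd).
transitivity (\int[P x]_(w in setT) \int[mu]_(u in Rpos) (f w u)%:E)%E.
  apply: eq_integral => w _.
  rewrite -GE; last by rewrite divr_ge0// ltW.
  rewrite integral_mkcond [RHS]integral_mkcond; apply: eq_integral => u _.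
  rewrite !patchE !mem_setE !in_itv/= andbT /f ltr_pdivlMr// mulrC.
  by case: (0 < u) => //=; case: ifP.
transitivity (\int[mu]_(u in Rpos) \int[P x]_(w in setT) (f w u)%:E)%E.
  apply: fubini_tonelli_setX => //.
    by apply: measurable_funTS; exact/measurable_EFinP.
  by move=> w u _ /Rpos_gt0 u0; rewrite lee_fin /f; case: ifP => // _; exact: g0.
apply: eq_integral => u /set_mem/Rpos_gt0 u0.
transitivity (\int[P x]_w ((g u)%:E * (\1_[set w | r * u < Z w] w)%:E))%E.
  apply: eq_integral => w _; rewrite -EFinM /f indicE.
  case: ifPn => h; first by rewrite mem_set// mulr1.
  by rewrite memNset ?mulr0//=; exact/negP.
rewrite ge0_integralZl ?lee_fin ?g0//; last first.
  by apply/measurable_EFinP; exact: measurable_indic (measurable_tail_set _).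
rewrite integral_indic ?setIT//; last exact: measurable_tail_set.
by rewrite EFinM fineK// tail_fin.
Qed.

Local Notation J := (\int[mu]_(u in Rpos) (g u * u `^ (- gam))%:E)%E.
Local Notation Jr w := (\int[mu]_(u in `]0%R, w%R]) (g u * u `^ (- gam))%:E)%E.
Hypothesis Jfin : J \is a fin_num.

Lemma Jr_indic (k w : R) : 0 <= k ->
  (\int[mu]_(u in Rpos) (k * (g u * u `^ (- gam) * \1_(`]0, w]%classic : set R) u))%:E =
   k%:E * Jr w)%E.
Proof.
move=> k0.
have mI : measurable_fun setT (fun u : R => \1_(`]0, w]%classic : set R) u : R).
  exact: measurable_indic.
under eq_integral do rewrite EFinM.
rewrite ge0_integralZlR//; last 2 first.
- by apply: measurable_funTS; measurability.
- by move=> u /Rpos_gt0 u0; rewrite lee_fin !mulr_ge0 ?powR_ge0 ?g0.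
congr (_ * _)%E; rewrite integral_mkcond [RHS]integral_mkcond; apply: eq_integral => u _.
rewrite !patchE !mem_setE indicE mem_setE !in_itv/= andbT.
by case: (0 < u) => //=; case: (u <= w); rewrite ?mulr1 ?mulr0.
Qed.

(** Where r u > Y the rescaled tail is within e of c u^(-gam). Where r u <= Y the tail estimate is
    void, but (r u)^gam times a probability is at most Y^gam, and the range u <= Y / r shrinks as r
    grows. *)
Lemma tail_scale_le (e Y r : R) (x : I) : 0 < Y -> 0 < r -> 0 <= e ->
  (forall y : R, Y < y -> `| y `^ gam * tl x y - c | <= e) ->
  ((r `^ gam)%:E * \int[P x]_w (G (Z w / r))%:E <=
    (c + e)%:E * J + (Y `^ gam)%:E * Jr (Y / r))%E.
Proof.
move=> Y0 r0 e0 H; rewrite layer_cake//.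
have ce : 0 <= c + e by exact: addr_ge0.
have mI : measurable_fun setT (fun u : R => \1_(`]0, Y / r]%classic : set R) u : R).
  exact: measurable_indic.
have mt : measurable_fun setT (fun u : R => tl x (r * u)).
  exact: (measurableT_comp (measurable_tail x) (mulrl_measurable _)).
have gp u : 0 < u -> 0 <= g u * u `^ (- gam).
  by move=> u0; rewrite mulr_ge0 ?powR_ge0// g0.
rewrite -ge0_integralZlR ?powR_ge0//; last 2 first.
- by apply: measurable_funTS; measurability.
- move=> u /Rpos_gt0 u0; rewrite lee_fin mulr_ge0 ?g0//.
  by have /andP[] := tail_01 x (r * u).
rewrite -ge0_integralZlR//; last 2 first.
- by apply: measurable_funTS; measurability.
- by move=> u /Rpos_gt0 u0; rewrite lee_fin gp.
rewrite -Jr_indic ?powR_ge0// -ge0_integralD//; last 4 first.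
- by move=> u /Rpos_gt0 u0; rewrite -EFinM lee_fin mulr_ge0 ?gp.
- by apply: measurable_funeM; apply: measurable_funTS; measurability.
- by move=> u /Rpos_gt0 u0; rewrite lee_fin !mulr_ge0 ?powR_ge0 ?g0.
- by apply: measurable_funTS; measurability.
apply: ge0_le_integral => //.
- move=> u /Rpos_gt0 u0; rewrite -EFinM lee_fin !mulr_ge0 ?powR_ge0 ?g0//.
  by have /andP[] := tail_01 x (r * u).
- by apply: measurable_funeM; apply: measurable_funTS; measurability.
- apply: emeasurable_funD; last by apply: measurable_funTS; measurability.
  by apply: measurable_funeM; apply: measurable_funTS; measurability.
move=> u /Rpos_gt0 u0; rewrite -!EFinM -EFinD lee_fin.
have ru0 : 0 < r * u by rewrite mulr_gt0.
have -> : r `^ gam * (g u * tl x (r * u)) =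
   (g u * u `^ (- gam)) * ((r * u) `^ gam * tl x (r * u)).
  rewrite powRM ?(ltW r0) ?(ltW u0)// powRN; field.
  by rewrite gt_eqF// powR_gt0.
rewrite indicE mem_setE in_itv/= u0/= ler_pdivlMr// [u * r]mulrC.
have gu := gp _ u0.
have /andP[t0 t1] := tail_01 x (r * u).
have [ruY|ruY] := leP (r * u) Y.
  rewrite mulr1 -[leLHS]add0r; apply: lerD; first exact: mulr_ge0.
  rewrite mulrC; apply: ler_wpM2r => //.
  rewrite -[leRHS]mulr1; apply: ler_pM => //; first exact: powR_ge0.
  by apply: ge0_ler_powR => //; rewrite ?nnegrE ltW.
rewrite mulr0 mulr0 addr0 mulrC; apply: ler_wpM2r => //.
by have := H _ ruY; rewrite ler_norml => /andP[_]; lra.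
Qed.

Lemma tail_scale_ge (e Y r : R) (x : I) : 0 < Y -> 0 < r -> 0 <= e ->
  (forall y : R, Y < y -> `| y `^ gam * tl x y - c | <= e) ->
  (c%:E * J <= (r `^ gam)%:E * \int[P x]_w (G (Z w / r))%:E + e%:E * J +
     c%:E * Jr (Y / r))%E.
Proof.
move=> Y0 r0 e0 H; rewrite layer_cake// -(@Jr_indic c (Y / r) c0).
have mI : measurable_fun setT (fun u : R => \1_(`]0, Y / r]%classic : set R) u : R).
  exact: measurable_indic.
have mt : measurable_fun setT (fun u : R => tl x (r * u)).
  exact: (measurableT_comp (measurable_tail x) (mulrl_measurable _)).
have gp u : 0 < u -> 0 <= g u * u `^ (- gam).
  by move=> u0; rewrite mulr_ge0 ?powR_ge0// g0.
have tp u : 0 < u -> 0 <= g u * tl x (r * u).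
  by move=> u0; rewrite mulr_ge0 ?g0//; have /andP[] := tail_01 x (r * u).
rewrite -ge0_integralZlR ?powR_ge0//; last 2 first.
- by apply: measurable_funTS; measurability.
- by move=> u /Rpos_gt0 u0; rewrite lee_fin ?gp ?tp.
rewrite -ge0_integralZlR ?powR_ge0//; last 2 first.
- by apply: measurable_funTS; measurability.
- by move=> u /Rpos_gt0 u0; rewrite lee_fin ?gp ?tp.
rewrite -ge0_integralZlR ?powR_ge0//; last 2 first.
- by apply: measurable_funTS; measurability.
- by move=> u /Rpos_gt0 u0; rewrite lee_fin ?gp ?tp.
have m1 : measurable_fun Rpos
    (fun u => ((r `^ gam)%:E * (g u * tl x (r * u))%:E)%E).
  by apply: measurable_funeM; apply: measurable_funTS; measurability.
have m2 k : measurable_fun Rpos (fun u => (k%:E * (g u * u `^ (- gam))%:E)%E).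
  by apply: measurable_funeM; apply: measurable_funTS; measurability.
have p1 u : Rpos u -> (0 <= (r `^ gam)%:E * (g u * tl x (r * u))%:E)%E.
  by move=> /Rpos_gt0 u0; rewrite -EFinM lee_fin mulr_ge0 ?powR_ge0 ?tp.
have p2 u : Rpos u -> (0 <= e%:E * (g u * u `^ (- gam))%:E)%E.
  by move=> /Rpos_gt0 u0; rewrite -EFinM lee_fin mulr_ge0 ?gp.
rewrite -ge0_integralD//; try exact: p1; try exact: p2; try exact: m2.
rewrite -ge0_integralD//; last 4 first.
- by move=> u Hu; apply: adde_ge0; [exact: p1|exact: p2].
- by apply: emeasurable_funD => //; exact: m2.
- by move=> u /Rpos_gt0 u0; rewrite lee_fin !mulr_ge0 ?powR_ge0 ?g0.
- by apply: measurable_funTS; measurability.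
apply: ge0_le_integral => //.
- by move=> u /Rpos_gt0 u0; rewrite -EFinM lee_fin mulr_ge0 ?gp.
- exact: m2.
- apply: emeasurable_funD; first by apply: emeasurable_funD => //; exact: m2.
  by apply: measurable_funTS; measurability.
move=> u /Rpos_gt0 u0; rewrite -!EFinM -!EFinD lee_fin.
have ru0 : 0 < r * u by rewrite mulr_gt0.
have -> : r `^ gam * (g u * tl x (r * u)) =
   (g u * u `^ (- gam)) * ((r * u) `^ gam * tl x (r * u)).
  rewrite powRM ?(ltW r0) ?(ltW u0)// powRN; field.
  by rewrite gt_eqF// powR_gt0.
rewrite indicE mem_setE in_itv/= u0/= ler_pdivlMr// [u * r]mulrC.
have gu := gp _ u0.
have /andP[t0 t1] := tail_01 x (r * u).
have tt0 : 0 <= (r * u) `^ gam * tl x (r * u).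
  by rewrite mulr_ge0 ?powR_ge0.
have [ruY|ruY] := leP (r * u) Y.
  by rewrite mulr1 lerDr addr_ge0// mulr_ge0.
rewrite mulr0 mulr0 addr0 [e * _]mulrC -mulrDr mulrC; apply: ler_wpM2l => //.
by have := H _ ruY; rewrite ler_norml => /andP[+ _]; lra.
Qed.

Lemma Jr_small (e : R) : 0 < e -> exists2 w, 0 < w & (Jr w <= e%:E)%E.
Proof.
move=> e0.
pose a (n : nat) : R := n.+1%:R^-1.
have a0 n : 0 < a n by rewrite invr_gt0.
have gp u : 0 < u -> 0 <= g u * u `^ (- gam).
  by move=> u0; rewrite mulr_ge0 ?powR_ge0// g0.
have mgp A : measurable A -> measurable_fun (A : set R) (fun u => (g u * u `^ (- gam))%:E).
  by move=> mA; apply: measurable_funTS; measurability.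
have H : (\int[mu]_(u in `]a n, +oo[) (g u * u `^ (- gam))%:E @[n --> \oo] --> J)%E.
  have -> : Rpos = \bigcup_n `]a n, +oo[%classic.
    apply/seteqP; split => u /=.
      rewrite in_itv/= andbT => u0.
      have /cvgrPdist_lt/(_ u u0)[n _ /(_ n (leqnn n))] := @cvg_harmonic R.
      rewrite /= sub0r normrN gtr0_norm// => enx; exists n => //=.
      by rewrite in_itv/= andbT.
    by move=> [n _ /=]; rewrite !in_itv/= !andbT; exact: lt_trans.
  apply: ge0_nondecreasing_set_cvg_integral => //.
  - move=> m n mn; rewrite subsetEset => u /=; rewrite !in_itv/= !andbT.
    by apply: le_lt_trans; rewrite lef_pV2 ?posrE// ler_nat.
  - by move=> n; exact: mgp.
  - move=> n u /=; rewrite in_itv/= andbT => nu; rewrite lee_fin gp//.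
    exact: lt_trans nu.
have split_J n : (J = Jr (a n) + \int[mu]_(u in `]a n, +oo[) (g u * u `^ (- gam))%:E)%E.
  have -> : Rpos = `]0%R, a n] `|` `]a n, +oo[.
    apply/seteqP; split => u /=; rewrite !in_itv/= !andbT.
      by move=> ->/=; case: leP => //; [left|right].
    by move=> [/andP[]//|]; exact: lt_trans.
  rewrite ge0_integral_setU//.
  - by apply: mgp; exact: measurableU.
  - move=> u [] /=; rewrite in_itv/= ?andbT; [move=> /andP[u0 _]|move=> nu]; rewrite lee_fin gp//.
    exact: lt_trans nu.
  - rewrite disj_set2E; apply/eqP/seteqP; split => // u [] /=; rewrite !in_itv/= andbT.
    by move=> /andP[_ x1] /(le_lt_trans x1); rewrite ltxx.
have Jr0 n : (0 <= Jr (a n))%E.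
  by apply: integral_ge0 => u /=; rewrite in_itv/= => /andP[u0 _]; rewrite lee_fin gp.
move: Jfin split_J H; move: J => [j| |]// _ split_J.
move=> /fine_cvgP[_ /cvgrPdist_le/(_ e e0)[n _ /(_ n (leqnn n)) hb]].
exists (a n) => //.
have := split_J n; have := Jr0 n; move: hb; rewrite /=.
move: (Jr (a n)) (\int[mu]_(u in `]a n, +oo[) (g u * u `^ (- gam))%:E)%E.
move=> [y| |]// [z| |]//= hb; rewrite !lee_fin -EFinD => y0 [jE].
by move: hb; rewrite jE addrK ger0_norm.
Qed.

(** Valid at every scale r > 0, unlike the asymptotics; it supplies integrability and the bounds
    used where r is only moderately large. *)
Lemma tail_bounded : exists2 C, 0 <= C & forall r x, 0 < r -> D x ->
  (\int[P x]_w (G (Z w / r))%:E <= (C * r `^ (- gam))%:E)%E.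
Proof.
have [Y0 HY] := tailZ ltr01.
pose Y := Num.max Y0 1; have Yp : 0 < Y by rewrite lt_max ltr01 orbT.
have {}HY x y : D x -> Y < y -> `|y `^ gam * tl x y - c| <= 1.
  by move=> Dx; rewrite gt_max => /andP[yY _]; exact: HY.
have J0 : (0 <= J)%E.
  by apply: integral_ge0 => u /Rpos_gt0 u0; rewrite lee_fin mulr_ge0 ?powR_ge0 ?g0.
exists ((c + 1 + Y `^ gam) * fine J).
  by rewrite mulr_ge0 ?fine_ge0// addr_ge0 ?powR_ge0// addr_ge0.
move=> r x r0 Dx.
have := tail_scale_le Yp r0 ler01 (fun y yY => HY x y Dx yY).
have Jle : (Jr (Y / r) <= J)%E.
  apply: ge0_subset_integral => //.
  - by apply: measurable_funTS; measurability.
  - by move=> u /Rpos_gt0 u0; rewrite lee_fin mulr_ge0 ?powR_ge0 ?g0.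
  - by move=> u /=; rewrite !in_itv/= andbT => /andP[].
have Jr0 : (0 <= Jr (Y / r))%E.
  by apply: integral_ge0 => u /=; rewrite in_itv/= => /andP[u0 _]; rewrite lee_fin mulr_ge0 ?powR_ge0 ?g0.
have rg : 0 < r `^ gam by rewrite powR_gt0.
move: Jle Jr0 Jfin J0; move: (Jr (Y / r)) J => [y| |]// [j| |]//=.
rewrite !lee_fin => yj y0 _ j0.
move: (\int[P x]_w _)%E => [z| |]//=; last 2 first.
- by rewrite gt0_muley ?lte_fin.
- by rewrite leNye.
rewrite -!EFinM -!EFinD !lee_fin powRN => H.
rewrite ler_pdivlMr// mulrC; apply: le_trans H _.
by rewrite [leRHS]mulrDl lerD2l ler_wpM2l// powR_ge0.
Qed.

Lemma tail_asymp (eps : R) : 0 < eps -> exists2 r0, 0 < r0 & forall r, r0 <= r ->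
  forall x, D x ->
  `| r `^ gam * fine (\int[P x]_w (G (Z w / r))%:E) - c * fine J | <= eps.
Proof.
move=> eps0.
have J0 : (0 <= J)%E.
  by apply: integral_ge0 => u /Rpos_gt0 u0; rewrite lee_fin mulr_ge0 ?powR_ge0 ?g0.
have j0 : 0 <= fine J by exact: fine_ge0.
pose e := eps / 2 / (fine J + 1).
have e0 : 0 < e by rewrite divr_gt0 ?divr_gt0// ltr_wpDl.
have [Y0 HY] := tailZ e0.
pose Y := Num.max Y0 1; have Yp : 0 < Y by rewrite lt_max ltr01 orbT.
have {}HY x y : D x -> Y < y -> `|y `^ gam * tl x y - c| <= e.
  by move=> Dx; rewrite gt_max => /andP[yY _]; exact: HY.
pose e' := eps / 2 / (c + Y `^ gam + 1).
have cY : 0 < c + Y `^ gam + 1 by rewrite ltr_wpDl// addr_ge0 ?powR_ge0.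
have e'0 : 0 < e' by rewrite divr_gt0 ?divr_gt0.
have [w w0 Hw] := Jr_small e'0.
exists (Y / w); first by rewrite divr_gt0.
move=> r rw x Dx; have r0 : 0 < r by apply: lt_le_trans rw; rewrite divr_gt0.
have H1 := tail_scale_le Yp r0 (ltW e0) (fun y yY => HY x y Dx yY).
have H2 := tail_scale_ge Yp r0 (ltW e0) (fun y yY => HY x y Dx yY).
have Jle : (Jr (Y / r) <= e'%:E)%E.
  apply: le_trans Hw; apply: ge0_subset_integral => //.
  - by apply: measurable_funTS; measurability.
  - move=> u /=; rewrite in_itv/= => /andP[u0 _].
    by rewrite lee_fin mulr_ge0 ?powR_ge0 ?g0.
  - move=> u /=; rewrite !in_itv/= => /andP[-> uY] /=; apply: le_trans uY _.
    by rewrite ler_pdivrMr// mulrC -ler_pdivrMr.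
have Jr0 : (0 <= Jr (Y / r))%E.
  by apply: integral_ge0 => u /=; rewrite in_itv/= => /andP[u0 _]; rewrite lee_fin mulr_ge0 ?powR_ge0 ?g0.
have rg : 0 < r `^ gam by rewrite powR_gt0.
have Ee : e * fine J <= eps / 2.
  rewrite /e mulrAC ler_pdivrMr ?ltr_wpDl//.
  by apply: ler_wpM2l; [rewrite divr_ge0// ltW|rewrite lerDl].
have Ee' : (c + Y `^ gam) * e' <= eps / 2.
  rewrite /e' mulrA ler_pdivrMr// mulrC.
  by apply: ler_wpM2l; [rewrite divr_ge0// ltW|rewrite lerDl].
move: e e' e0 e'0 Ee Ee' H1 H2 Jle {HY Hw} => e e' e0 e'0 Ee Ee' H1 H2 Jle.
move: Jle Jr0 Jfin J0 Ee j0 H1 H2; move: (Jr (Y / r)) J => [y| |]// [j| |]//=.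
rewrite !lee_fin => ye y0 _ j0 Ee _.
move: (\int[P x]_w _)%E => [z| |]//=; last 2 first.
- by rewrite gt0_muley ?lte_fin.
- by move=> _; rewrite gt0_muleNy ?lte_fin.
rewrite -!EFinM -!EFinD !lee_fin => H1 H2.
have Y'0 : 0 <= Y `^ gam by exact: powR_ge0.
have P1 : Y `^ gam * y <= Y `^ gam * e' by apply: ler_wpM2l.
have P2 : c * y <= c * e' by apply: ler_wpM2l.
have P3 : 0 <= c * e' by rewrite mulr_ge0// ltW.
have P4 : 0 <= Y `^ gam * e' by rewrite mulr_ge0// ltW.
by rewrite mulrDl in Ee'; rewrite mulrDl in H1; rewrite ler_norml; apply/andP; split; lra.
Qed.

End TailAsymptotics.

(** * Mean change of a power of the norm under a radial or a tangential jump *)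

Section JumpDrift.
Context {R : realType} {d : measure_display} {T : measurableType d} {I : Type}.
Local Notation mu := (@lebesgue_measure R).
Local Notation Rpos := (`]0%R, +oo[%classic : set R).
Variables (P : I -> probability T R) (D : set I).

Lemma integral_ray_oo (f : R -> R) (t : R) : measurable_fun setT f ->
  (\int[mu]_(u in `]0%R, t[) (f u)%:E = \int[mu]_(u in `]0%R, t]) (f u)%:E)%E.
Proof.
move=> mf; rewrite -integral_itv_bndo_bndc//.
by apply/measurable_EFinP; exact: measurable_funTS.
Qed.

Lemma measurable_pospart : measurable_fun setT (@pospart R).
Proof.
rewrite /pospart; apply: measurable_fun_ifT => //.
by apply: measurable_fun_ler => //; exact: measurable_cst.
Qed.

Lemma measurable_negpart : measurable_fun setT (@negpart R).
Proof.
rewrite /negpart; apply: measurable_fun_ifT => //.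
by apply: measurable_fun_ltr => //; exact: measurable_cst.
Qed.

Lemma pospart_ge0 (y : R) : 0 <= pospart y.
Proof. by rewrite /pospart; case: ifP. Qed.

Lemma negpart_ge0 (y : R) : 0 <= negpart y.
Proof. by rewrite /negpart; case: ifP => // /ltW; rewrite oppr_ge0. Qed.

Lemma pospart_le_norm (y : R) : pospart y <= `|y|.
Proof. by rewrite /pospart; case: ifP => // _; exact: ler_norm. Qed.

Variables (alpha nu : R).
Hypotheses (a12 : 1 < alpha < 2) (n11 : -1 < nu < 1) (nu0 : nu != 0).

Lemma integrableRZ x k (f : T -> R) : (P x).-integrable setT (EFin \o f) ->
  (P x).-integrable setT (EFin \o (fun w => k * f w)).
Proof.
move=> fi; have -> : EFin \o (fun w => k * f w) = (fun w => k%:E * (EFin \o f) w)%E by [].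
exact: integrableZl.
Qed.

Lemma integrableRD x (f g : T -> R) : (P x).-integrable setT (EFin \o f) ->
  (P x).-integrable setT (EFin \o g) ->
  (P x).-integrable setT (EFin \o (fun w => f w + g w)).
Proof.
move=> fi gi; have -> : EFin \o (fun w => f w + g w) = ((EFin \o f) \+ (EFin \o g))%E by [].
exact: integrableD.
Qed.

Lemma integrableRB x (f g : T -> R) : (P x).-integrable setT (EFin \o f) ->
  (P x).-integrable setT (EFin \o g) ->
  (P x).-integrable setT (EFin \o (fun w => f w - g w)).
Proof.
move=> fi gi; have -> : EFin \o (fun w => f w - g w) = ((EFin \o f) \- (EFin \o g))%E by [].
exact: integrableB.
Qed.

Lemma power_cvg0 (p K eps : R) : p < 0 -> 0 < eps ->
  exists2 r0, 2 <= r0 & forall r, r0 <= r -> K * r `^ p <= eps.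
Proof.
move=> p0 e0.
have /cvgrPdist_le/(_ (eps / (`|K| + 1))) := @powR_cvgy0 R p p0.
have K1 : 0 < `|K| + 1 by rewrite ltr_wpDl.
move=> /(_ (divr_gt0 e0 K1))[A [_ HA]].
exists (Num.max 2 (A + 1)); first by rewrite le_max lexx.
move=> r; rewrite ge_max => /andP[r2 Ar].
have := HA r; rewrite sub0r normrN ger0_norm ?powR_ge0// => H.
have AR : A < r by lra.
have {}H := H AR.
apply: (@le_trans _ _ ((`|K| + 1) * r `^ p)).
  by rewrite ler_wpM2r ?powR_ge0// (le_trans (ler_norm K))// lerDl.
by rewrite mulrC -ler_pdivlMr.
Qed.

Section Radial.
Variable thR : T -> R.
Hypothesis mthR : measurable_fun setT thR.
Hypothesis int_thR : forall x, D x -> (P x).-integrable setT (EFin \o thR).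
Hypothesis mean_thR : forall x, D x -> (\int[P x]_w (thR w)%:E = 0)%E.
Variables (cR b M : R).
Hypothesis cR0 : 0 <= cR.
Hypothesis tailR : forall eps : R, 0 < eps -> exists Y : R, forall y, Y < y ->
  forall x, D x -> `| y `^ alpha * fine (P x [set w | y < pospart (thR w)]) - cR | <= eps.
Hypotheses (b12 : 1 <= b <= 2) (ab : alpha < b) (anb : alpha - nu < b).
Hypothesis momR : forall x, D x ->
  (\int[P x]_w ((negpart (thR w)) `^ b)%:E <= M%:E)%E.

Let mpR : measurable_fun setT (fun w => pospart (thR w)).
Proof. exact: (measurableT_comp measurable_pospart mthR). Qed.

Let mnR : measurable_fun setT (fun w => negpart (thR w)).
Proof. exact: (measurableT_comp measurable_negpart mthR). Qed.

(** Concavity defect of an outward jump. Centering cancels the linear terms, so it enters the drift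
    with a minus sign; its derivative 1 - (1 + t)^(nu - 1) is the factor that appears in
    [int_rad]. *)
Definition radial_gain (t : R) := t - boxcox nu (1 + t).

Lemma radial_gainE (t : R) : 0 <= t ->
  (\int[mu]_(u in `]0%R, t[) (1 - (1 + u) `^ (nu - 1))%:E = (radial_gain t)%:E)%E.
Proof.
move=> t0; have /andP[n1 n2] := n11.
have m1 : measurable_fun setT (fun u : R => 1 - (1 + u) `^ (nu - 1)) by measurability.
have m2 : measurable_fun setT (fun u : R => (1 + u) `^ (nu - 1)) by measurability.
rewrite integral_ray_oo//.
have : (\int[mu]_(u in `]0%R, t]) (1 - (1 + u) `^ (nu - 1))%:E +
    \int[mu]_(u in `]0%R, t]) ((1 + u) `^ (nu - 1))%:E = t%:E)%E.
  rewrite -ge0_integralD//; last 4 first.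
  - move=> u /=; rewrite in_itv/= => /andP[u0 _].
    by rewrite lee_fin powRDx_le1// ltW.
  - by apply/measurable_EFinP; exact: measurable_funTS.
  - by move=> u _; rewrite lee_fin powR_ge0.
  - by apply/measurable_EFinP; exact: measurable_funTS.
  transitivity (\int[mu]_(u in `]0%R, t]) 1%:E)%E.
    by apply: eq_integral => u _; rewrite -EFinD subrK.
  rewrite integral_cst// mul1e; transitivity (mu `]0%R, t]) => //.
  rewrite lebesgue_measure_itv/= lte_fin; case: ltP => t0'; first by rewrite -EFinB subr0.
  by congr EFin; apply/eqP; rewrite eq_le t0 t0'.
rewrite integral_powR_boxcox//.
move: (\int[mu]_(u in _) _)%E => [z| |]//= [] zt.
by congr EFin; rewrite /radial_gain -{1}zt addrK.
Qed.

Let gainR w r := radial_gain (pospart (thR w) / r).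

Lemma radial_gain_ge0 (t : R) : 0 <= t -> 0 <= radial_gain t.
Proof.
move=> t0; have /andP[n1 n2] := n11.
rewrite subr_ge0; apply: le_trans (boxcox_le _ _ nu0) _; first by rewrite ltr_pwDl.
- by rewrite !ltW.
- by rewrite addrAC subrr add0r.
Qed.

Lemma radial_gain_le (t : R) : 0 <= t -> radial_gain t <= t.
Proof.
move=> t0; have /andP[n1 n2] := n11.
rewrite gerBl; apply: le_trans (le_boxcox _ _ nu0); last 2 first.
- by rewrite ltr_pwDl.
- by rewrite !ltW.
by rewrite subr_ge0 invf_le1 ?ltr_pwDl// lerDl.
Qed.

Lemma int_gainR x r : D x -> 0 < r -> (P x).-integrable setT (EFin \o (gainR^~ r)).
Proof.
move=> Dx r0; apply: (@le_integrable _ _ _ _ _ _ _ (EFin \o (fun w => r^-1 * thR w))) => //.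
- apply/measurable_EFinP; rewrite /gainR /radial_gain /boxcox; measurability.
- move=> w _ /=; rewrite lee_fin.
  have t0 : 0 <= pospart (thR w) / r by rewrite divr_ge0 ?pospart_ge0// ltW.
  rewrite (ger0_norm (radial_gain_ge0 t0)); apply: le_trans (radial_gain_le t0) _.
  by rewrite mulrC normrM gtr0_norm ?invr_gt0// ler_pM2l ?invr_gt0// pospart_le_norm.
- exact: integrableRZ (int_thR Dx).
Qed.

Let restR w r := radial_rest nu r (thR w).

Lemma measurable_restR r : measurable_fun setT (restR^~ r).
Proof.
rewrite /restR /radial_rest /boxcox /maxone; measurability.
Qed.

Let K r := 4 * (1 + `|nu|^-1) * (1 + r `^ (- nu)).

Let K_ge0 r : 0 <= K r.
Proof. by rewrite !mulr_ge0 ?addr_ge0 ?powR_ge0// invr_ge0. Qed.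

Lemma int_negR x : D x -> (P x).-integrable setT (EFin \o (fun w => negpart (thR w) `^ b)).
Proof.
move=> Dx; apply/integrableP; split.
  by apply/measurable_EFinP; measurability.
apply: le_lt_trans (ltry M); apply: le_trans (momR Dx).
rewrite le_eqVlt; apply/orP; left; apply/eqP; apply: eq_integral => w _ /=.
by rewrite ger0_norm// powR_ge0.
Qed.

Lemma restR_le w r : 2 <= r -> `|restR w r| <= K r * r `^ (- b) * negpart (thR w) `^ b.
Proof.
move=> r2; have /andP[n1 n2] := n11; have r0 : 0 < r by lra.
apply: le_trans (radial_rest_bound _ _ nu0 b12 r2) _; first by rewrite !ltW.
rewrite -/(K r) powRM ?negpart_ge0 ?invr_ge0 ?(ltW r0)// -(powR_inv1 (ltW r0)).
by rewrite -powRrM mulN1r mulrA mulrAC.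
Qed.

Lemma int_restR x r : D x -> 2 <= r -> (P x).-integrable setT (EFin \o (restR^~ r)).
Proof.
move=> Dx r2.
apply: (@le_integrable _ _ _ _ _ _ _
   (EFin \o (fun w => K r * r `^ (- b) * negpart (thR w) `^ b))) => //.
- by apply/measurable_EFinP; exact: measurable_restR.
- move=> w _ /=; rewrite lee_fin; apply: le_trans (restR_le w r2) _; exact: ler_norm.
- exact: integrableRZ (int_negR Dx).
Qed.

Lemma Rintegral_restR x r : D x -> 2 <= r ->
  `|\int[P x]_w restR w r| <= K r * r `^ (- b) * M.
Proof.
move=> Dx r2; apply: le_trans (le_normr_Rintegral _ (int_restR Dx r2)) _ => //.
have intb := int_negR Dx.
have Kb : 0 <= K r * r `^ (- b) by rewrite mulr_ge0 ?powR_ge0.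
apply: (@le_trans _ _ (\int[P x]_w (K r * r `^ (- b) * negpart (thR w) `^ b))).
  apply: le_Rintegral => //.
  - have := integrable_abse (int_restR Dx r2); apply: eq_integrable => //.
  - exact: integrableRZ.
  - by move=> w _; exact: restR_le.
rewrite RintegralZl//; apply: ler_wpM2l => //.
have := momR Dx; have := integrable_fin_num measurableT intb.
by rewrite /Rintegral; case: (\int[P x]_w _)%E.
Qed.

Definition radial_drift x r : R :=
  r `^ alpha * (- (\int[P x]_w gainR w r) + \int[P x]_w restR w r).

(** An exact identity: the Box-Cox increment is the linear term minus the gain plus the rest, and
    the linear term has mean zero. Asymptotics concern [radial_drift] alone. *)
Lemma radial_driftE x r : D x -> 2 <= r ->
  (\int[P x]_w (maxone `|r + thR w| `^ nu)%:E =
   (r `^ nu * (1 + nu * r `^ (- alpha) * radial_drift x r))%:E)%E.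
Proof.
move=> Dx r2; have r0 : 0 < r by lra.
have i1 := int_gainR Dx r0; have i2 := int_restR Dx r2.
have i3 := integrableRZ r^-1 (int_thR Dx).
have i4 := integrableRB i3 i1.
have i5 := integrableRD i4 i2.
have i6 := integrableRZ (nu * r `^ nu) i5.
have i7 : (P x).-integrable setT (EFin \o (fun=> r `^ nu)).
  exact: finite_measure_integrable_cst.
have E w : maxone `|r + thR w| `^ nu =
    r `^ nu + nu * r `^ nu * (r^-1 * thR w - gainR w r + restR w r).
  have m0 := maxone_gt0 `|r + thR w|.
  have -> : r^-1 * thR w - gainR w r + restR w r = boxcox nu (maxone `|r + thR w| / r).
    by rewrite /gainR /restR /radial_rest /radial_gain; ring.
  rewrite /boxcox powRM ?(ltW m0) ?invr_ge0 ?(ltW r0)// -(powR_inv1 (ltW r0)) -powRrM mulN1r.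
  rewrite powRN; field.
  by rewrite nu0 gt_eqF// powR_gt0.
transitivity (\int[P x]_w (r `^ nu + nu * r `^ nu * (r^-1 * thR w - gainR w r + restR w r)))%:E.
  rewrite /Rintegral fineK; last first.
    by apply: integrable_fin_num => //; exact: integrableRD i7 i6.
  by apply: eq_integral => w _; rewrite E.
rewrite RintegralD// RintegralZl// RintegralD// RintegralB// RintegralZl//; last exact: int_thR.
have -> : \int[P x]_w thR w = 0 by rewrite /Rintegral mean_thR.
have -> : \int[P x]_w (cst (r `^ nu) w) = r `^ nu.
  by rewrite Rintegral_cst// [X in fine X]probability_setT mulr1.
congr EFin; rewrite /radial_drift powRN; field.
by rewrite !gt_eqF// powR_gt0.
Qed.


Lemma tailR_gain : (exists2 C, 0 <= C & forall r x, 0 < r -> D x ->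
    (\int[P x]_w (gainR w r)%:E <= (C * r `^ (- alpha))%:E)%E) /\
  forall eps, 0 < eps -> exists2 r0, 0 < r0 & forall r, r0 <= r -> forall x, D x ->
    `|r `^ alpha * fine (\int[P x]_w (gainR w r)%:E) - cR * fine (int_rad alpha nu)| <= eps.
Proof.
have /andP[n1 n2] := n11; have /andP[a1 a2] := a12.
have mg : measurable_fun setT (fun u : R => 1 - (1 + u) `^ (nu - 1)) by measurability.
have g0 (u : R) : 0 < u -> 0 <= 1 - (1 + u) `^ (nu - 1) by apply: powRDx_le1; exact: ltW.
have Jf := int_rad_fin a12 n2; rewrite int_rad.unlock in Jf.
rewrite int_rad.unlock; split.
  exact: (tail_bounded mpR (fun w => pospart_ge0 (thR w)) (lt_trans ltr01 a1) cR0
    tailR mg g0 radial_gainE Jf).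
by move=> eps; apply: (tail_asymp mpR (fun w => pospart_ge0 (thR w)) (lt_trans ltr01 a1) cR0
    tailR mg g0 radial_gainE Jf).
Qed.

(** Both exponents on the right are negative by [ab] and [anb], so the negative part of the jump
    disappears from the limit. *)
Lemma restR_drift_le x r : D x -> 2 <= r ->
  r `^ alpha * `|\int[P x]_w restR w r| <=
  4 * (1 + `|nu|^-1) * `|M| * (r `^ (alpha - b) + r `^ (alpha - nu - b)).
Proof.
move=> Dx r2; have r0 : r != 0 by rewrite gt_eqF//; lra.
apply: (@le_trans _ _ (r `^ alpha * (K r * r `^ (- b) * `|M|))).
  rewrite ler_wpM2l ?powR_ge0//; apply: le_trans (Rintegral_restR Dx r2) _.
  by rewrite ler_wpM2l ?ler_norm// mulr_ge0 ?powR_ge0.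
rewrite le_eqVlt; apply/orP; left; apply/eqP.
have Ea : r `^ (alpha - b) = r `^ alpha * r `^ (- b) by rewrite -powRD// r0 implybT.
have Eb : r `^ (alpha - nu - b) = r `^ alpha * r `^ (- nu) * r `^ (- b).
  by rewrite -!powRD// ?r0 ?implybT.
by rewrite Ea Eb /K; ring.
Qed.

(** The gain is nonnegative and enters negatively, so only the rest has to be bounded. The estimate
    covers the radii too small for the asymptotics. *)
Lemma radial_drift_le : exists2 C, 0 <= C &
  forall x r, D x -> 2 <= r -> radial_drift x r <= C.
Proof.
pose C := 4 * (1 + `|nu|^-1) * `|M|.
have C0 : 0 <= C by rewrite !mulr_ge0 ?addr_ge0 ?invr_ge0.
exists (C * 2); first by rewrite mulr_ge0.
move=> x r Dx r2; rewrite /radial_drift mulrDr.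
have r1 : 1 <= r by lra.
have ab' := ab; have anb' := anb.
have H1 : 0 <= \int[P x]_w gainR w r.
  apply: Rintegral_ge0 => w _; apply: radial_gain_ge0.
  by rewrite divr_ge0 ?pospart_ge0//; lra.
have H2 := restR_drift_le Dx r2.
have H3 : r `^ alpha * \int[P x]_w restR w r <= r `^ alpha * `|\int[P x]_w restR w r|.
  by rewrite ler_wpM2l ?powR_ge0// ler_norm.
have H4 : 0 <= r `^ alpha * \int[P x]_w gainR w r by rewrite mulr_ge0 ?powR_ge0.
have H5 : r `^ (alpha - b) <= 1.
  by rewrite -(powRr0 r) ler_powR//; lra.
have H6 : r `^ (alpha - nu - b) <= 1.
  by rewrite -(powRr0 r) ler_powR//; lra.
have H7 : C * (r `^ (alpha - b) + r `^ (alpha - nu - b)) <= C * 2 by rewrite ler_wpM2l//; lra.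
by move: H2; rewrite -/C; lra.
Qed.

Lemma radial_drift_cvg eps : 0 < eps -> exists2 r0, 2 <= r0 & forall r, r0 <= r ->
  forall x, D x -> `|radial_drift x r + cR * fine (int_rad alpha nu)| <= eps.
Proof.
move=> e0; have e3 : 0 < eps / 3 by lra.
have [r1 r10 H1] := tailR_gain.2 _ e3.
have ab' : alpha - b < 0 by rewrite subr_lt0.
have anb' : alpha - nu - b < 0 by rewrite subr_lt0.
have [r2 r20 H2] := power_cvg0 (4 * (1 + `|nu|^-1) * `|M|) ab' e3.
have [r3 r30 H3] := power_cvg0 (4 * (1 + `|nu|^-1) * `|M|) anb' e3.
exists (Num.max r1 (Num.max r2 r3)); first by rewrite !le_max r20 orbT.
move=> r; rewrite !ge_max => /and3P[R1 R2 R3] x Dx.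
have := H1 r R1 x Dx; have := H2 r R2; have := H3 r R3.
have := restR_drift_le Dx (le_trans r20 R2).
rewrite mulrDr -{1}(ger0_norm (powR_ge0 r alpha)) -normrM.
rewrite /radial_drift mulrDr /Rintegral.
move: (fine _) (fine (\int[P x]_w (restR w r)%:E)%E) => A B.
by rewrite !ler_norml; move=> /andP[? ?] ? ? /andP[? ?]; apply/andP; split; lra.
Qed.

End Radial.

Section Tangential.
Variable thT : T -> R.
Hypothesis mthT : measurable_fun setT thT.
Variable cT : R.
Hypothesis cT0 : 0 <= cT.
Hypothesis symT : forall x, D x -> forall y : R, 0 <= y ->
  P x [set w | y < negpart (thT w)] = P x [set w | y < pospart (thT w)].
Hypothesis tailT : forall eps : R, 0 < eps -> exists Y : R, forall y, Y < y ->
  forall x, D x -> `| y `^ alpha * fine (P x [set w | y < pospart (thT w)]) - cT | <= eps.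

Let mpT : measurable_fun setT (fun w => pospart (thT w)).
Proof. exact: (measurableT_comp measurable_pospart mthT). Qed.

Let mnT : measurable_fun setT (fun w => negpart (thT w)).
Proof. exact: (measurableT_comp measurable_negpart mthT). Qed.

Lemma tail_sqr x y : D x -> 0 < y ->
  (P x [set w | (y ^+ 2 < thT w ^+ 2)%R] = 2%:E * P x [set w | (y < pospart (thT w))%R])%E.
Proof.
move=> Dx y0.
have -> : [set w | y ^+ 2 < thT w ^+ 2] =
    [set w | y < pospart (thT w)] `|` [set w | y < negpart (thT w)].
  apply/seteqP; split => w /=; rewrite /pospart /negpart.
    rewrite -[thT w ^+ 2]real_normK ?num_real// ltr_pXn2r ?nnegrE ?(ltW y0)//.
    by case: (ltP (thT w) 0) => h; [rewrite ltr0_norm//; right | rewrite ger0_norm//; left].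
  rewrite -[thT w ^+ 2]real_normK ?num_real// ltr_pXn2r ?nnegrE ?(ltW y0)//.
  case: (ltP (thT w) 0) => h; [rewrite ltr0_norm// | rewrite ger0_norm//].
    by case=> //; rewrite ltNge (ltW y0).
  by case=> //; rewrite ltNge (ltW y0).
rewrite measureU//; first last.
- rewrite -subset0 => w /= []; rewrite /pospart /negpart; case: (ltP (thT w) 0) => h.
    by rewrite ltNge (ltW y0).
  by move=> _; rewrite ltNge (ltW y0).
- exact: measurable_tail_set.
- exact: measurable_tail_set.
rewrite [X in (_ + X)%E](symT Dx (ltW y0)).
by rewrite mule_natl mule2n.
Qed.

(** A tangential jump changes the squared norm by exactly [thT w ^+ 2], so the tail of the square
    matters: its exponent is alpha / 2, and symmetry doubles the constant. *)
Lemma tailT_sqr (eps : R) : 0 < eps -> exists Y : R, forall y, Y < y ->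
  forall x, D x ->
    `| y `^ (alpha / 2) * fine (P x [set w | y < thT w ^+ 2]) - 2 * cT | <= eps.
Proof.
move=> e0; have e2 : 0 < eps / 2 by lra.
have [Y HY] := tailT e2; exists (Num.max Y 0 ^+ 2) => y Yy x Dx.
have y0 : 0 < y by apply: le_lt_trans Yy; exact: sqr_ge0.
have s0 : 0 < Num.sqrt y by rewrite sqrtr_gt0.
have Ys : Y < Num.sqrt y.
  apply: (@le_lt_trans _ _ (Num.max Y 0)); first by rewrite le_max lexx.
  rewrite -(ltr_pXn2r (ltn0Sn 1)) ?nnegrE ?le_max ?lexx ?orbT ?(ltW s0)//.
  by rewrite sqr_sqrtr// ltW.
rewrite -{2}(sqr_sqrtr (ltW y0)) tail_sqr//.
have := HY _ Ys x Dx; have := tail_fin P mpT x (Num.sqrt y).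
have -> : y `^ (alpha / 2) = Num.sqrt y `^ alpha.
  by rewrite -powR12_sqrt ?(ltW y0)// -powRrM mulrC.
case: (P x _) => [p| |]// _ /=.
by rewrite !ler_norml => /andP[? ?]; apply/andP; split; lra.
Qed.

Let gainT w r := boxcox (nu / 2) (1 + thT w ^+ 2 / r ^+ 2).

Lemma tailT_gain : (exists2 C, 0 <= C & forall r x, 0 < r -> D x ->
    (\int[P x]_w (gainT w r)%:E <= (C * r `^ (- alpha))%:E)%E) /\
  forall eps, 0 < eps -> exists2 r0, 0 < r0 & forall r, r0 <= r -> forall x, D x ->
    `|r `^ alpha * fine (\int[P x]_w (gainT w r)%:E) - 2 * cT * fine (int_tan (alpha / 2) (nu / 2))| <= eps.
Proof.
have /andP[n1 n2] := n11; have /andP[a1 a2] := a12.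
have mZ : measurable_fun setT (fun w => thT w ^+ 2) by measurability.
have Z0 w : 0 <= thT w ^+ 2 by exact: sqr_ge0.
have mg : measurable_fun setT (fun u : R => (1 + u) `^ (nu / 2 - 1)) by measurability.
have g0 (u : R) : 0 < u -> 0 <= (1 + u) `^ (nu / 2 - 1) by rewrite powR_ge0.
have h0 : 0 < alpha / 2 by lra.
have c0 : 0 <= 2 * cT by rewrite mulr_ge0.
have nu2 : nu / 2 != 0 by rewrite mulf_neq0// invr_neq0.
have GE t : 0 <= t -> (\int[mu]_(u in `]0%R, t[) ((1 + u) `^ (nu / 2 - 1))%:E =
   (boxcox (nu / 2) (1 + t))%:E)%E.
  by move=> t0; rewrite integral_ray_oo// integral_powR_boxcox.
have Jf : int_tan (alpha / 2) (nu / 2) \is a fin_num by apply: int_tan_fin; lra.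
rewrite int_tan.unlock in Jf.
have sq r p : 0 < r -> (r ^+ 2) `^ p = r `^ (2 * p).
  by move=> r0; rewrite -powR_mulrn ?(ltW r0)// -powRrM.
have [C C0 HC] := tail_bounded mZ Z0 h0 c0 tailT_sqr mg g0 GE Jf.
have HA := tail_asymp mZ Z0 h0 c0 tailT_sqr mg g0 GE Jf.
rewrite int_tan.unlock; split.
  exists C => // r x r0 Dx; have := HC (r ^+ 2) x (exprn_gt0 2 r0) Dx.
  by rewrite sq// (_ : 2 * - (alpha / 2) = - alpha); last lra.
move=> eps e0; have [r0 r00 H] := HA eps e0.
exists (Num.max r0 1); first by rewrite lt_max ltr01 orbT.
move=> r; rewrite ge_max => /andP[rr r1] x Dx.
have rp : 0 < r by lra.
have := H (r ^+ 2) _ x Dx.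
rewrite sq// (_ : 2 * (alpha / 2) = alpha); last lra.
apply; apply: le_trans rr _; rewrite expr2 -{1}(mulr1 r); rewrite ler_pM2l//.
Qed.

(** The factor 1/2 comes from writing r^nu as the power nu / 2 of the squared norm; it cancels the 2
    of the two-sided tail. *)
Definition tangential_drift x r : R :=
  r `^ alpha * fine (\int[P x]_w (gainT w r)%:E) / 2.

Lemma gainT_ge0 w r : 0 <= gainT w r.
Proof.
have t0 : 0 <= thT w ^+ 2 / r ^+ 2 by rewrite divr_ge0 ?sqr_ge0.
have nu2 : nu / 2 != 0 by rewrite mulf_neq0// invr_neq0.
have /andP[n1 n2] := n11.
apply: le_trans (le_boxcox _ _ nu2); last 2 first.
- by rewrite ltr_pwDl.
- by apply/andP; split; lra.
by rewrite subr_ge0 invf_le1 ?ltr_pwDl// lerDl.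
Qed.

Lemma measurable_gainT r : measurable_fun setT (gainT^~ r).
Proof. by rewrite /gainT /boxcox; measurability. Qed.

Lemma int_gainT x r : D x -> 0 < r -> (P x).-integrable setT (EFin \o (gainT^~ r)).
Proof.
move=> Dx r0; have [[C C0 HC] _] := tailT_gain.
apply/integrableP; split; first by apply/measurable_EFinP; exact: measurable_gainT.
apply: le_lt_trans (ltry (C * r `^ (- alpha))); apply: le_trans (HC r x r0 Dx).
rewrite le_eqVlt; apply/orP; left; apply/eqP; apply: eq_integral => w _ /=.
by rewrite ger0_norm// gainT_ge0.
Qed.

Lemma tangential_driftE x r : D x -> 2 <= r ->
  (\int[P x]_w (maxone (Num.sqrt (r ^+ 2 + thT w ^+ 2)) `^ nu)%:E =
   (r `^ nu * (1 + nu * r `^ (- alpha) * tangential_drift x r))%:E)%E.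
Proof.
move=> Dx r2; have r0 : 0 < r by lra.
have i1 := int_gainT Dx r0.
have i2 := integrableRZ (nu / 2 * r `^ nu) i1.
have i3 : (P x).-integrable setT (EFin \o (fun=> r `^ nu)).
  exact: finite_measure_integrable_cst.
have E w : maxone (Num.sqrt (r ^+ 2 + thT w ^+ 2)) `^ nu =
    r `^ nu + nu / 2 * r `^ nu * gainT w r.
  have t0 : 0 <= thT w ^+ 2 / r ^+ 2 by rewrite divr_ge0 ?sqr_ge0.
  have -> : Num.sqrt (r ^+ 2 + thT w ^+ 2) = r * Num.sqrt (1 + thT w ^+ 2 / r ^+ 2).
    rewrite -{2}(gtr0_norm r0) -sqrtr_sqr -sqrtrM ?sqr_ge0//; congr Num.sqrt.
    by field; rewrite gt_eqF.
  have s1 : 1 <= Num.sqrt (1 + thT w ^+ 2 / r ^+ 2).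
    by rewrite -{1}sqrtr1 ler_sqrt ?lerDl// addr_ge0.
  rewrite maxone_id; last first.
    by apply: le_trans (_ : r <= _); [lra | rewrite ler_peMr// ltW].
  rewrite powRM ?(ltW r0)// ?sqrtr_ge0// -powR12_sqrt ?addr_ge0// -powRrM mulrC -[2^-1 * nu]mulrC.
  rewrite /gainT /boxcox; field.
  by rewrite nu0.
transitivity (\int[P x]_w (r `^ nu + nu / 2 * r `^ nu * gainT w r))%:E.
  rewrite /Rintegral fineK; last by apply: integrable_fin_num => //; exact: integrableRD i3 i2.
  by apply: eq_integral => w _; rewrite E.
rewrite RintegralD// RintegralZl//.
rewrite Rintegral_cst// [X in fine X]probability_setT mulr1.
congr EFin; rewrite /tangential_drift /Rintegral powRN; field.
by rewrite gt_eqF// powR_gt0.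
Qed.

Lemma tangential_drift_le : exists2 C, 0 <= C &
  forall x r, D x -> 2 <= r -> tangential_drift x r <= C.
Proof.
have [[C C0 HC] _] := tailT_gain; exists C => // x r Dx r2.
have r0 : 0 < r by lra.
have := HC r x r0 Dx.
rewrite /tangential_drift -(fineK (integrable_fin_num measurableT (int_gainT Dx r0))) lee_fin.
move: (fine _) => A; have p0 : 0 < r `^ alpha by rewrite powR_gt0.
rewrite powRN -ler_pdivrMr ?invr_gt0// invrK => H.
have : 0 <= C by []. by move: H; rewrite mulrC; move: (_ * A) => z; lra.
Qed.

Lemma tangential_drift_cvg eps : 0 < eps -> exists2 r0, 2 <= r0 & forall r, r0 <= r ->
  forall x, D x -> `|tangential_drift x r - cT * fine (int_tan (alpha / 2) (nu / 2))| <= eps.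
Proof.
move=> e0; have [r0 r00 H] := tailT_gain.2 _ e0.
exists (Num.max r0 2); first by rewrite le_max lexx orbT.
move=> r; rewrite ge_max => /andP[rr _] x Dx; have := H r rr x Dx.
rewrite /tangential_drift; move: (fine (int_tan _ _)) (_ `^ _ * _) => B A.
by rewrite !ler_norml => /andP[? ?]; apply/andP; split; lra.
Qed.

End Tangential.
End JumpDrift.

(** * Markov chains and Lyapunov functions *)

Section IntegralDisintegration.
Context {R : realType} {d1 d2 : measure_display} {S : measurableType d1} {Y : measurableType d2}.
Local Open Scope ereal_scope.
Import HBNNSimple.
Variables (m : {measure set S -> \bar R}) (D : set S) (nu : {measure set Y -> \bar R}).
Variable k : S -> {measure set Y -> \bar R}.
Hypotheses (mD : measurable D).
Hypothesis mk : forall B, measurable B -> measurable_fun [set: S] (k ^~ B).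
Hypothesis nuE : forall B, measurable B -> nu B = \int[m]_(s in D) k s B.

Lemma ge0_integral_disintegration_nnsfun (h : {nnsfun Y >-> R}) :
  \int[nu]_y (h y)%:E = \int[m]_(s in D) \int[k s]_y (h y)%:E.
Proof.
under [in RHS]eq_integral do rewrite integralT_nnsfun sintegralE.
rewrite integralT_nnsfun sintegralE ge0_integral_fsum//; last 2 first.
- move=> r; apply: measurable_funTS; apply: measurable_funeM; exact: mk.
- by move=> r s _; exact: nnsfun_mulemu_ge0.
apply: eq_fsbigr => r _; rewrite nuE//.
have [r0|r0] := leP 0%R r.
  rewrite ge0_integralZl//; apply: measurable_funTS; exact: mk.
rewrite (_ : h @^-1` [set r] = set0).
  rewrite integral0_eq; last by move=> s _; rewrite measure0.
  by rewrite mule0 integral0_eq// => s _; rewrite measure0 mule0.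
by rewrite preimage_nnfun0.
Qed.

Lemma ge0_integral_disintegration (f : Y -> \bar R) : measurable_fun [set: Y] f ->
  (forall y, 0 <= f y) -> \int[nu]_y f y = \int[m]_(s in D) \int[k s]_y f y.
Proof.
move=> mf f0; pose h := nnsfun_approx measurableT mf.
have mh n : measurable_fun [set: Y] (fun y => (h n y)%:E) by exact/measurable_EFinP.
have h0 n y : 0 <= (h n y)%:E by rewrite lee_fin.
have hnd y : {homo (fun n => (h n y)%:E) : p q / (p <= q)%N >-> p <= q}.
  by move=> p q pq; rewrite lee_fin; exact/lefP/nd_nnsfun_approx.
have cvgh (mu' : {measure set Y -> \bar R}) :
    \int[mu']_y f y = limn (fun n => \int[mu']_y (h n y)%:E).
  rewrite -monotone_convergence//.
  apply: eq_integral => y _; apply/esym/cvg_lim => //.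
  exact: cvg_nnsfun_approx.
rewrite cvgh.
under eq_fun do rewrite ge0_integral_disintegration_nnsfun.
rewrite -monotone_convergence//.
- by apply: eq_integral => s _; rewrite cvgh.
- move=> n; apply: measurable_funTS; apply: measurable_fun_integral_kernel => //.
- by move=> n s _; apply: integral_ge0 => y _.
- move=> s _ p q pq; apply: ge0_le_integral => //.
  by move=> y _; exact: hnd.
Qed.

End IntegralDisintegration.

Section IntegralImage.
Context {R : realType} {d1 d2 : measure_display} {S : measurableType d1} {Y : measurableType d2}.
Local Open Scope ereal_scope.
Variables (m : {measure set S -> \bar R}) (D : set S) (nu : {measure set Y -> \bar R}).
Variable phi : S -> Y.
Hypotheses (mD : measurable D) (mphi : measurable_fun setT phi).
Hypothesis nuE : forall B, measurable B -> nu B = m (D `&` phi @^-1` B).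

Lemma ge0_integral_image (f : Y -> \bar R) : measurable_fun [set: Y] f ->
  (forall y, 0 <= f y) -> \int[nu]_y f y = \int[m]_(s in D) f (phi s).
Proof.
move=> mf f0.
rewrite (@ge0_integral_disintegration _ _ _ _ _ m D nu (fun s => \d_(phi s)))//.
- by apply: eq_integral => s _; rewrite integral_dirac// diracT mul1e.
- move=> B mB; apply: (measurableT_comp (f := fun y => \d_y B)) => //.
  exact: measurable_fun_dirac.
- move=> B mB; rewrite nuE//.
  transitivity (\int[m]_(s in D) (\1_(phi @^-1` B) s)%:E).
    rewrite integral_indic//; first by rewrite setIC.
    by rewrite -[X in measurable X]setTI; exact: mphi.
  by apply: eq_integral => s _; rewrite /dirac.
Qed.

End IntegralImage.

Section MarkovChain.
Context {R : realType} {d : measure_display} {Omega : measurableType d}.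
Variables (X : set (R * R)) (P : R * R -> probability Omega R)
  (xi : nat -> Omega -> R * R) (K : R.-pker (R * R)%type ~> (R * R)%type).
Hypothesis chain : is_markov_chain X P xi K.
Local Open Scope ereal_scope.

Lemma measurable_xi n : measurable_fun setT (xi n).
Proof. by case: chain. Qed.

Lemma measurable_hist A n : (forall i, measurable (A i)) -> measurable (hist xi A n).
Proof.
move=> mA; have -> : hist xi A n = \bigcap_(i in [set i | (i <= n)%N]) (xi i @^-1` A i).
  by apply/seteqP; split => w h i /=; exact: h.
apply: bigcap_measurable => [|i _]; first by exists 0%N.
by rewrite -[X in measurable X]setTI; exact: measurable_xi.
Qed.

Lemma hist0 A : hist xi A 0 = xi 0%N @^-1` A 0%N.
Proof.
apply/seteqP; split => w; first by move=> /(_ 0%N (leqnn 0)).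
by move=> h i; rewrite leqn0 => /eqP ->.
Qed.

Lemma histS A n : hist xi A n.+1 = hist xi A n `&` xi n.+1 @^-1` A n.+1.
Proof.
apply/seteqP; split => w.
  by move=> h; split; [move=> i /leqW; exact: h | exact: h].
move=> [h hS] i; rewrite leq_eqVlt => /predU1P[->//|]; rewrite ltnS; exact: h.
Qed.

Lemma measurable_kernel_integral (V : R * R -> \bar R) : measurable_fun setT V ->
  (forall y, 0 <= V y) -> measurable_fun setT (fun y => \int[K y]_z V z).
Proof.
move=> mV V0; apply: measurable_fun_integral_kernel => // U mU.
exact: measurable_kernel.
Qed.

(** The chain hypothesis is the case of indicator functions: it disintegrates the law of [xi n.+1],
    restricted to the history, along the kernels [K (xi n w)]. *)
Lemma integral_hist_Markov x A n (V : R * R -> \bar R) : X x ->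
  (forall i, measurable (A i)) -> measurable_fun setT V -> (forall y, 0 <= V y) ->
  \int[P x]_(w in hist xi A n) V (xi n.+1 w) =
  \int[P x]_(w in hist xi A n) \int[K (xi n w)]_z V z.
Proof.
move=> Xx mA mV V0; have mh := measurable_hist n mA.
have [_ /(_ x Xx)[_ [_ /(_ n A)mk]]] := chain.
have mx := measurable_xi n.+1.
pose xS : {mfun Omega >-> (R * R)%type} := mfun_Sub (mem_set mx).
pose nu := pushforward (mrestr (P x) mh) xS.
transitivity (\int[nu]_y V y).
  apply/esym; apply: (@ge0_integral_image _ _ _ _ _ (P x)) => // B mB.
  by rewrite /nu /pushforward/= /mrestr setIC.
rewrite (@ge0_integral_disintegration _ _ _ _ _ (P x) (hist xi A n) _ (fun w => K (xi n w)))//.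
- move=> B mB; apply: (measurableT_comp (f := fun y => K y B)); last exact: measurable_xi.
  exact: measurable_kernel.
- by move=> B mB; rewrite -mk// /nu /pushforward/= /mrestr setIC.
Qed.

(** The semigroup of the chain killed on leaving the sets A. These depend on time, so that free
    initial periods and a special first step can be encoded. *)
Definition occupation x A n (V : R * R -> \bar R) := \int[P x]_(w in hist xi A n) V (xi n w).

Lemma occupationS x A n (V : R * R -> \bar R) : X x -> (forall i, measurable (A i)) ->
  measurable_fun setT V -> (forall y, 0 <= V y) ->
  occupation x A n.+1 V = occupation x A n (fun y => \int[K y]_(z in A n.+1) V z).
Proof.
move=> Xx mA mV V0; rewrite /occupation histS.
have mV' : measurable_fun setT (V \_ (A n.+1)).
  by apply/(measurable_restrictT _ (mA n.+1)); exact: measurable_funTS.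
have V'0 y : 0 <= (V \_ (A n.+1)) y by rewrite patchE; case: ifP.
rewrite integral_mkcondr.
transitivity (\int[P x]_(w in hist xi A n) (V \_ (A n.+1)) (xi n.+1 w)).
  by [].
rewrite (integral_hist_Markov n Xx mA mV' V'0); apply: eq_integral => w _.
exact/esym/integral_mkcond.
Qed.

Lemma start_ae x : X x -> {ae P x, forall w, xi 0%N w = x}.
Proof.
move=> Xx; have [_ /(_ x Xx)[H _]] := chain.
have mS : measurable [set w | xi 0%N w = x].
  have -> : [set w | xi 0%N w = x] = xi 0%N @^-1` ([set x.1] `*` [set x.2]).
    apply/seteqP; split => w /=; first by move=> ->.
    by move=> [h1 h2]; apply/eqP; rewrite [xi 0%N w]surjective_pairing h1 h2 -surjective_pairing.
  rewrite -[X in measurable X]setTI; apply: measurable_xi => //.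
  exact: measurableX.
exists (~` [set w | xi 0%N w = x]); split => //; first exact: measurableC.
by rewrite probability_setC// H subee.
Qed.

Lemma state_ae x n : measurable X -> X x -> {ae P x, forall w, X (xi n w)}.
Proof.
move=> mX Xx; have [_ /(_ x Xx)[_ [H _]]] := chain.
have mS : measurable (xi n @^-1` X).
  by rewrite -[X in measurable X]setTI; exact: measurable_xi.
exists (~` (xi n @^-1` X)); split => //; first exact: measurableC.
by rewrite probability_setC// H subee.
Qed.

Lemma occupation0 x A (V : R * R -> \bar R) : X x -> (forall i, measurable (A i)) ->
  measurable_fun setT V -> (forall y, 0 <= V y) ->
  A 0%N x -> occupation x A 0 V = V x.
Proof.
move=> Xx mA mV V0 Ax; rewrite /occupation hist0 integral_mkcond.
transitivity (\int[P x]_w cst (V x) w); last first.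
  by rewrite integral_cst// [X in _ * X]probability_setT mule1.
have mm : measurable (xi 0%N @^-1` A 0%N).
  by rewrite -[X in measurable X]setTI; exact: measurable_xi.
apply: ae_eq_integral => //.
  apply/(measurable_restrictT _ mm); apply: measurable_funTS.
  exact: measurableT_comp mV (measurable_xi 0).
apply: filterS (start_ae Xx) => w /= xw _.
rewrite patchE -[w \in _]/(xi 0%N w \in A 0%N) xw mem_set//.
Qed.

(** [is_markov_chain] constrains K only along paths, hence at states of X; time 0 with unrestricted
    sets identifies K x with the law of the next state. *)
Lemma kernel_law x : X x -> forall f : R * R -> \bar R, measurable_fun setT f ->
  (forall y, 0 <= f y) -> \int[K x]_z f z = \int[P x]_w f (xi 1%N w).
Proof.
move=> Xx f mf f0.
pose A (i : nat) : set (R * R) := setT.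
have mA i : measurable (A i) by exact: measurableT.
have := occupationS 0 Xx mA mf f0.
rewrite occupation0//.
  move=> <-; rewrite /occupation (_ : hist _ _ _ = setT)//.
  by apply/seteqP; split => w.
- exact: measurable_kernel_integral.
- by move=> y; exact: integral_ge0.
Qed.

Lemma le_occupation x A n (V W : R * R -> \bar R) : measurable X -> X x ->
  (forall i, measurable (A i)) ->
  measurable_fun setT V -> measurable_fun setT W -> (forall y, 0 <= V y) -> (forall y, 0 <= W y) ->
  (forall y, X y -> A n y -> V y <= W y) -> occupation x A n V <= occupation x A n W.
Proof.
move=> mX Xx mA mV mW V0 W0 VW; apply: ae_ge0_le_integral => //.
- exact: measurable_hist.
- apply: measurable_funTS; exact: measurableT_comp mV (measurable_xi n).
- apply: measurable_funTS; exact: measurableT_comp mW (measurable_xi n).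
- apply: filterS (state_ae n mX Xx) => w Xw /(_ n (leqnn n)) Aw; exact: VW.
Qed.

Lemma occupationD x A n (V W : R * R -> \bar R) :
  (forall i, measurable (A i)) ->
  measurable_fun setT V -> measurable_fun setT W -> (forall y, 0 <= V y) -> (forall y, 0 <= W y) ->
  occupation x A n (V \+ W) = occupation x A n V + occupation x A n W.
Proof.
move=> mA mV mW V0 W0; rewrite /occupation ge0_integralD//.
- exact: measurable_hist.
- apply: measurable_funTS; exact: measurableT_comp mV (measurable_xi n).
- apply: measurable_funTS; exact: measurableT_comp mW (measurable_xi n).
Qed.

Lemma occupationZ x A n (k : R) (V : R * R -> \bar R) :
  (forall i, measurable (A i)) -> (0 <= k)%R ->
  measurable_fun setT V -> (forall y, 0 <= V y) ->
  occupation x A n (fun y => k%:E * V y) = k%:E * occupation x A n V.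
Proof.
move=> mA k0 mV V0; rewrite /occupation ge0_integralZl//.
- exact: measurable_hist.
- apply: measurable_funTS; exact: measurableT_comp mV (measurable_xi n).
Qed.

Lemma occupation1 x A n : (forall i, measurable (A i)) ->
  occupation x A n (fun=> 1) = P x (hist xi A n).
Proof. by move=> mA; rewrite /occupation integral_cst ?mul1e//; exact: measurable_hist. Qed.

Lemma occupation_ge0 x A n (V : R * R -> \bar R) : (forall y, 0 <= V y) -> 0 <= occupation x A n V.
Proof. by move=> V0; apply: integral_ge0. Qed.

End MarkovChain.

Lemma sume_cst_ord (R : realType) n (x : \bar R) : (0 <= x)%E ->
  (\sum_(j < n) x = n%:R%:E * x)%E.
Proof.
move=> x0; elim: n => [|n IH]; first by rewrite big_ord0 mul0e.
by rewrite big_ord_recr/= IH -natr1 EFinD ge0_muleDl ?lee_fin// mul1e.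
Qed.

(** * Drift inequalities for the chain killed on leaving given sets *)

Section Lyapunov.
Context {R : realType} {d : measure_display} {Omega : measurableType d}.
Variables (X : set (R * R)) (P : R * R -> probability Omega R)
  (xi : nat -> Omega -> R * R) (K : R.-pker (R * R)%type ~> (R * R)%type).
Hypothesis mX : measurable X.
Hypothesis chain : is_markov_chain X P xi K.
Local Open Scope ereal_scope.
Local Notation occ := (occupation P xi).
Variables (x : R * R) (A : nat -> set (R * R)) (m : nat).
Hypotheses (Xx : X x) (mA : forall i, measurable (A i)).

Section Drain.
Variables (V w : R * R -> R).
Hypotheses (mV : measurable_fun setT V) (mw : measurable_fun setT w).
Hypotheses (V0 : forall y, (0 <= V y)%R) (w0 : forall y, (0 <= w y)%R).
Hypothesis drain : forall i y, (m <= i)%N -> X y -> A i y ->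
  \int[K y]_(z in A i.+1) (V z)%:E + (w y)%:E <= (V y)%:E.

Let V0' y : 0 <= (V y)%:E. Proof. by rewrite lee_fin. Qed.
Let w0' y : 0 <= (w y)%:E. Proof. by rewrite lee_fin. Qed.
Let mV' : measurable_fun setT (EFin \o V). Proof. exact/measurable_EFinP. Qed.
Let mw' : measurable_fun setT (EFin \o w). Proof. exact/measurable_EFinP. Qed.

(** Dynkin's formula as an inequality: each step from time m on removes the mean of w from that of
    V, and killing only helps. *)
Lemma occupation_drain n :
  occ x A (m + n) (EFin \o V) + \sum_(j < n) occ x A (m + j) (EFin \o w) <=
  occ x A m (EFin \o V).
Proof.
elim: n => [|n IH]; first by rewrite big_ord0 adde0 addn0.
apply: le_trans IH; rewrite big_ord_recr/= addnS addeA [leLHS]addeAC leeD2r//.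
rewrite (occupationS chain (m + n) Xx mA mV' V0').
have mKV : measurable_fun setT (fun y => \int[K y]_(z in A (m + n).+1) (V z)%:E).
  have -> : (fun y => \int[K y]_(z in A (m + n).+1) (V z)%:E) =
      (fun y => \int[K y]_z ((EFin \o V) \_ (A (m + n).+1)) z).
    by apply/funext => y; rewrite integral_mkcond.
  apply: measurable_kernel_integral; last by move=> y; rewrite patchE; case: ifP => // _; exact: V0'.
  by apply/(measurable_restrictT _ (mA _)); exact: measurable_funTS.
have KV0 y : 0 <= \int[K y]_(z in A (m + n).+1) (V z)%:E by apply: integral_ge0 => z _; exact: V0'.
rewrite -(occupationD chain x _ mA mKV mw' KV0 w0').
apply: (le_occupation chain) => //.
- exact: emeasurable_funD.
- by move=> y; rewrite adde_ge0//; exact: w0'.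
- by move=> y Xy Ay; exact: (drain (leq_addr n m)).
Qed.

(** The survival events decrease in time, so n times the last probability is at most the sum of n
    earlier ones. The level h is left free to balance the two terms on the right. *)
Lemma hist_decay (h c : R) n : (0 < h)%R -> (0 < c)%R ->
  (forall i y, (m <= i)%N -> X y -> A i y -> (V y <= h)%R -> (c <= w y)%R) ->
  (n%:R)%:E * P x (hist xi A (m + n)) <= (c^-1 + n%:R / h)%:E * occ x A m (EFin \o V).
Proof.
move=> h0 c0 cw.
have one0 (y : R * R) : 0 <= 1 :> \bar R by [].
(* Either V <= h, where w drains at least c, or V > h, where Markov applies. *)
have step j : (j < n)%N -> P x (hist xi A (m + n)) <=
    (c^-1)%:E * occ x A (m + j) (EFin \o w) + (h^-1)%:E * occ x A m (EFin \o V).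
  move=> jn; have c1 : (0 <= c^-1)%R by rewrite invr_ge0 ltW.
  have h1 : (0 <= h^-1)%R by rewrite invr_ge0 ltW.
  apply: (@le_trans _ _ (P x (hist xi A (m + j)))).
    apply: le_measure; rewrite ?inE; try exact: (measurable_hist chain).
    move=> s Hs i ij; apply: Hs; apply: leq_trans ij _.
    by rewrite leq_add2l ltnW.
  rewrite -(occupation1 chain x _ mA).
  apply: (@le_trans _ _ (occ x A (m + j) (fun y => (c^-1)%:E * (w y)%:E + (h^-1)%:E * (V y)%:E))).
    apply: (le_occupation chain) => //.
    - by apply: emeasurable_funD; exact: measurable_funeM.
    - by move=> y; rewrite adde_ge0// mule_ge0.
    - move=> y Xy Ay; rewrite -!EFinM -EFinD lee_fin.
      have [Vh|hV] := leP (V y) h.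
        have := cw _ _ (leq_addr j m) Xy Ay Vh => cwy.
        rewrite -[leLHS]addr0 lerD ?mulr_ge0//.
        by rewrite mulrC ler_pdivlMr// mul1r.
      rewrite -[leLHS]add0r lerD ?mulr_ge0//.
      by rewrite mulrC ler_pdivlMr// mul1r ltW.
  rewrite (occupationD chain)//; last 4 first.
  - exact: measurable_funeM.
  - exact: measurable_funeM.
  - by move=> y; rewrite mule_ge0.
  - by move=> y; rewrite mule_ge0.
  rewrite !(occupationZ chain)// leeD2l// lee_wpmul2l//.
  apply: le_trans (occupation_drain j); rewrite leeDl//.
  by apply: sume_ge0 => i _; exact: occupation_ge0.
have -> : (n%:R)%:E * P x (hist xi A (m + n)) = \sum_(j < n) P x (hist xi A (m + n)).
  by rewrite sume_cst_ord.
apply: (@le_trans _ _ (\sum_(j < n) ((c^-1)%:E * occ x A (m + j) (EFin \o w) +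
    (h^-1)%:E * occ x A m (EFin \o V)))).
  by apply: lee_sum => j _; exact: step.
rewrite big_split/= -ge0_sume_distrr; last by move=> j _; exact: occupation_ge0.
rewrite sume_cst_ord; last first.
  by rewrite mule_ge0 ?lee_fin ?invr_ge0 ?(ltW h0)//; exact: occupation_ge0.
rewrite EFinD ge0_muleDl ?lee_fin ?invr_ge0 ?(ltW c0)//; last first.
  by rewrite divr_ge0 ?(ltW h0).
rewrite EFinM -[_%:E * _%:E * _]muleA leeD2r// lee_wpmul2l ?lee_fin ?invr_ge0 ?(ltW c0)//.
apply: le_trans (occupation_drain n); rewrite leeDr//.
exact: occupation_ge0.
Qed.

End Drain.

(** A bounded function that keeps a fraction e of its mean at every step forces survival: after n
    steps its mean is at least e^n times the initial one, and at most C times the survival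
    probability. *)
Lemma hist_lower_bound (V : R * R -> R) (C e : R) n :
  measurable_fun setT V -> (forall y, (0 <= V y)%R) -> (forall y, (V y <= C)%R) -> (0 <= e <= 1)%R ->
  (forall i y, (m <= i)%N -> X y -> A i y ->
     (e * V y)%:E <= \int[K y]_(z in A i.+1) (V z)%:E) ->
  (e ^+ n)%:E * occ x A m (EFin \o V) <= C%:E * P x (hist xi A (m + n)).
Proof.
move=> mV V0 VC /andP[e0 e1] HV.
have C0 : (0 <= C)%R by apply: le_trans (V0 (0, 0)%R) (VC _).
have mV' : measurable_fun setT (EFin \o V) by exact/measurable_EFinP.
have V0' y : 0 <= (EFin \o V) y by rewrite lee_fin.
apply: (@le_trans _ _ (occ x A (m + n) (EFin \o V))); last first.
  rewrite -(occupation1 chain x _ mA) -(occupationZ chain)//.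
  apply: (le_occupation chain) => //; first by move=> y; rewrite mule_ge0 ?lee_fin.
  by move=> y _ _; rewrite mule1 lee_fin.
elim: n => [|n IH]; first by rewrite expr0 mul1e addn0.
rewrite exprS EFinM -muleA.
apply: (@le_trans _ _ (e%:E * occ x A (m + n) (EFin \o V))).
  by rewrite lee_wpmul2l// lee_fin.
rewrite addnS (occupationS chain _ Xx mA mV' V0') -(occupationZ chain)//.
apply: (le_occupation chain) => //.
- exact: measurable_funeM.
- have -> : (fun y => \int[K y]_(z in A (m + n).+1) (EFin \o V) z) =
      (fun y => \int[K y]_z ((EFin \o V) \_ (A (m + n).+1)) z).
    by apply/funext => y; rewrite integral_mkcond.
  apply: measurable_kernel_integral; last by move=> y; rewrite patchE; case: ifP.
  by apply/(measurable_restrictT _ (mA _)); exact: measurable_funTS.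
- by move=> y; rewrite mule_ge0// lee_fin.
- by move=> y; exact: integral_ge0.
- by move=> y Xy Ay; rewrite -EFinM; apply: HV => //; exact: leq_addr.
Qed.

End Lyapunov.

(** * Expected number of visits to a set *)

Section Visits.
Context {R : realType} {d : measure_display} {Omega : measurableType d}.
Variables (X : set (R * R)) (P : R * R -> probability Omega R)
  (xi : nat -> Omega -> R * R) (K : R.-pker (R * R)%type ~> (R * R)%type).
Hypothesis mX : measurable X.
Hypothesis chain : is_markov_chain X P xi K.
Local Open Scope ereal_scope.

Lemma measurable_xi_preimage n (B : set (R * R)) : measurable B -> measurable (xi n @^-1` B).
Proof. by move=> mB; rewrite -[X in measurable X]setTI; exact: (measurable_xi chain). Qed.

Lemma sum_visits_lty x (V : R * R -> R) (B : set (R * R)) (c : R) :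
  X x -> measurable B -> measurable_fun setT V -> (forall y, (0 <= V y)%R) -> (0 < c)%R ->
  (forall y, X y -> \int[K y]_z (V z)%:E + (c * \1_B y)%:E <= (V y)%:E) ->
  \sum_(0 <= n <oo) P x (xi n @^-1` B) < +oo.
Proof.
move=> Xx mB mV V0 c0 HV; pose A (i : nat) : set (R * R) := setT.
have mA i : measurable (A i) by exact: measurableT.
have mw : measurable_fun setT (fun y => c * \1_B y)%R.
  by apply: measurable_funM => //; exact: measurable_indic.
have w0 y : (0 <= c * \1_B y)%R by rewrite mulr_ge0 ?(ltW c0)// indicE.
have H n := @occupation_drain _ _ _ X P xi K mX chain x A 0%N Xx mA V _ mV mw V0 w0
  (fun i y _ Xy _ => HV y Xy) n.
apply: (@le_lt_trans _ _ (V x / c)%:E); last exact: ltry.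
apply: lime_le; first exact: is_cvg_nneseries.
apply: nearW => n; rewrite big_mkord.
have HA i : hist xi A i = setT by apply/seteqP; split => w.
have E j : occupation P xi x A (0 + j) (EFin \o (fun y => c * \1_B y)%R) = c%:E * P x (xi j @^-1` B).
  rewrite /occupation add0n HA; transitivity (\int[P x]_w (c%:E * (\1_(xi j @^-1` B) w)%:E)).
    by apply: eq_integral.
  rewrite ge0_integralZl//.
  - by rewrite integral_indic ?setIT//; exact: measurable_xi_preimage.
  - by apply/measurable_EFinP; apply: measurable_indic; exact: measurable_xi_preimage.
  - by rewrite lee_fin ltW.
rewrite EFinM lee_pdivlMr// muleC ge0_sume_distrr//.
under eq_bigr do rewrite -E.
have mV' : measurable_fun setT (EFin \o V) by exact/measurable_EFinP.
have V0' y : 0 <= (EFin \o V) y by rewrite lee_fin.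
rewrite -[leRHS]/((EFin \o V) x) -(occupation0 chain (A := A) Xx mA mV' V0' I).
apply: le_trans (H n); rewrite leeDr//; apply: occupation_ge0 => y.
by rewrite lee_fin.
Qed.

Lemma xiS_law x n (B : set (R * R)) : X x -> measurable B ->
  P x (xi n.+1 @^-1` B) = \int[P x]_w K (xi n w) B.
Proof.
move=> Xx mB; have [_ /(_ x Xx)[_ [_ /(_ n (fun=> setT) B (fun=> measurableT) mB)]]] := chain.
have -> : hist xi (fun=> setT) n = setT by apply/seteqP; split => w.
by rewrite setTI.
Qed.

End Visits.

Lemma powR_exprn (R : realType) (x p : R) k : 0 <= x -> (x `^ p) ^+ k = (x ^+ k) `^ p.
Proof.
move=> x0; rewrite -(powR_mulrn k (powR_ge0 x p)) -(powR_mulrn k x0) -!powRrM.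
by rewrite [k%:R * p]mulrC.
Qed.

(** * Path events and moments of the passage time *)

Section Paths.
Context {R : realType} {d : measure_display} {Omega : measurableType d}.
Variables (xi : nat -> Omega -> R * R) (mxi : forall n, measurable_fun setT (xi n)).
Local Open Scope ereal_scope.

Lemma nrm_ge0 (x : R * R) : (0 <= nrm x)%R.
Proof. exact: sqrtr_ge0. Qed.

Lemma measurable_nrm : measurable_fun setT (@nrm R).
Proof.
rewrite /nrm; apply: measurableT_sqrt; apply: measurable_funD; apply: measurableT_exp.
  exact: measurable_fst.
exact: measurable_snd.
Qed.

Let mn n : measurable_fun setT (fun w => nrm (xi n w)).
Proof. exact: measurableT_comp measurable_nrm (mxi n). Qed.

Lemma visits_finite_ae (mu : {measure set Omega -> \bar R}) (B : set (R * R)) : measurable B ->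
  \sum_(0 <= n <oo) mu (xi n @^-1` B) < +oo ->
  {ae mu, forall w, exists N, forall n, (N <= n)%N -> ~ B (xi n w)}.
Proof.
move=> mB HB; have mF n : measurable (xi n @^-1` B).
  by rewrite -[X in measurable X]setTI; exact: mxi.
have H := lim_sup_set_cvg0 mF HB.
exists (lim_sup_set (fun n => xi n @^-1` B)); split => //.
  by apply: bigcap_measurable => // k _; exact: bigcup_measurable.
move=> w /= Hw N _; apply: contrapT => HN; apply: Hw; exists N => n Nn Bn.
by apply: HN; exists n.
Qed.

Lemma nrm_cvgy_ae (mu : {measure set Omega -> \bar R}) :
  (forall k : nat, {ae mu, forall w, exists N, forall n, (N <= n)%N -> (k%:R < nrm (xi n w))%R}) ->
  {ae mu, forall w, (fun n => nrm (xi n w)) @ \oo --> +oo%R}.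
Proof.
move=> /ae_foralln; apply: filterS => w H; apply/cvgryPge => M.
have [N HN] := H (Num.truncn M).+1.
exists N => // n /= Nn; apply: ltW; apply: lt_trans (HN _ Nn).
exact: truncnS_gt.
Qed.

Lemma limn_einf_le_ae (mu : {measure set Omega -> \bar R}) (a : R) :
  (forall m, {ae mu, forall w, exists2 n, (m <= n)%N & (nrm (xi n w) <= a)%R}) ->
  {ae mu, forall w, limn_einf (fun n => (nrm (xi n w))%:E) <= a%:E}.
Proof.
move=> /ae_foralln; apply: filterS => w H.
rewrite limn_einf_lim; apply: lime_le; first exact: is_cvg_einfs.
apply: nearW => m; apply: ge_ereal_inf.
by have [n lemn na] := H m; exists (nrm (xi n w))%:E => //; exists n.
Qed.

Section Tau.
Variable a : R.
Local Notation above := [set y : R * R | (a < nrm y)%R].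

Lemma tauP w : (exists2 n, tau xi a w = (n%:R)%:E &
    (nrm (xi n w) <= a)%R /\ forall i, (i < n)%N -> (a < nrm (xi i w))%R) \/
  (tau xi a w = +oo /\ forall i, (a < nrm (xi i w))%R).
Proof.
have [H|H] := pselect (exists n, (nrm (xi n w) <= a)%R); [left|right].
  have [n Hn nmin] := ex_minnP H; exists n; last first.
    split => // i; rewrite ltNge => ni; apply/negP => Hi; move: (nmin i Hi).
    by rewrite leqNgt ni.
  apply/eqP; rewrite eq_le; apply/andP; split.
    by apply: ge_ereal_inf; exists (n%:R)%:E => //; exists n.
  by apply: le_ereal_inf_tmp => _ [i /= Hi <-]; rewrite lee_fin ler_nat; exact: nmin.
split; last by move=> i; rewrite ltNge; apply/negP => Hi; apply: H; exists i.
rewrite /tau (_ : [set n : nat | (nrm (xi n w) <= a)%R] = set0) ?image_set0 ?ereal_inf0//.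
by rewrite -subset0 => n Hn; apply: H; exists n.
Qed.

Lemma lt_tauP w n : hist xi (fun=> above) n w <-> (n%:R)%:E < tau xi a w.
Proof.
have [[k -> [Hk km]]|[-> H]] := tauP w.
  rewrite lte_fin ltr_nat; split => [h|nk i /= ni]; last by apply: km; exact: leq_ltn_trans nk.
  rewrite ltnNge; apply/negP => kn; have := h k kn => /=; by rewrite ltNge Hk.
by rewrite ltry; split => // _ i _; exact: H.
Qed.

Lemma measurable_tau : measurable_fun setT (tau xi a).
Proof.
have -> : tau xi a = (fun w => einfs (fun n => if (nrm (xi n w) <= a)%R then (n%:R)%:E else +oo) 0%N).
  apply/funext => w; apply/eqP; rewrite eq_le; apply/andP; split.
    apply: le_ereal_inf_tmp => _ [n _ <-]; case: ifPn => [h|_]; last by rewrite leey.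
    by apply: ereal_inf_lbound; exists n.
  apply: le_ereal_inf_tmp => _ [n /= h <-]; apply: ge_ereal_inf.
  by exists (n%:R)%:E => //; exists n => //; rewrite h.
apply: measurable_fun_einfs => n; apply: measurable_fun_ifT => //.
apply: measurable_fun_ler => //; exact: measurable_cst.
Qed.

Lemma measurable_poweR_tau q : measurable_fun setT (fun w => poweR (tau xi a w) q).
Proof. exact: measurableT_comp (measurable_poweR q) measurable_tau. Qed.

Lemma measurable_hist_above n : measurable (hist xi (fun=> above) n).
Proof.
have -> : hist xi (fun=> above) n = \bigcap_(i in [set i | (i <= n)%N])
    [set w | (a < nrm (xi i w))%R].
  by apply/seteqP; split => w h i /=; exact: h.
apply: bigcap_measurable => [|i _]; first by exists 0%N.
by apply: measurable_tail_set.
Qed.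

Variable mu : probability Omega R.

Lemma tau_moment_ge q n : (0 < q)%R ->
  ((n%:R : R) `^ q)%R%:E * mu (hist xi (fun=> above) n) <= \int[mu]_w poweR (tau xi a w) q.
Proof.
move=> q0; have mh := measurable_hist_above n.
apply: (@le_trans _ _ (\int[mu]_(w in hist xi (fun=> above) n) ((n%:R : R) `^ q)%R%:E)).
  by rewrite integral_cst.
apply: (@le_trans _ _ (\int[mu]_(w in hist xi (fun=> above) n) poweR (tau xi a w) q)).
  apply: ge0_le_integral => //.
  - by apply: measurable_funTS; exact: measurable_poweR_tau.
  - move=> w /lt_tauP; have [[k -> _]|[-> _]] := tauP w; last first.
      by move=> _; rewrite poweRyr ?gt_eqF// leey.
    rewrite lte_fin => nk; rewrite poweR_EFin lee_fin ge0_ler_powR ?nnegrE ?ler0n ?(ltW q0)//.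
    exact: ltW.
apply: ge0_subset_integral => //; first exact: measurable_poweR_tau.
by move=> w _; exact: poweR_ge0.
Qed.

(** Dyadic summation: if 2^k < tau <= 2^(k+1), the k-th term of the sum of 2^((k+1)q) 1[tau > 2^j]
    type weights already exceeds tau^q. In expectation the terms are geometric with ratio 2^(q-s) <
    1. *)
Lemma tau_moment_lty q s (C : R) : (0 < q)%R -> (q < s)%R -> (0 <= C)%R ->
  (forall n, (0 < n)%N -> mu (hist xi (fun=> above) n) <= (C * (n%:R : R) `^ (- s))%R%:E) ->
  \int[mu]_w poweR (tau xi a w) q < +oo.
Proof.
move=> q0 qs C0 HC.
pose c (k : nat) : R := (((2 ^ k.+1)%N%:R : R) `^ q)%R.
have c1 k : (1 <= c k)%R.
  by rewrite -[leLHS](@powRr0 R ((2 ^ k.+1)%N%:R)) ler_powR ?ler1n ?expn_gt0 ?(ltW q0).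
have c0 k : (0 <= c k)%R by exact: le_trans ler01 (c1 k).
pose f k w : \bar R := (c k * \1_(hist xi (fun=> above) (2 ^ k)%N) w)%:E.
have f0 k w : 0 <= f k w by rewrite lee_fin mulr_ge0// indicE.
have mf k : measurable_fun setT (f k).
  apply/measurable_EFinP; apply: measurable_funM => //.
  by apply: measurable_indic; exact: measurable_hist_above.
have tau_le w : poweR (tau xi a w) q <= 1 + \sum_(0 <= k <oo) f k w.
  have [[n -> [Hn nm]]|[-> H]] := tauP w; last first.
    suff -> : \sum_(0 <= k <oo) f k w = +oo by rewrite leey.
    apply: eq_infty => r; pose N := (Num.truncn r).+1.
    apply: (@le_trans _ _ (\sum_(j < N) (1 : \bar R))).
      by rewrite sume_cst_ord// mule1 lee_fin ltW// truncnS_gt.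
    apply: (@le_trans _ _ (\sum_(0 <= k < N) f k w)); last first.
      by apply: nneseries_lim_ge => k _ _.
    rewrite big_mkord; apply: lee_sum => k _; rewrite /f indicE mem_set ?mulr1 ?lee_fin//.
    by move=> i _; exact: H.
  have [n1|n1] := leqP n 1.
    rewrite -[leLHS]adde0; apply: leeD; last exact: nneseries_ge0.
    have E1 : ((1 : R) `^ q = 1)%R by rewrite powR1.
    rewrite poweR_EFin lee_fin -[leRHS]E1 ge0_ler_powR ?nnegrE ?(ltW q0)//.
    by rewrite lern1.
  (* Taken at n - 1 so that 2^k < n <= 2^(k+1): the left inequality must be strict for the path to
     be above a up to time 2^k. *)
  pose k := trunc_log 2 n.-1.
  have n0 : (0 < n.-1)%N by rewrite -subn1 subn_gt0.
  have /andP[k1 k2] := trunc_log_bounds (ltnSn 1) n0.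
  rewrite -[leLHS]add0e; apply: leeD => //.
  apply: (@le_trans _ _ (\sum_(0 <= j < k.+1) f j w)); last first.
    by apply: nneseries_lim_ge => j _ _.
  rewrite big_nat_recr//= -[leLHS]add0e; apply: leeD; first exact: sume_ge0.
  rewrite /f indicE mem_set; last first.
    move=> i ik /=; apply: nm; apply: leq_ltn_trans ik _.
    by rewrite -(ltn_predK n1) ltnS.
  rewrite mulr1 lee_fin /c ge0_ler_powR ?nnegrE ?(ltW q0)// ler_nat.
  by rewrite -(ltn_predK n1).
apply: (@le_lt_trans _ _ (\int[mu]_w (1 + \sum_(0 <= k <oo) f k w))).
  apply: ge0_le_integral => //.
  - by move=> w _; exact: poweR_ge0.
  - exact: measurable_poweR_tau.
  - by apply: emeasurable_funD => //; apply: ge0_emeasurable_sum.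
rewrite ge0_integralD//; last 2 first.
- by move=> w _; exact: nneseries_ge0.
- by apply: ge0_emeasurable_sum.
rewrite integral_cst// mul1e [X in X + _]probability_setT integral_nneseries//.
pose rho : R := (2 `^ (q - s))%R.
have rho01 : (0 <= rho < 1)%R.
  rewrite powR_ge0/= /rho -[ltRHS](@powRr0 R 2) /powR pnatr_eq0/= ltr_expR ltr_pM2r ?subr_lt0//.
  by rewrite ln_gt0// ltr1n.
have /andP[rho0 rho1] := rho01.
have Hk k : \int[mu]_w f k w <= (2 `^ q * C * rho ^+ k)%R%:E.
  under eq_integral do rewrite /f EFinM.
  rewrite ge0_integralZl//; last 2 first.
  - by apply/measurable_EFinP; apply: measurable_indic; exact: measurable_hist_above.
  - by rewrite lee_fin.
  rewrite integral_indic// ?setIT; last exact: measurable_hist_above.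
  apply: (@le_trans _ _ ((c k)%:E * (C * ((2 ^ k)%N%:R : R) `^ (- s))%R%:E)).
    by rewrite lee_wpmul2l ?lee_fin// HC// expn_gt0.
  rewrite -EFinM lee_fin /c /rho expnS natrM powRM// natrX.
  have -> : ((2 `^ (q - s)) ^+ k = ((2 ^+ k : R) `^ q) * (2 ^+ k) `^ (- s) :> R)%R.
    rewrite -powRD; last by rewrite expf_neq0 ?pnatr_eq0// implybT.
    by rewrite powR_exprn// ler0n.
  by rewrite le_eqVlt; apply/orP; left; apply/eqP; ring.
apply: (@le_lt_trans _ _ (1 + (2 `^ q * C / (1 - rho))%R%:E)); last by rewrite -EFinD ltry.
apply: leeD => //; apply: lime_le.
  by apply: is_cvg_nneseries => k _ _; exact: integral_ge0.
apply: nearW => n; rewrite big_mkord.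
apply: (@le_trans _ _ (\sum_(k < n) (2 `^ q * C * rho ^+ k)%R%:E)).
  by apply: lee_sum => k _; exact: Hk.
rewrite sumEFin lee_fin -mulr_sumr ler_wpM2l ?mulr_ge0 ?powR_ge0//.
rewrite -[leRHS]mul1r ler_pdivlMr ?subr_gt0// mulrC.
have -> : ((1 - rho) * (\sum_(k < n) rho ^+ k) = 1 - rho ^+ n)%R.
  by rewrite -[in RHS](expr1n R n) subrXX; congr (_ * _)%R; apply: eq_bigr => k _; rewrite expr1n mul1r.
by rewrite gerBl exprn_ge0.
Qed.

End Tau.
End Paths.

(** * The jump kernel *)

Section JumpGeometry.
Context {R : realType}.

Lemma sqr_nrm (x : R * R) : nrm x ^+ 2 = x.1 ^+ 2 + x.2 ^+ 2.
Proof. by rewrite sqr_sqrtr// addr_ge0 ?sqr_ge0. Qed.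

Lemma nrm_gt0 (x : R * R) : x <> origin -> 0 < nrm x.
Proof.
move=> x0; rewrite lt_neqAle nrm_ge0 andbT eq_sym; apply/eqP => n0; apply: x0.
have := sqr_nrm x; rewrite n0 expr0n/= => /esym/eqP.
rewrite paddr_eq0 ?sqr_ge0// !sqrf_eq0 => /andP[/eqP h1 /eqP h2].
by rewrite [x]surjective_pairing h1 h2.
Qed.

Lemma nrm_radial_jump (x : R * R) t : x <> origin ->
  nrm (vadd x (smul t (uvec x))) = `|nrm x + t|.
Proof.
move=> /nrm_gt0 r0; rewrite -sqrtr_sqr /nrm; congr Num.sqrt.
rewrite -/(nrm x) /vadd /smul/=.
transitivity ((1 + t / nrm x) ^+ 2 * (x.1 ^+ 2 + x.2 ^+ 2)).
  by rewrite /uvec /smul/=; ring.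
rewrite -sqr_nrm; field.
by rewrite gt_eqF.
Qed.

Lemma nrm_tangential_jump (x : R * R) t : x <> origin ->
  nrm (vadd x (smul t (vvec x))) = Num.sqrt (nrm x ^+ 2 + t ^+ 2).
Proof.
move=> /nrm_gt0 r0; rewrite {1}/nrm; congr Num.sqrt.
rewrite /vadd /smul/= /uvec /smul/=.
transitivity ((1 + (t / nrm x) ^+ 2) * (x.1 ^+ 2 + x.2 ^+ 2)).
  ring.
rewrite -sqr_nrm; field.
by rewrite gt_eqF.
Qed.

End JumpGeometry.

Section IndependentChoice.
Context {R : realType} {d : measure_display} {Omega : measurableType d}.
Variables (mu : probability Omega R) (C : set Omega) (th : Omega -> R) (p : R).
Hypotheses (mC : measurable C) (mth : measurable_fun setT th) (p0 : 0 <= p).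
Hypothesis PC : mu C = p%:E.
Hypothesis indep : forall B : set R, measurable B ->
  (mu (C `&` th @^-1` B) = mu C * mu (th @^-1` B))%E.

Lemma integral_independent_choice (g : R -> \bar R) : measurable_fun setT g ->
  (forall t, 0 <= g t)%E ->
  (\int[mu]_(w in C) g (th w) = p%:E * \int[mu]_w g (th w))%E.
Proof.
move=> mg g0; pose T : {mfun Omega >-> R} := mfun_Sub (mem_set mth).
pose nu : {measure set R -> \bar R} := mscale (NngNum p0) (distribution mu T).
rewrite -(@ge0_integral_image _ _ _ _ _ mu C nu th)//; last first.
  by move=> B mB; apply/esym; apply: etrans (indep mB) _; rewrite PC.
by rewrite /nu ge0_integral_mscale// ge0_integral_distribution.
Qed.

End IndependentChoice.

Lemma Rintegral_indic {R : realType} {d : measure_display} {T : measurableType d}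
  (mu : {measure set T -> \bar R}) (S : set T) : measurable S ->
  \int[mu]_w \1_S w = fine (mu S).
Proof. by move=> mS; rewrite /Rintegral integral_indic// setIT. Qed.

Section Jump.
Context {R : realType} {d : measure_display} {Omega : measurableType d}.
Variables (X : set (R * R)) (P : R * R -> probability Omega R)
  (xi : nat -> Omega -> R * R) (K : R.-pker (R * R)%type ~> (R * R)%type)
  (chi : Omega -> bool) (thR thT : Omega -> R) (pR : R).
Hypothesis mX : measurable X.
Hypothesis chain : is_markov_chain X P xi K.
Hypotheses (mchi : measurable [set w | chi w])
  (mthR : measurable_fun setT thR) (mthT : measurable_fun setT thT).
Hypothesis jumpE : forall x, X x -> x <> origin ->
    {ae P x, forall w, vsub (xi 1%N w) (xi 0%N w) =
       vadd (smul ((chi w)%:R * thR w) (uvec x))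
            (smul ((1 - (chi w)%:R) * thT w) (vvec x))}.
Hypothesis indep : forall x, X x -> x <> origin -> forall (b : bool) (B : set R), measurable B ->
     P x ([set w | chi w = b] `&` thR @^-1` B) =
       (P x [set w | chi w = b] * P x (thR @^-1` B))%E /\
     P x ([set w | chi w = b] `&` thT @^-1` B) =
       (P x [set w | chi w = b] * P x (thT @^-1` B))%E.
Hypothesis pR01 : 0 < pR < 1.
Hypothesis Pchi : forall x, X x -> x <> origin ->
     P x [set w | chi w] = pR%:E /\ P x [set w | ~~ chi w] = (1 - pR)%:E.

Definition states : set (R * R) := [set x | X x /\ x <> origin].

(** The norm after a jump depends on the starting norm and on one scalar only, and the choice
    between the two is independent of that scalar. All planar estimates thereby become
    one-dimensional. *)
Lemma kernel_radial_profile x (k : R -> R) : states x -> measurable_fun setT k ->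
  (forall t, 0 <= k t) ->
  (\int[K x]_z (k (nrm z))%:E = pR%:E * \int[P x]_w (k `|nrm x + thR w|)%:E +
    (1 - pR)%:E * \int[P x]_w (k (Num.sqrt (nrm x ^+ 2 + thT w ^+ 2)))%:E)%E.
Proof.
move=> [Xx x0] mk k0; have /andP[p0 p1] := pR01.
have mkn : measurable_fun setT (fun z : R * R => (k (nrm z))%:E).
  by apply/measurable_EFinP; exact: measurableT_comp mk measurable_nrm.
have mg1 : measurable_fun setT (fun t : R => (k `|nrm x + t|)%:E).
  by apply/measurable_EFinP; apply: (measurableT_comp mk); measurability.
have mg2 : measurable_fun setT (fun t : R => (k (Num.sqrt (nrm x ^+ 2 + t ^+ 2)))%:E).
  by apply/measurable_EFinP; apply: (measurableT_comp mk); measurability.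
have mf1 : measurable_fun setT (fun w => (k `|nrm x + thR w|)%:E).
  exact: measurableT_comp mg1 mthR.
have mf2 : measurable_fun setT (fun w => (k (Num.sqrt (nrm x ^+ 2 + thT w ^+ 2)))%:E).
  exact: measurableT_comp mg2 mthT.
have mnchi : measurable [set w | ~~ chi w].
  by rewrite (_ : [set w | ~~ chi w] = ~` [set w | chi w]);
    [exact: measurableC | apply/seteqP; split => w /= /negP].
rewrite (kernel_law chain Xx mkn); last by move=> z; rewrite lee_fin.
have mk1 : measurable_fun setT (fun w => (k (nrm (xi 1%N w)))%:E).
  exact: measurableT_comp mkn (measurable_xi chain 1).
have EU : [set: Omega] = [set w | chi w] `|` [set w | ~~ chi w].
  by apply/seteqP; split => w //= _; case: (chi w); [left|right].
rewrite [in LHS]EU ge0_integral_setU//; first last.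
- by apply/disj_setPRL => w /= /negP h.
- by move=> w _; rewrite lee_fin.
- exact: measurable_funTS.
have [PC PnC] := Pchi Xx x0.
have ae_jump : {ae P x, forall w, xi 1%N w =
    if chi w then vadd x (smul (thR w) (uvec x)) else vadd x (smul (thT w) (vvec x))}.
  have := jumpE Xx x0; have := start_ae chain Xx; apply: filterS2 => w -> h.
  have -> : xi 1%N w = vadd x (vsub (xi 1%N w) x).
    by rewrite /vadd /vsub/= !subrKC -surjective_pairing.
  rewrite h; case: (chi w); rewrite /= ?subrr ?subr0 !(mul0r, mul1r) /vadd/=; congr (_, _); ring.
congr (_ + _)%E.
  have ind B (mB : measurable B) := (indep Xx x0 true mB).1.
  have g0 t : (0 <= (k `|nrm x + t|)%:E)%E by rewrite lee_fin.
  rewrite -(integral_independent_choice mchi mthR (ltW p0) PC ind mg1 g0).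
  apply: ae_eq_integral => //; try exact: measurable_funTS.
  by apply: filterS ae_jump => w -> /= ->; rewrite nrm_radial_jump.
have p1' : 0 <= 1 - pR by rewrite subr_ge0 ltW.
have EC : [set w | ~~ chi w] = [set w | chi w = false].
  by apply/seteqP; split => w /=; case: (chi w).
have ind B (mB : measurable B) := (indep Xx x0 false mB).2.
have g0 t : (0 <= (k (Num.sqrt (nrm x ^+ 2 + t ^+ 2)))%:E)%E by rewrite lee_fin.
rewrite -EC in ind.
rewrite -(integral_independent_choice mnchi mthT p1' PnC ind mg2 g0).
apply: ae_eq_integral => //; try exact: measurable_funTS.
by apply: filterS ae_jump => w -> /= /negbTE ->; rewrite nrm_tangential_jump.
Qed.

Variables (cR cT alpha beta : R).
Hypothesis meanR : forall x, states x ->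
  (P x).-integrable setT (EFin \o thR) /\ (\int[P x]_w (thR w)%:E = 0)%E.
Hypotheses (a12 : 1 < alpha < 2) (cR0 : 0 < cR).
Hypothesis tailR : forall eps : R, 0 < eps -> exists Y : R, forall y, Y < y ->
  forall x, states x ->
       `| y `^ alpha * fine (P x [set w | y < pospart (thR w)]) - cR | <= eps.
Hypothesis ab : alpha < beta.
Hypothesis momR : exists M : R, forall x, states x ->
     (\int[P x]_w ((negpart (thR w)) `^ beta)%:E <= M%:E)%E.
Hypothesis symT : forall x, states x -> forall y : R, 0 <= y ->
     P x [set w | y < negpart (thT w)] = P x [set w | y < pospart (thT w)].
Hypothesis cT0 : 0 < cT.
Hypothesis tailT : forall eps : R, 0 < eps -> exists Y : R, forall y, Y < y ->
     forall x, states x ->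
       `| y `^ alpha * fine (P x [set w | y < pospart (thT w)]) - cT | <= eps.

(** The bound on the radial rest is of second order, so s^2 <= s^b for small s limits the usable
    moment to exponents at most 2. *)
Let b := Num.min beta 2.

Lemma moment_exponent : [/\ 1 <= b <= 2, alpha < b & b <= beta].
Proof.
have /andP[a1 a2] := a12; have ab' := ab.
split; rewrite /b.
- by rewrite ge_min le_min lexx orbT ler1n !andbT; lra.
- by rewrite lt_min ab.
- by rewrite ge_min lexx.
Qed.

Lemma moment_bound : exists M : R, forall x, states x ->
     (\int[P x]_w ((negpart (thR w)) `^ b)%:E <= M%:E)%E.
Proof.
have [M HM] := momR; exists (1 + M) => x Dx.
have [/andP[b1 b2] _ bb] := moment_exponent.
have mn : measurable_fun setT (fun w => negpart (thR w)).
  exact: (measurableT_comp measurable_negpart mthR).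
apply: (@le_trans _ _ (\int[P x]_w (1 + ((negpart (thR w)) `^ beta)%:E))%E).
  apply: ge0_le_integral => //.
  - by move=> w _; rewrite lee_fin powR_ge0.
  - by apply/measurable_EFinP; measurability.
  - apply: emeasurable_funD => //; apply/measurable_EFinP; measurability.
  - move=> w _; rewrite -EFinD lee_fin.
    have [n1|n1] := leP (negpart (thR w)) 1.
      rewrite -[leLHS]addr0 lerD ?powR_ge0//.
      have E1 : (1 : R) `^ b = 1 by rewrite powR1.
      rewrite -[leRHS]E1 ge0_ler_powR ?nnegrE ?negpart_ge0//.
      by rewrite (le_trans ler01 b1).
    rewrite -[leLHS]add0r lerD// ler_powR//; exact: ltW.
rewrite ge0_integralD//; last 2 first.
- by move=> w _; rewrite lee_fin powR_ge0.
- by apply/measurable_EFinP; measurability.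
rewrite integral_cst// mul1e EFinD [X in (X + _)%E]probability_setT.
by apply: leeD => //; exact: HM.
Qed.

(** The identity and the upper bound hold from norm 2 on, whatever nu is; only the radius in the
    last clause depends on nu. The one-sided bound serves at moderate radii and for the subtracted
    power of the lower bounds. *)
Definition kernel_drift_spec nu (Dr : R * R -> R) :=
  [/\ forall x, states x -> 2 <= nrm x ->
        (\int[K x]_z (maxone (nrm z) `^ nu)%:E =
          (nrm x `^ nu * (1 + nu * nrm x `^ (- alpha) * Dr x))%:E)%E,
      exists2 C, 0 <= C & forall x, states x -> 2 <= nrm x -> Dr x <= C
    & forall eps, 0 < eps -> exists2 r0, 2 <= r0 & forall x, states x -> r0 <= nrm x ->
        `|Dr x - drift_exp alpha (pR * cR) ((1 - pR) * cT) nu| <= eps].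

Lemma kernel_drift nu : -1 < nu < 1 -> nu != 0 -> alpha - nu < b ->
  exists Dr, kernel_drift_spec nu Dr.
Proof.
move=> n11 n0 anb; have [b12 ab' _] := moment_exponent; have [M HM] := moment_bound.
have /andP[p0 p1] := pR01.
have iR x (Dx : states x) := (meanR Dx).1; have mR x (Dx : states x) := (meanR Dx).2.
pose rd := radial_drift P alpha nu thR; pose td := tangential_drift P alpha nu thT.
exists (fun x => pR * rd x (nrm x) + (1 - pR) * td x (nrm x)); split.
- move=> x Dx r2.
  have mk : measurable_fun setT (fun t : R => maxone t `^ nu).
    by rewrite /maxone; measurability.
  rewrite (kernel_radial_profile (k := fun t => maxone t `^ nu) Dx mk); last first.
    by move=> t; exact: powR_ge0.
  rewrite (radial_driftE alpha n11 n0 mthR iR mR b12 HM Dx r2).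
  rewrite (tangential_driftE a12 n11 n0 mthT (ltW cT0) symT tailT Dx r2).
  by rewrite -!EFinM -EFinD; congr EFin; rewrite -/rd -/td; ring.
- have [C1 C10 H1] := radial_drift_le n11 n0 mthR b12 ab' anb HM.
  have [C2 C20 H2] := tangential_drift_le a12 n11 n0 mthT (ltW cT0) symT tailT.
  exists (C1 + C2); first exact: addr_ge0.
  move=> x Dx r2; have := H1 _ _ Dx r2; have := H2 _ _ Dx r2; rewrite -/rd -/td.
  move: (rd _ _) (td _ _) => u v hv hu.
  apply: lerD; nra.
move=> eps e0.
have [r1 r12 H1] := radial_drift_cvg a12 n11 n0 mthR (ltW cR0) tailR b12 ab' anb HM e0.
have [r2 r22 H2] := tangential_drift_cvg a12 n11 n0 mthT (ltW cT0) symT tailT e0.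
exists (Num.max r1 r2); first by rewrite le_max r12.
move=> x Dx; rewrite ge_max => /andP[R1 R2].
have := H1 _ R1 _ Dx; have := H2 _ R2 _ Dx; rewrite -/rd -/td drift_exp.unlock.
move: (rd _ _) (td _ _) (fine (int_rad _ _)) (fine (int_tan _ _)) => u v I J.
rewrite !ler_norml => /andP[v1 v2] /andP[u1 u2]; apply/andP; split; nra.
Qed.

Lemma outward_jump : exists2 T0, 0 < T0 & forall t x, T0 <= t -> states x ->
  cR / 2 * t `^ (- alpha) <= fine (P x [set w | t < pospart (thR w)]).
Proof.
have c2 : 0 < cR / 2 by rewrite divr_gt0.
have [Y HY] := tailR c2; exists (Num.max (Y + 1) 1); first by rewrite lt_max ltr01 orbT.
move=> t x; rewrite ge_max => /andP[Yt t1] Dx.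
have Yt' : Y < t by lra.
have := HY t Yt' x Dx; rewrite ler_norml => /andP[h _].
have t0 : 0 < t by lra.
rewrite powRN ler_pdivrMr ?powR_gt0// [leRHS]mulrC.
by move: (_ `^ _ * _) h => z h; lra.
Qed.

(* The jumps being centered, the heavy outward tail has to be balanced by inward
   jumps; the moment of order b > 1 keeps some of these bounded. *)
Lemma inward_jump : exists dl L p : R, [/\ 0 < dl, 0 < L, 0 < p &
  forall x, states x -> p <= fine (P x [set w | dl <= negpart (thR w) <= L])].
Proof.
have /andP[a1 a2] := a12.
have [T0 T00 HT] := outward_jump; have [/andP[b1 b2] ab' _] := moment_exponent.
have [M HM] := moment_bound; pose M' := Num.max M 0.
(* A lower bound for the mean outward jump, hence for the mean inward one. Inward jumps below dl =
   kap / 4 or above L account for at most kap / 4 each, so L times the probability of the middle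
   range is at least kap / 2. *)
pose kap := T0 * (cR / 2 * T0 `^ (- alpha)).
have kap0 : 0 < kap by rewrite !mulr_gt0 ?powR_gt0 ?invr_gt0.
have b0 : 1 - b < 0 by lra.
have [L L2 HL] := power_cvg0 M' b0 (divr_gt0 kap0 (ltr0n R 4)).
pose dl := kap / 4; have dl0 : 0 < dl by rewrite divr_gt0.
have L0 : 0 < L by lra.
exists dl, L, (dl / L); split => //; first by rewrite divr_gt0.
move=> x Dx; have [iR mR] := meanR Dx.
have mnR : measurable_fun setT (fun w => negpart (thR w)).
  exact: (measurableT_comp measurable_negpart mthR).
have mpR : measurable_fun setT (fun w => pospart (thR w)).
  exact: (measurableT_comp measurable_pospart mthR).
have bndI (f : Omega -> R) : measurable_fun setT f -> (forall w, `|f w| <= `|thR w|) ->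
    (P x).-integrable setT (EFin \o f).
  move=> mf fl; apply: (@le_integrable _ _ _ _ _ _ _ (EFin \o thR)) => //.
  - exact/measurable_EFinP.
  - by move=> w _; rewrite /= lee_fin.
have npE t : `|negpart t| <= `|t| :> R.
  rewrite /negpart; case: ifP => _; first by rewrite normrN.
  by rewrite normr0.
have ppE t : `|pospart t| <= `|t| :> R.
  rewrite /pospart; case: ifP => // _; by rewrite normr0.
have iN := bndI _ mnR (fun w => npE (thR w)).
have iP := bndI _ mpR (fun w => ppE (thR w)).
have EN : \int[P x]_w negpart (thR w) = \int[P x]_w pospart (thR w).
  have : \int[P x]_w (pospart (thR w) - negpart (thR w)) = 0.
    suff E : (\int[P x]_w (pospart (thR w) - negpart (thR w))%R%:E = \int[P x]_w (thR w)%:E)%E.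
      by rewrite /Rintegral E mR.
    apply: eq_integral => w _; congr EFin; rewrite /pospart /negpart.
    by case: (ltP (thR w) 0) => h; rewrite ?opprK ?add0r ?subr0.
  by rewrite RintegralB// => /eqP; rewrite subr_eq0 => /eqP ->.
have mPt (t : R) : measurable [set w | t < pospart (thR w)] by exact: measurable_tail_set.
have EPlow : kap <= \int[P x]_w pospart (thR w).
  apply: (@le_trans _ _ (\int[P x]_w (T0 * \1_[set w | T0 < pospart (thR w)] w))).
    rewrite RintegralZl//; last exact: integrable_indic.
    rewrite Rintegral_indic//; apply: ler_wpM2l; first exact: ltW.
    exact: HT.
  apply: le_Rintegral => //.
  - by apply: integrableRZ; exact: integrable_indic.
  - move=> w _; rewrite indicE; case: (boolP (w \in _)) => [/set_mem/= h|_].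
      by rewrite mulr1 ltW.
    by rewrite mulr0 pospart_ge0.
pose S := [set w | dl <= negpart (thR w) <= L].
have mS : measurable S.
  rewrite (_ : S = (fun w => negpart (thR w)) @^-1` `[dl, L]%classic).
    by rewrite -[X in measurable X]setTI; exact: mnR.
  by apply/seteqP; split => w /=; rewrite in_itv.
have mb : measurable_fun setT (fun w => negpart (thR w) `^ b) by measurability.
have ib : (P x).-integrable setT (EFin \o (fun w => negpart (thR w) `^ b)).
  exact: (int_negR mthR HM Dx).
have Eb : \int[P x]_w (negpart (thR w) `^ b) <= M'.
  rewrite /Rintegral; have := HM x Dx; have := integrable_fin_num measurableT ib => /=.
  case: (\int[P x]_w _)%E => [z| |]//= _; rewrite lee_fin => /le_trans; apply.
  by rewrite le_max lexx.
have ENup : \int[P x]_w negpart (thR w) <= dl + L * fine (P x S) + L `^ (1 - b) * M'.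
  apply: (@le_trans _ _ (\int[P x]_w (dl + L * \1_S w + L `^ (1 - b) * (negpart (thR w) `^ b)))).
    have i1 : (P x).-integrable setT (EFin \o (fun w => dl + L * \1_S w)).
      apply: integrableRD; first exact: finite_measure_integrable_cst.
      by apply: integrableRZ; exact: integrable_indic.
    apply: le_Rintegral => //; first by apply: integrableRD => //; exact: integrableRZ.
    move=> w _; rewrite indicE.
    have nn := negpart_ge0 (thR w).
    have pp : 0 <= L `^ (1 - b) * negpart (thR w) `^ b by rewrite mulr_ge0 ?powR_ge0.
    case: (boolP (w \in S)) => [/set_mem/= /andP[h1 h2]|].
      by rewrite mulr1; lra.
    rewrite notin_setE /= => /negP; rewrite negb_and -!ltNge mulr0 addr0 => /orP[h|h].
      lra.
    have : negpart (thR w) <= L `^ (1 - b) * negpart (thR w) `^ b; last by lra.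
    have n0 : 0 < negpart (thR w) by lra.
    rewrite -{1}(powRr1 (ltW n0)) -{1}(subrK b 1) powRD; last by rewrite (gt_eqF n0) implybT.
    rewrite ler_wpM2r ?powR_ge0//.
    rewrite -[1 - b]opprB !powRN lef_pV2 ?posrE ?powR_gt0//.
    by rewrite ge0_ler_powR ?nnegrE ?(ltW h) ?(ltW L0)// subr_ge0.
  have i1 : (P x).-integrable setT (EFin \o (fun w => dl + L * \1_S w)).
    apply: integrableRD; first exact: finite_measure_integrable_cst.
    by apply: integrableRZ; exact: integrable_indic.
  rewrite RintegralD//; last by exact: integrableRZ.
  rewrite RintegralD//; last 2 first.
  - exact: finite_measure_integrable_cst.
  - by apply: integrableRZ; exact: integrable_indic.
  rewrite Rintegral_cst// [X in fine X]probability_setT mulr1.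
  rewrite !RintegralZl//; last exact: integrable_indic.
  rewrite Rintegral_indic// lerD2l//.
  by rewrite ler_wpM2l ?powR_ge0.
have := HL L (lexx L); rewrite mulrC -/dl => HL'.
rewrite ler_pdivrMr//; rewrite EN in ENup; move: ENup HL'.
rewrite -/S [fine _ * L]mulrC; move: (L `^ _ * M') (\int[P x]_w _) (L * fine _) EPlow => u v s.
by rewrite /dl; lra.
Qed.

(** An inward jump between dl and L has a probability bounded below and, from beyond L, does not
    cross the origin; it multiplies e^(-lam r) by at least e^(lam dl), and lam is taken large enough
    for this alone to double the mean. *)
Lemma kernel_contraction : exists lam L : R, [/\ 0 < lam, 2 <= L &
  forall x, states x -> L < nrm x ->
    ((2 * expR (- (lam * nrm x)))%:E <= \int[K x]_z (expR (- (lam * nrm z)))%:E)%E].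
Proof.
have /andP[p0 p1] := pR01.
have [dl [L [p [dl0 L0 pp0 Hp]]]] := inward_jump.
have q0 : 0 < 2 / (pR * p) by rewrite divr_gt0// mulr_gt0.
(* Then pR p e^(lam dl) exceeds 2; the added 1 makes the logarithm positive. *)
pose lam := ln (2 / (pR * p) + 1) / dl.
have lam0 : 0 < lam by rewrite divr_gt0// ln_gt0// ltrDr.
exists lam, (Num.max L 2); split => //; first by rewrite le_max lexx orbT.
move=> x Dx; rewrite gt_max => /andP[Lr _].
have mk : measurable_fun setT (fun t : R => expR (- (lam * t))) by measurability.
rewrite (kernel_radial_profile Dx mk); last by move=> t; exact: expR_ge0.
apply: (@le_trans _ _ (pR%:E * \int[P x]_w (expR (- (lam * `|nrm x + thR w|)))%:E)%E); last first.
  rewrite leeDl// mule_ge0 ?lee_fin ?subr_ge0 ?(ltW p1)//.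
  by apply: integral_ge0 => w _; rewrite lee_fin expR_ge0.
pose S := [set w | dl <= negpart (thR w) <= L].
have mS : measurable S.
  rewrite (_ : S = (fun w => negpart (thR w)) @^-1` `[dl, L]%classic).
    rewrite -[X in measurable X]setTI.
    by apply: (measurableT_comp measurable_negpart mthR).
  by apply/seteqP; split => w /=; rewrite in_itv.
pose c := expR (- (lam * (nrm x - dl))).
have : (c%:E * P x S <= \int[P x]_w (expR (- (lam * `|nrm x + thR w|)))%:E)%E.
  have EI : P x S = (\int[P x]_w (\1_S w)%:E)%E by rewrite integral_indic// setIT.
  have m1 : measurable_fun setT (fun w => (\1_S w : R)%:E).
    by apply/measurable_EFinP; exact: measurable_indic.
  have n1 w : setT w -> (0 <= (\1_S w : R)%:E)%E by rewrite lee_fin indicE.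
  have c0 : (0 <= c%:E)%E by rewrite lee_fin expR_ge0.
  rewrite EI -(ge0_integralZl (P x) measurableT m1 n1 c0).
  apply: ge0_le_integral => //.
  - by move=> w _; rewrite mule_ge0 ?lee_fin ?expR_ge0 ?indicE.
  - by apply: measurable_funeM; apply/measurable_EFinP; exact: measurable_indic.
  - by measurability.
  - move=> w _; rewrite -EFinM lee_fin indicE; case: (boolP (w \in S)) => [|_].
      rewrite inE /S/= /negpart; case: ifP => [t0|_]; last by move=> /andP[]; lra.
      move=> /andP[h1 h2]; rewrite mulr1 ler_expR lerN2 ler_pM2l// ger0_norm; lra.
    by rewrite mulr0 expR_ge0.
have := Hp x Dx; rewrite -/S.
have : P x S \is a fin_num by exact: fin_num_measure.
case: (P x S) => [s| |]//= _ ps H.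
apply: (@le_trans _ _ (pR%:E * (c%:E * s%:E))%E); last first.
  by rewrite lee_wpmul2l// lee_fin ltW.
rewrite -!EFinM lee_fin /c mulrBr opprB expRD mulrC.
have -> : pR * (expR (lam * dl) * expR (- (lam * nrm x)) * s) =
  expR (- (lam * nrm x)) * (expR (lam * dl) * (pR * s)) by ring.
rewrite ler_wpM2l ?expR_ge0//.
have E : expR (lam * dl) = 2 / (pR * p) + 1.
  by rewrite /lam divfK ?gt_eqF// lnK// posrE addr_gt0.
rewrite E mulrDl; apply: (@le_trans _ _ (2 / (pR * p) * (pR * p))).
  by rewrite divfK// gt_eqF// mulr_gt0.
have h : pR * p <= pR * s by rewrite ler_pM2l.
rewrite -[leLHS]addr0; apply: lerD; first by rewrite ler_wpM2l// ltW.
by rewrite mul1r; apply: le_trans h; rewrite mulr_ge0 ?ltW.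
Qed.

Lemma kernel_escape (t : R) : exists2 p : R, 0 < p & forall x, states x ->
  (p%:E <= K x [set z | (t < nrm z)%R])%E.
Proof.
have /andP[p0 p1] := pR01.
have [T0 T00 HT] := outward_jump.
pose t' := Num.max t T0; have t'0 : 0 < t' by rewrite lt_max T00 orbT.
exists (pR * (cR / 2 * t' `^ (- alpha))); first by rewrite !mulr_gt0 ?powR_gt0 ?invr_gt0.
move=> x Dx; have r0 := nrm_ge0 x.
have mt : measurable ([set s : R | t < s]).
  rewrite (_ : [set s : R | t < s] = `]t, +oo[%classic)//.
  by apply/seteqP; split => s /=; rewrite in_itv/= andbT.
have mtn : measurable [set z : R * R | t < nrm z].
  by rewrite -[X in measurable X]setTI; exact: (measurable_nrm measurableT mt).
have mk : measurable_fun setT (\1_[set s : R | t < s] : R -> R) by exact: measurable_indic.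
have : (\int[K x]_z (\1_[set s : R | t < s] (nrm z))%:E = K x [set z | (t < nrm z)%R])%E.
  by rewrite -[in RHS](setIT [set z | (t < nrm z)%R]) -integral_indic.
rewrite (kernel_radial_profile Dx mk); last by move=> s; rewrite indicE.
move=> <-.
apply: (@le_trans _ _ (pR%:E * \int[P x]_w (\1_[set s : R | t < s] `|nrm x + thR w|)%:E)%E); last first.
  rewrite leeDl// mule_ge0 ?lee_fin ?subr_ge0 ?(ltW p1)//.
  by apply: integral_ge0 => w _; rewrite lee_fin indicE.
have mP : measurable [set w | t' < pospart (thR w)].
  apply: measurable_tail_set; exact: (measurableT_comp measurable_pospart mthR).
have : (P x [set w | (t' < pospart (thR w))%R] <=
    \int[P x]_w (\1_[set s : R | (t < s)%R] `|nrm x + thR w|%R)%:E)%E.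
  have -> : P x [set w | t' < pospart (thR w)] =
      (\int[P x]_w (\1_[set w | (t' < pospart (thR w))%R] w)%:E)%E.
    by rewrite integral_indic// setIT.
  apply: ge0_le_integral => //.
  - by apply/measurable_EFinP; exact: measurable_indic.
  - apply/measurable_EFinP; apply: (measurableT_comp mk); measurability.
  - move=> w _; rewrite lee_fin !indicE.
    case: (boolP (w \in _)) => [|_]; last by [].
    rewrite inE /= /pospart => h; rewrite mem_set//=.
    case: ifP h => [th0|_]; last by rewrite ltNge (ltW t'0).
    rewrite gt_max => /andP[h1 h2]; rewrite ger0_norm; lra.
have := HT t' x _ Dx; rewrite le_max lexx orbT => /(_ isT).
have : P x [set w | t' < pospart (thR w)] \is a fin_num by exact: fin_num_measure.
case: (P x _) => [s| |]//= _ ps H.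
apply: (@le_trans _ _ (pR%:E * s%:E)%E); last by rewrite lee_wpmul2l// lee_fin ltW.
by rewrite -EFinM lee_fin ler_pM2l.
Qed.

End Jump.

(** * Recurrence and upper bounds on passage times *)

Section Classification.
Context {R : realType} {d : measure_display} {Omega : measurableType d}.
Variables (X : set (R * R)) (P : R * R -> probability Omega R)
  (xi : nat -> Omega -> R * R) (K : R.-pker (R * R)%type ~> (R * R)%type).
Hypothesis mX : measurable X.
Hypothesis chain : is_markov_chain X P xi K.
Variables (pR cR cT alpha b : R).
Hypotheses (a12 : 1 < alpha < 2) (ab : alpha < b).
Hypothesis drift : forall nu, -1 < nu < 1 -> nu != 0 -> alpha - nu < b ->
  exists Dr, kernel_drift_spec X K pR cR cT alpha nu Dr.
Local Notation lim_drift := (drift_exp alpha (pR * cR) ((1 - pR) * cT)).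
Local Notation above a := [set y : R * R | a < nrm y].
Local Notation occ := (occupation P xi).

Let mn := @measurable_nrm R.

Lemma measurable_above (a : R) : measurable (above a).
Proof. exact: measurable_tail_set mn a. Qed.

Lemma measurable_maxone_nrm nu : measurable_fun setT (fun y : R * R => maxone (nrm y) `^ nu).
Proof. by rewrite /maxone; measurability; exact: mn. Qed.

Lemma above_states (a : R) y : 0 <= a -> X y -> above a y -> states X y.
Proof.
move=> a0 Xy ay; split => // y0; move: ay; rewrite /= y0 /nrm/= expr0n/= addr0 sqrtr0.
by rewrite ltNge a0.
Qed.

Section Recurrence.
Variables (lam L : R).
Hypotheses (lam0 : 0 < lam) (L2 : 2 <= L).
Hypothesis contraction : forall x, states X x -> L < nrm x ->
  ((2 * expR (- (lam * nrm x)))%:E <= \int[K x]_z (expR (- (lam * nrm z)))%:E)%E.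

(* A large multiple of this bounded function compensates for the drift of r^nu where
   r is too small for the asymptotics to apply, so that L does not depend on nu. *)
Let defect (y : R * R) := 1 - expR (- (lam * nrm y)).

Let defect01 y : 0 <= defect y <= 1.
Proof.
rewrite /defect gerBl expR_ge0 andbT subr_ge0 -expR0 ler_expR oppr_le0.
by rewrite mulr_ge0 ?nrm_ge0 ?ltW.
Qed.

Let measurable_defect : measurable_fun setT defect.
Proof. by rewrite /defect; measurability; exact: mn. Qed.

Lemma integral_defect x : states X x -> L < nrm x ->
  (\int[K x]_z (defect z)%:E <= (1 - 2 * expR (- (lam * nrm x)))%:E)%E.
Proof.
move=> Sx Lx; have := contraction Sx Lx.
have me : measurable_fun setT (fun z : R * R => expR (- (lam * nrm z))).
  by measurability; exact: mn.
have e0 z : 0 <= expR (- (lam * nrm z)) by exact: expR_ge0.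
have : (\int[K x]_z (defect z)%:E + \int[K x]_z (expR (- (lam * nrm z)))%:E = 1)%E.
  rewrite -ge0_integralD//.
  - rewrite (_ : (fun z => _) = cst 1%E).
      by rewrite integral_cst// mul1e; exact: prob_kernel.
    by apply/funext => z; rewrite -EFinD /defect subrK.
  - by move=> z _; rewrite lee_fin; have /andP[] := defect01 z.
  - exact/measurable_EFinP.
  - exact/measurable_EFinP.
have : (0 <= \int[K x]_z (defect z)%:E)%E.
  by apply: integral_ge0 => z _; rewrite lee_fin; have /andP[] := defect01 z.
move: (\int[K x]_z (defect z)%:E)%E (\int[K x]_z (expR (- (lam * nrm z)))%:E)%E => [u| |] [v| |]//=.
by rewrite !lee_fin => u0 [uv] h; lra.
Qed.

Lemma lyapunov_drain nu : 0 < nu < 1 -> lim_drift nu < 0 ->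
  exists C c : R, [/\ 0 <= C, 0 < c & forall y, states X y -> L < nrm y ->
    (\int[K y]_z (maxone (nrm z) `^ nu + C * defect z)%:E + (c * nrm y `^ (nu - alpha))%:E <=
     (maxone (nrm y) `^ nu + C * defect y)%:E)%E].
Proof.
move=> /andP[nu0 nu1] F0; have ab' := ab; have /andP[a1 a2] := a12; have L2' := L2.
have n11 : -1 < nu < 1 by lra.
have anb : alpha - nu < b by lra.
have [Dr [DrE [D0 D00 DrD0] Drlim]] := drift n11 (lt0r_neq0 nu0) anb.
have F2 : 0 < - lim_drift nu / 2 by lra.
have [r0 r02 Hr0] := Drlim _ F2.
pose c := nu * (- lim_drift nu / 2); have c0 : 0 < c by rewrite mulr_gt0.
(* Between L and r0 the power may gain nu D0 and the drain costs c, both times r^(nu - alpha) <= 1.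
   The mean of [defect] falls there by at least e^(-lam r0), so C times this fall pays for both. *)
pose C := (nu * D0 + c) / expR (- (lam * r0)).
have h0 : 0 <= nu * D0 + c := addr_ge0 (mulr_ge0 (ltW nu0) D00) (ltW c0).
have C0 : 0 <= C by rewrite divr_ge0 ?expR_ge0.
exists C, c; split => // y Sy Ly.
have y2 : 2 <= nrm y by lra.
have mm := measurable_maxone_nrm nu.
have mV2 : measurable_fun setT (fun z => C * defect z) by exact: measurable_funM.
have d0 z : 0 <= C * defect z by have /andP[h _] := defect01 z; rewrite mulr_ge0.
under eq_integral do rewrite EFinD.
rewrite ge0_integralD//; last 4 first.
- by move=> z _; rewrite lee_fin powR_ge0.
- exact/measurable_EFinP.
- by move=> z _; rewrite lee_fin.
- exact/measurable_EFinP.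
rewrite (DrE _ Sy y2).
have -> : (\int[K y]_z (C * defect z)%:E = C%:E * \int[K y]_z (defect z)%:E)%E.
  under eq_integral do rewrite EFinM.
  rewrite ge0_integralZl//; first exact/measurable_EFinP.
  by move=> z _; rewrite lee_fin; have /andP[] := defect01 z.
have := integral_defect Sy Ly.
have : (0 <= \int[K y]_z (defect z)%:E)%E.
  by apply: integral_ge0 => z _; rewrite lee_fin; have /andP[] := defect01 z.
move: (\int[K y]_z (defect z)%:E)%E => [u| |]//=; rewrite !lee_fin => u0 ule.
rewrite maxone_id; last lra.
have Cu : C * u <= C * (1 - 2 * expR (- (lam * nrm y))) by rewrite ler_wpM2l.
have rpos : 0 < nrm y by lra.
have Ep : nrm y `^ nu * nrm y `^ (- alpha) = nrm y `^ (nu - alpha).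
  by rewrite -powRD// (gt_eqF rpos) implybT.
set w := nrm y `^ (nu - alpha) in Ep *.
have w0 : 0 <= w by exact: powR_ge0.
have w1 : w <= 1 by rewrite /w -(powRr0 (nrm y)) ler_powR//; lra.
suff key : w * (nu * Dr y + c) <= C * expR (- (lam * nrm y)).
  have -> : nrm y `^ nu * (1 + nu * nrm y `^ (- alpha) * Dr y) = nrm y `^ nu + nu * w * Dr y.
    by rewrite -Ep; ring.
  move: Cu key; rewrite /defect; move: (nrm y `^ nu) (expR _) => p e Cu key.
  have -> : C * (1 - e) = C - C * e by ring.
  have : C * (1 - 2 * e) = C - 2 * (C * e) by ring.
  by move: (C * e) (C * (1 - 2 * e)) (C * u) Cu key => Ce z1 z2; nra.
have e0 : 0 < expR (- (lam * nrm y)) by exact: expR_gt0.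
have [ry|ry] := leP r0 (nrm y).
  have : Dr y <= lim_drift nu / 2.
    have := Hr0 y Sy ry; rewrite ler_norml => /andP[_]; lra.
  move=> h; apply: (@le_trans _ _ 0); last by rewrite mulr_ge0// ltW.
  rewrite mulr_ge0_le0// /c.
  have : nu * Dr y <= nu * (lim_drift nu / 2) by rewrite ler_pM2l.
  move: (nu * Dr y) => z h2; lra.
apply: (@le_trans _ _ (1 * (nu * D0 + c))).
  have hD : nu * Dr y + c <= nu * D0 + c by rewrite lerD2r ler_pM2l// DrD0.
  apply: (@le_trans _ _ (w * (nu * D0 + c))); first by rewrite ler_wpM2l.
  by rewrite ler_wpM2r.
rewrite mul1r /C mulrAC ler_pdivlMr ?expR_gt0//.
rewrite ler_wpM2l// ler_expR lerN2 ler_pM2l//; exact: ltW.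
Qed.

(** Passage times use it with m = 0; recurrence needs a free period before time m, and the explicit
    bound on V to estimate the mean at that time. *)
Lemma hist_power_decay nu : 0 < nu < 1 -> lim_drift nu < 0 ->
  exists (V : R * R -> R) (C C' : R), [/\ measurable_fun setT V,
    forall y, 0 <= V y <= maxone (nrm y) `^ nu + C', 0 <= C &
    forall a x A m n, L <= a -> X x -> (forall i, measurable (A i)) ->
      (forall i, (m <= i)%N -> A i `<=` above a) -> (0 < n)%N ->
      (P x (hist xi A (m + n)) <= (C * n%:R `^ (- (nu / alpha)))%:E * occ x A m (EFin \o V))%E].
Proof.
move=> nu01 F0; have [C [c [C0 c0 HV]]] := lyapunov_drain nu01 F0.
have /andP[nu0 nu1] := nu01; have /andP[a1 a2] := a12; have L2' := L2.
pose V y := maxone (nrm y) `^ nu + C * defect y.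
pose w y := c * (nrm y `^ (nu - alpha)).
have mV : measurable_fun setT V.
  by apply: measurable_funD; [exact: measurable_maxone_nrm | exact: measurable_funM].
have mw : measurable_fun setT w by rewrite /w; measurability; exact: mn.
have V0 y : 0 <= V y.
  by have /andP[h _] := defect01 y; rewrite addr_ge0 ?powR_ge0// mulr_ge0.
have w0 y : 0 <= w y by rewrite mulr_ge0 ?powR_ge0// ltW.
exists V, (c^-1 + 1), C; split => //.
- move=> y; rewrite V0/= lerD2l; have /andP[_ h] := defect01 y.
  by rewrite -[leRHS]mulr1 ler_wpM2l.
- by rewrite addr_ge0// invr_ge0 ltW.
move=> a x A m n La Xx mA Aa n0.
have np : 0 < n%:R :> R by rewrite ltr0n.
(* V <= h forces r <= n^(1/alpha), where the drain is at least c n^(nu/alpha - 1). With this level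
   both terms of [hist_decay] are of order n^(1 - nu/alpha). *)
pose h : R := n%:R `^ (nu / alpha); have h0 : 0 < h by rewrite powR_gt0.
pose cw : R := c * n%:R `^ (nu / alpha - 1).
have cw0 : 0 < cw by rewrite mulr_gt0// powR_gt0.
have drain i y : (m <= i)%N -> X y -> A i y ->
    (\int[K y]_(z in A i.+1) (V z)%:E + (w y)%:E <= (V y)%:E)%E.
  move=> mi Xy Ay; have ay := Aa i mi y Ay.
  have Ly : L < nrm y by exact: le_lt_trans La ay.
  have Sy : states X y by apply: (above_states _ Xy ay); lra.
  apply: le_trans (HV y Sy Ly); apply: leeD => //.
  apply: ge0_subset_integral => //; first exact/measurable_EFinP.
  by move=> z _; rewrite lee_fin.
have cwP i y : (m <= i)%N -> X y -> A i y -> V y <= h -> cw <= w y.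
  move=> mi Xy Ay Vh; have ay := Aa i mi y Ay.
  have Ly : 2 < nrm y by apply: le_lt_trans ay; lra.
  have y0 : 0 < nrm y by lra.
  rewrite /cw /w ler_pM2l//.
  have yn : nrm y <= n%:R `^ alpha^-1.
    have /andP[d0 _] := defect01 y.
    have : nrm y `^ nu <= h.
      apply: le_trans Vh; rewrite /V maxone_id ?lerDl ?mulr_ge0//; lra.
    rewrite /h mulrC powRrM => hh.
    rewrite leNgt; apply/negP => /(gt0_ltr_powR nu0); rewrite !nnegrE powR_ge0 nrm_ge0.
    by move=> /(_ isT isT); rewrite ltNge hh.
  have -> : nu / alpha - 1 = alpha^-1 * (nu - alpha).
    by field; rewrite gt_eqF//; lra.
  rewrite powRrM; apply: gtr0_ler_powRN => //; lra.
have := hist_decay mX chain Xx mA mV mw V0 w0 drain n h0 cw0 cwP.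
have : P x (hist xi A (m + n)) \is a fin_num.
  by apply: fin_num_measure; exact: (measurable_hist chain).
have : (0 <= occ x A m (EFin \o V))%E by apply: occupation_ge0 => y; rewrite lee_fin.
case: (P x _) => [p| |]//; case: (occ x A m _) => [v| |]//=; last first.
  by move=> _ _ _; rewrite gt0_muley ?leey// lte_fin mulr_gt0 ?powR_gt0// addr_gt0// invr_gt0.
rewrite lee_fin => v0 _; rewrite -!EFinM !lee_fin => H.
have -> : (c^-1 + 1) * n%:R `^ (- (nu / alpha)) * v = (cw^-1 + n%:R / h) * v / n%:R.
  rewrite /cw /h powRN powRD; last by rewrite (gt_eqF np) implybT.
  rewrite powRN powRr1 ?(ltW np)//; field.
  by rewrite !gt_eqF// powR_gt0.
by rewrite ler_pdivlMr// mulrC.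
Qed.

Lemma tau_moment_finite nu q a x : 0 < nu < 1 -> lim_drift nu < 0 -> 0 < q -> q < nu / alpha ->
  L <= a -> X x -> a < nrm x -> (\int[P x]_w poweR (tau xi a w) q < +oo)%E.
Proof.
move=> nu01 F0 q0 qnu La Xx ax.
have [V [C [C' [mV V0 C0 H]]]] := hist_power_decay nu01 F0.
have V0' y : 0 <= V y by have /andP[] := V0 y.
have mV' : measurable_fun setT (EFin \o V) by exact/measurable_EFinP.
have mA (i : nat) : measurable (above a) by exact: measurable_above.
apply: (tau_moment_lty (measurable_xi chain) (s := nu / alpha) (C := C * V x)) => //.
  by rewrite mulr_ge0.
have V0e y : (0 <= (EFin \o V) y)%E by rewrite lee_fin.
move=> n n0; have := H a x (fun=> above a) 0%N n La Xx mA (fun i _ => @subset_refl _ _) n0.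
rewrite add0n (occupation0 chain Xx mA mV' V0e ax)/=.
by rewrite -EFinM mulrAC.
Qed.

Lemma chain_recurrent nu : 0 < nu < 1 -> lim_drift nu < 0 -> recurrent X P xi.
Proof.
move=> nu01 F0; exists L => x Xx; apply: limn_einf_le_ae => m.
have [V [C [C' [mV V0 C0 H]]]] := hist_power_decay nu01 F0.
have V0' y : 0 <= V y by have /andP[] := V0 y.
have /andP[nu0 nu1] := nu01; have /andP[a1 a2] := a12.
(* A path that stays above L from time m on is below some N at time m. The truncation at N bounds V
   there; V at time m need not be integrable, since the jump from the origin is unrestricted. *)
pose A (N i : nat) : set (R * R) := if (i < m)%N then setT else
  if i == m then above L `&` [set y | nrm y <= N%:R] else above L.
have mle (N : nat) : measurable [set y : R * R | nrm y <= N%:R].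
  rewrite (_ : [set y : R * R | nrm y <= N%:R] = ~` above N%:R).
    by apply: measurableC; exact: measurable_above.
  by apply/seteqP; split => y /=; rewrite leNgt => /negP.
have mA N i : measurable (A N i).
  rewrite /A; case: ifP => // _; case: ifP => _; last exact: measurable_above.
  by apply: measurableI; [exact: measurable_above | exact: mle].
have mh N n : measurable (hist xi (A N) n) by exact: (measurable_hist chain).
have Aabove N i : (m <= i)%N -> A N i `<=` above L.
  by rewrite /A ltnNge => -> /=; case: ifP => // _ y [].
pose G N := \bigcap_n hist xi (A N) (m + n).
have mG N : measurable (G N) by exact: bigcapT_measurable.
have G0 N : P x (G N) = 0%E.
  apply/eqP; rewrite eq_le measure_ge0 andbT; apply/lee_addgt0Pr => e e0; rewrite add0e.
  pose v := maxone N%:R `^ nu + C'.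
  have v0 : 0 <= v.
    have /andP[h1 h2] := V0 (N%:R, 0); apply: le_trans h1 _; apply: le_trans h2 _.
    rewrite lerD2r ge0_ler_powR ?nnegrE ?(ltW (maxone_gt0 _)) ?(ltW nu0)//.
    by rewrite /nrm/= expr0n/= addr0 sqrtr_sqr ger0_norm.
  have nup : - (nu / alpha) < 0 by rewrite oppr_lt0 divr_gt0//; lra.
  have [r0 r02 Hr] := power_cvg0 (C * v) nup e0.
  pose n := (Num.truncn r0).+1.
  have rn : r0 <= n%:R by rewrite ltW// truncnS_gt.
  apply: (@le_trans _ _ (P x (hist xi (A N) (m + n)))).
    by apply: le_measure; rewrite ?inE//; exact: bigcap_inf.
  apply: le_trans (H L x (A N) m n (lexx _) Xx (mA N) (Aabove N) (ltn0Sn _)) _.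
  apply: (@le_trans _ _ ((C * n%:R `^ (- (nu / alpha)))%:E * v%:E)%E); last first.
    by rewrite -EFinM lee_fin mulrAC; exact: Hr.
  rewrite lee_wpmul2l ?lee_fin ?mulr_ge0 ?powR_ge0//.
  apply: (@le_trans _ _ (occ x (A N) m (fun=> v%:E))).
    apply: (le_occupation chain) => //.
    - exact/measurable_EFinP.
    - move=> y Xy; rewrite /A ltnn eqxx => -[_ /= yN]; rewrite lee_fin.
      have /andP[_ h] := V0 y; apply: le_trans h _; rewrite lerD2r.
      rewrite ge0_ler_powR ?nnegrE ?(ltW (maxone_gt0 _)) ?(ltW nu0)//.
      by rewrite /maxone ge_max !le_max yN lexx orbT.
  rewrite /occupation integral_cst// -[leRHS]mule1 lee_wpmul2l ?lee_fin//.
  exact: probability_le1.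
have mUG : measurable (\bigcup_N G N) by exact: bigcupT_measurable.
exists (\bigcup_N G N); split => //.
  apply/(negligibleP _ mUG); apply: negligible_bigcup => N.
  by exists (G N); split => //; exact: G0.
move=> w /= Hw; have above_w i : (m <= i)%N -> L < nrm (xi i w).
  by move=> mi; rewrite ltNge; apply/negP => h; apply: Hw; exists i.
exists (Num.truncn (nrm (xi m w))).+1 => // n _ i _; rewrite /A.
case: ltnP => // mi; case: eqP => [->|_]; last exact: above_w.
by split; [exact: above_w | rewrite /= ltW// truncnS_gt].
Qed.

End Recurrence.
End Classification.

(** * Lower bounds on passage times *)

Lemma powR_small {R : realType} (dl e : R) : 0 < dl -> 0 < e ->
  exists2 u0 : R, 0 < u0 <= 1 & forall u, 0 <= u -> u <= u0 -> u `^ dl <= e.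
Proof.
move=> dl0 e0; exists (Num.min 1 (e `^ dl^-1)).
  by rewrite lt_min ltr01 powR_gt0// ge_min lexx.
move=> u u0; rewrite le_min => /andP[_ ue].
have : u `^ dl <= (e `^ dl^-1) `^ dl by rewrite ge0_ler_powR ?nnegrE ?powR_ge0 ?(ltW dl0).
by rewrite -powRrM mulVf ?gt_eqF// powRr1// ltW.
Qed.

Lemma powR_div {R : realType} (x H p : R) : 0 <= x -> 0 < H ->
  (x / H) `^ p = x `^ p * H `^ (- p).
Proof.
by move=> x0 H0; rewrite powRM ?invr_ge0 ?(ltW H0)// -powR_inv1 ?(ltW H0)// -powRrM mulN1r.
Qed.

Section SaturatedProfile.
Context {R : realType}.
Variables (nu nu' : R).
Hypotheses (nu0 : 0 < nu) (nunu' : nu < nu') (nu'1 : nu' < 1).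
Implicit Types u v : R.

(* power_gap is maximal at u = 1, so freezing it there gives a bounded nondecreasing
   function that is still above power_gap everywhere. *)
Definition power_gap u := u `^ nu / nu - u `^ nu' / nu'.
Definition saturated u := power_gap (Num.min u 1).

Let nu'0 : 0 < nu' := lt_trans nu0 nunu'.

Lemma power_gap1 : power_gap 1 = nu^-1 - nu'^-1.
Proof. by rewrite /power_gap !powR1 !mul1r. Qed.

Lemma power_gap_boxcox u : power_gap u = power_gap 1 + (boxcox nu u - boxcox nu' u).
Proof.
rewrite power_gap1 /power_gap /boxcox; field.
by rewrite !gt_eqF.
Qed.

Lemma power_gap_le1 u : 0 < u -> power_gap u <= power_gap 1.
Proof.
move=> u0; rewrite power_gap_boxcox gerDl subr_le0.
by apply: boxcox_ler => //; exact: ltW.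
Qed.

(** With t = u / v the difference is v^nu' boxcox nu' t - v^nu boxcox nu t. Both Box-Cox values are
    nonpositive and increase with the exponent, while v^nu' <= v^nu. *)
Lemma power_gap_mono u v : 0 < u -> u <= v -> v <= 1 -> power_gap u <= power_gap v.
Proof.
move=> u0 uv v1; have v0 := lt_le_trans u0 uv.
have t0 : 0 < u / v by rewrite divr_gt0.
have t1 : u / v <= 1 by rewrite ler_pdivrMr// mul1r.
have E : power_gap v - power_gap u =
    v `^ nu' * boxcox nu' (u / v) - v `^ nu * boxcox nu (u / v).
  have Ep p : u `^ p = (u / v) `^ p * v `^ p.
    by rewrite -powRM ?(ltW t0) ?(ltW v0)// divfK// gt_eqF.
  rewrite /power_gap /boxcox !Ep.
  move: (v `^ nu) (v `^ nu') ((u / v) `^ nu) ((u / v) `^ nu') => a b c e.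
  by field; rewrite !gt_eqF.
rewrite -subr_ge0 E.
have b0 p : 0 < p -> boxcox p (u / v) <= 0.
  move=> p0; rewrite /boxcox mulr_le0_ge0 ?invr_ge0 ?(ltW p0)// subr_le0.
  have E1 : (1 : R) `^ p = 1 by rewrite powR1.
  by rewrite -[leRHS]E1 ge0_ler_powR ?nnegrE ?(ltW p0) ?(ltW t0).
have h1 : boxcox nu (u / v) <= boxcox nu' (u / v).
  by apply: boxcox_ler => //; exact: ltW.
have h2 : v `^ nu' <= v `^ nu by rewrite ger_powR ?v0// ltW.
have h3 := b0 _ nu'0; have h4 : 0 <= v `^ nu' by exact: powR_ge0.
rewrite subr_ge0; apply: (@le_trans _ _ (v `^ nu * boxcox nu' (u / v))).
  by rewrite ler_wpM2l// powR_ge0.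
by rewrite ler_wnM2r.
Qed.

Lemma power_gap_pos u : 0 < u -> u <= 1 -> 0 < power_gap u.
Proof.
move=> u0 u1; rewrite /power_gap subr_gt0.
have h2 : u `^ nu' <= u `^ nu by rewrite ger_powR ?u0// ltW.
apply: (@le_lt_trans _ _ (u `^ nu / nu')); first by rewrite ler_pM2r// invr_gt0.
by rewrite ltr_pM2l ?powR_gt0// ltf_pV2.
Qed.

Lemma saturated_ge u : 0 < u -> power_gap u <= saturated u.
Proof.
move=> u0; rewrite /saturated; case: (leP u 1) => //= _; exact: power_gap_le1.
Qed.

Lemma saturated_mono u v : 0 < u -> u <= v -> saturated u <= saturated v.
Proof.
move=> u0 uv; apply: power_gap_mono.
- by rewrite lt_min u0 ltr01.
- by rewrite le_min !ge_min uv lexx orbT.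
- by rewrite ge_min lexx orbT.
Qed.

Lemma saturated_le1 u : 0 < u -> saturated u <= power_gap 1.
Proof. by move=> u0; apply: power_gap_le1; rewrite lt_min u0 ltr01. Qed.

Lemma saturated_le u : 0 < u -> saturated u <= u `^ nu / nu.
Proof.
move=> u0; apply: (@le_trans _ _ ((Num.min u 1) `^ nu / nu)).
  by rewrite /saturated /power_gap gerBl mulr_ge0 ?powR_ge0// invr_ge0 ltW.
rewrite ler_pM2r ?invr_gt0// ge0_ler_powR ?nnegrE ?le_min ?ler01 ?andbT ?(ltW nu0) ?(ltW u0)//.
by rewrite ge_min lexx.
Qed.

Lemma power_gap_small : exists2 u0 : R, 0 < u0 <= 1 & forall u, 0 < u -> u <= u0 ->
  u `^ nu / (2 * nu) <= power_gap u.
Proof.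
have dl0 : 0 < nu' - nu by rewrite subr_gt0.
have e0 : 0 < nu' / (2 * nu) by rewrite divr_gt0// mulr_gt0.
have [u0 u01 H] := powR_small dl0 e0; exists u0 => // u up uu0.
have := H u (ltW up) uu0; rewrite /power_gap.
have -> : u `^ nu' = u `^ nu * u `^ (nu' - nu).
  by rewrite -powRD ?subrKC// (gt_eqF up) implybT.
have := powR_gt0 nu up; move: (u `^ nu) (u `^ (nu' - nu)) => p t p0.
rewrite ler_pdivlMr ?mulr_gt0// => h.
rewrite -mulrA -mulrBr ler_pM2l// invfM -subr_ge0.
have -> : nu^-1 - t / nu' - 2^-1 * nu^-1 = (nu' - t * (2 * nu)) / (2 * nu * nu').
  by field; rewrite !gt_eqF.
by rewrite divr_ge0 ?subr_ge0// !mulr_ge0// ltW.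
Qed.

End SaturatedProfile.

Section InfiniteMoments.
Context {R : realType} {d : measure_display} {Omega : measurableType d}.
Variables (X : set (R * R)) (P : R * R -> probability Omega R)
  (xi : nat -> Omega -> R * R) (K : R.-pker (R * R)%type ~> (R * R)%type).
Hypothesis mX : measurable X.
Hypothesis chain : is_markov_chain X P xi K.
Variables (pR cR cT alpha b : R).
Hypotheses (a12 : 1 < alpha < 2) (ab : alpha < b).
Hypothesis drift : forall nu, -1 < nu < 1 -> nu != 0 -> alpha - nu < b ->
  exists Dr, kernel_drift_spec X K pR cR cT alpha nu Dr.
Hypothesis escape : forall t : R, exists2 p : R, 0 < p & forall x, states X x ->
  (p%:E <= K x [set z | (t < nrm z)%R])%E.
Local Notation lim_drift := (drift_exp alpha (pR * cR) ((1 - pR) * cT)).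
Local Notation above a := [set y : R * R | a < nrm y].
Local Notation occ := (occupation P xi).
Let mn := @measurable_nrm R.

Section Profile.
Variables (nu nu' : R).
Hypotheses (nu0 : 0 < nu) (nunu' : nu < nu') (nu'1 : nu' < 1) (F0 : 0 < lim_drift nu).
Let nu'0 : 0 < nu' := lt_trans nu0 nunu'.
Local Notation S := (saturated nu nu').
Local Notation C0 := (power_gap nu nu' 1).
Local Notation m z := (maxone (nrm z)).

Lemma measurable_saturated H : measurable_fun setT (fun z : R * R => S (m z / H)).
Proof. by rewrite /saturated /power_gap /maxone; measurability; exact: mn. Qed.

(** The saturated profile dominates [power_gap], whose mean is known exactly. Only nu needs a
    positive limit drift: the power nu' is subtracted, so an upper bound on its drift suffices. The
    constants do not depend on the scale H. *)
Lemma saturated_kernel : exists (r0 dd D' : R), [/\ 2 <= r0, 0 < dd, 0 <= D' &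
  forall H y, 0 < H -> states X y -> r0 <= nrm y ->
   ((power_gap nu nu' (nrm y / H) +
     nrm y `^ (- alpha) * (dd * (nrm y / H) `^ nu - D' * (nrm y / H) `^ nu'))%:E <=
    \int[K y]_z (S (m z / H))%:E)%E].
Proof.
have ab' := ab; have /andP[a1 a2] := a12; have h0 := nu0; have h1 := nunu'; have h2 := nu'1.
have n11 : -1 < nu < 1 by lra.
have n11' : -1 < nu' < 1 by lra.
have anb : alpha - nu < b by lra.
have anb' : alpha - nu' < b by lra.
have [D1 [E1 _ L1]] := drift n11 (lt0r_neq0 nu0) anb.
have [D2 [E2 [D' D'0 HD'] _]] := drift n11' (lt0r_neq0 nu'0) anb'.
have F2 : 0 < lim_drift nu / 2 by rewrite divr_gt0.
have [r0 r02 Hr] := L1 _ F2.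
exists r0, (lim_drift nu / 2), D'; split => // H y H0 Sy ry.
have y2 : 2 <= nrm y by exact: le_trans ry.
have yp : 0 < nrm y by lra.
have mS := measurable_saturated H.
have mp p : measurable_fun setT (fun z : R * R => m z `^ p) by exact: measurable_maxone_nrm.
have S0 z : 0 <= S (m z / H).
  rewrite /saturated ltW// power_gap_pos// ?lt_min ?ltr01 ?divr_gt0 ?maxone_gt0//.
  by rewrite ge_min lexx orbT.
have pw z : m z `^ nu * (H `^ (- nu) / nu) <= S (m z / H) + m z `^ nu' * (H `^ (- nu') / nu').
  have zH : 0 < m z / H by rewrite divr_gt0// maxone_gt0.
  have := saturated_ge nu0 nunu' zH; rewrite /power_gap.
  rewrite !(powR_div _ (ltW (maxone_gt0 _)) H0).
  by rewrite lerBlDr !mulrA.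
have E p k : 0 <= k -> (\int[K y]_z (m z `^ p * k)%:E = k%:E * \int[K y]_z (m z `^ p)%:E)%E.
  move=> k0; under eq_integral do rewrite EFinM muleC.
  rewrite ge0_integralZl//; first exact/measurable_EFinP.
  by move=> z _; rewrite lee_fin powR_ge0.
have k1 : 0 <= H `^ (- nu) / nu by rewrite divr_ge0 ?powR_ge0 ?ltW.
have k2 : 0 <= H `^ (- nu') / nu' by rewrite divr_ge0 ?powR_ge0// ltW.
have : (\int[K y]_z (m z `^ nu * (H `^ (- nu) / nu))%:E <=
    \int[K y]_z (S (m z / H))%:E + \int[K y]_z (m z `^ nu' * (H `^ (- nu') / nu'))%:E)%E.
  rewrite -ge0_integralD//.
  - apply: ge0_le_integral => //.
    + by move=> z _; rewrite lee_fin mulr_ge0// powR_ge0.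
    + by apply/measurable_EFinP; apply: measurable_funM.
    + by apply/measurable_EFinP; apply: measurable_funD => //; apply: measurable_funM.
    + by move=> z _; rewrite lee_fin.
  - by move=> z _; rewrite lee_fin.
  - exact/measurable_EFinP.
  - by move=> z _; rewrite lee_fin mulr_ge0// powR_ge0.
  - by apply/measurable_EFinP; apply: measurable_funM.
rewrite !E// (E1 _ Sy y2) (E2 _ Sy y2).
have : (0 <= \int[K y]_z (S (m z / H))%:E)%E by apply: integral_ge0 => z _; rewrite lee_fin.
move: (\int[K y]_z (S (m z / H))%:E)%E => [v| |]//; last by move=> _ _; exact: leey.
rewrite -!EFinM -EFinD !lee_fin => _.
have pH p : (nrm y / H) `^ p = nrm y `^ p * H `^ (- p).
  by rewrite powR_div// ltW.
rewrite /power_gap !pH.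
have := HD' y Sy y2; have : lim_drift nu / 2 <= D1 y.
  have := Hr y Sy ry; rewrite ler_norml => /andP[h _]; lra.
have := powR_ge0 (nrm y) (- alpha); have := powR_ge0 (nrm y) nu; have := powR_ge0 (nrm y) nu'.
have := powR_ge0 H (- nu); have := powR_ge0 H (- nu').
move: (D1 y) (D2 y) (lim_drift nu / 2) (nrm y `^ _) (nrm y `^ _) (nrm y `^ _) (H `^ _) (H `^ _).
move=> d1 d2 dd ra rn rn' hn hn' hn'0 hn0 rn'0 rn0 ra0 dd1 d2D Hv.
have A1 : ra * (rn * hn) * dd <= ra * (rn * hn) * d1 by rewrite ler_wpM2l// !mulr_ge0.
have A2 : ra * (rn' * hn') * d2 <= ra * (rn' * hn') * D' by rewrite ler_wpM2l// !mulr_ge0.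
have X1 : hn / nu * (rn * (1 + nu * ra * d1)) = rn * hn / nu + ra * (rn * hn) * d1.
  by field; rewrite gt_eqF.
have X2 : hn' / nu' * (rn' * (1 + nu' * ra * d2)) = rn' * hn' / nu' + ra * (rn' * hn') * d2.
  by field; rewrite gt_eqF.
rewrite X1 X2 in Hv.
have -> : ra * (dd * (rn * hn) - D' * (rn' * hn')) = ra * (rn * hn) * dd - ra * (rn' * hn') * D'.
  by ring.
move: Hv A1 A2; move: (_ * d1) (_ * d2) (_ * D') (_ * dd) (_ / nu) (_ / nu') => *; lra.
Qed.

(* theta is the value that makes the hump vanish in a ball (see [hump_eq0]), and H is
   of order n^(1/alpha). *)
Definition hump theta H (y : R * R) := Num.max (S (m y / H) - theta) 0.

Lemma hump_ge0 theta H y : 0 <= hump theta H y.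
Proof. by rewrite /hump le_max lexx orbT. Qed.

Lemma measurable_hump theta H : measurable_fun setT (hump theta H).
Proof.
apply: measurable_maxr => //; apply: measurable_funB => //.
exact: measurable_saturated.
Qed.

Lemma hump_le theta H y : 0 <= theta -> 0 < H -> hump theta H y <= C0.
Proof.
move=> t0 H0; rewrite /hump ge_max; apply/andP; split.
  rewrite lerBlDr; apply: (@le_trans _ _ C0); last by rewrite lerDl.
  by apply: saturated_le1 => //; rewrite divr_gt0// maxone_gt0.
by rewrite ltW// power_gap_pos.
Qed.

Lemma hump_eq0 a H y : 1 <= a -> 0 < H -> nrm y <= a -> hump ((a / H) `^ nu / nu) H y = 0.
Proof.
move=> a1 H0 ya; apply/eqP; rewrite eq_le hump_ge0 andbT /hump ge_max lexx andbT subr_le0.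
have zH : 0 < m y / H by rewrite divr_gt0// maxone_gt0.
apply: le_trans (saturated_le nu0 nunu' zH) _.
rewrite ler_pM2r ?invr_gt0// ge0_ler_powR ?nnegrE ?(ltW nu0) ?(ltW zH)//.
  by rewrite divr_ge0 ?(ltW H0)//; lra.
by rewrite ler_pM2r ?invr_gt0// /maxone ge_max ya.
Qed.

Lemma hump_kernel : exists r0 M sg : R, [/\ 2 <= r0, 0 < M, 0 < sg &
  forall theta n H y, 0 <= theta <= sg -> (0 < n)%N -> 0 < H -> H `^ alpha = M * n%:R ->
    states X y -> r0 <= nrm y ->
    (((1 - (2 * n%:R)^-1) * hump theta H y)%:E <= \int[K y]_z (hump theta H z)%:E)%E].
Proof.
have [r0 [dd [D' [r02 dd0 D'0 HK]]]] := saturated_kernel.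
have dl0 : 0 < nu' - nu by rewrite subr_gt0.
have D1 : 0 < D' + 1 by rewrite ltr_wpDl.
have [u1 /andP[u10 u11] Hu1] := powR_small dl0 (divr_gt0 dd0 D1).
have /andP[a1 a2] := a12.
have S1 : 0 < power_gap nu nu' u1 by exact: power_gap_pos.
pose sg := power_gap nu nu' u1 / 2; have sg0 : 0 < sg by rewrite divr_gt0.
(* M makes the loss D' (u1 H)^(-alpha) at most sg / (2 n). *)
pose M := 2 * D' * u1 `^ (- alpha) / sg + 1.
have M0 : 0 < M by rewrite ltr_wpDl// divr_ge0 ?(ltW sg0)// !mulr_ge0 ?powR_ge0.
exists r0, M, sg; split => // theta n H y /andP[t0 tsg] n0 H0 HM Sy ry.
have yp : 0 < nrm y by lra.
have np : 0 < n%:R :> R by rewrite ltr0n.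
have e01 : 0 <= (2 * n%:R : R)^-1 <= 1.
  rewrite invr_ge0 mulr_ge0//= invf_le1 ?mulr_gt0// -[leLHS]mulr1 ler_pM// ?ler1n//; lra.
have [S0|S0] := leP (S (m y / H) - theta) 0.
  rewrite {1}/hump max_r// mulr0; apply: integral_ge0 => z _.
  by rewrite lee_fin hump_ge0.
rewrite {1}/hump max_l ?(ltW S0)//.
have mE : m y = nrm y by rewrite maxone_id//; lra.
rewrite mE in S0 *; set u := nrm y / H in S0 *.
have u0 : 0 < u by rewrite divr_gt0.
have Kh : (\int[K y]_z (S (m z / H))%:E <= \int[K y]_z (hump theta H z)%:E + theta%:E)%E.
  have -> : (theta%:E = \int[K y]_z (cst theta%:E z))%E.
    by rewrite integral_cst// [X in (_ * X)%E]prob_kernel mule1.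
  rewrite -ge0_integralD//; last 2 first.
  - by move=> z _; rewrite lee_fin hump_ge0.
  - by apply/measurable_EFinP; exact: measurable_hump.
  apply: ge0_le_integral => //.
  - move=> z _; rewrite lee_fin /saturated ltW// power_gap_pos//.
      by rewrite lt_min ltr01 divr_gt0 ?maxone_gt0.
    by rewrite ge_min lexx orbT.
  - by apply/measurable_EFinP; exact: measurable_saturated.
  - apply: emeasurable_funD => //; apply/measurable_EFinP; exact: measurable_hump.
  - by move=> z _; rewrite -EFinD lee_fin -lerBlDr /hump le_max lexx.
suff : ((S u - (2 * n%:R)^-1 * (S u - theta))%:E <= \int[K y]_z (S (m z / H))%:E)%E.
  move=> /le_trans/(_ Kh); move: (\int[K y]_z (hump theta H z)%:E)%E => [v| |]//.
    by rewrite -EFinD !lee_fin; lra.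
  by move=> _; exact: leey.
have sub0 : 0 <= (2 * n%:R)^-1 * (S u - theta) by rewrite mulr_ge0 ?(ltW S0)//; case/andP: e01.
have gain v : 0 < v -> v <= u1 -> 0 <= dd * v `^ nu - D' * v `^ nu'.
  move=> v0 vu1; have := Hu1 v (ltW v0) vu1; rewrite ler_pdivlMr// => h.
  have -> : v `^ nu' = v `^ nu * v `^ (nu' - nu).
    by rewrite -powRD ?subrKC// (gt_eqF v0) implybT.
  have := powR_ge0 v nu; have := powR_ge0 v (nu' - nu); nra.
have [uu1|uu1] := leP u u1.
  apply: le_trans (HK H y H0 Sy ry); rewrite lee_fin -/u.
  have Su : S u = power_gap nu nu' u by rewrite /saturated min_l// (le_trans uu1).
  rewrite Su in sub0 *; apply: (@le_trans _ _ (power_gap nu nu' u)); first by rewrite gerBl.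
  by rewrite lerDl mulr_ge0 ?powR_ge0// gain.
have loss : D' * (u1 * H) `^ (- alpha) <= (2 * n%:R)^-1 * (S u - theta).
  have Su : power_gap nu nu' u1 <= S u.
    have -> : power_gap nu nu' u1 = S u1 by rewrite /saturated min_l.
    by apply: saturated_mono => //; exact: ltW.
  apply: (@le_trans _ _ ((2 * n%:R)^-1 * sg)); last first.
    by rewrite ler_wpM2l ?invr_ge0 ?mulr_ge0//; move: tsg Su; rewrite /sg; lra.
  have hM : 2 * D' * u1 `^ (- alpha) <= M * sg.
    have sgn : sg != 0 by rewrite gt_eqF.
    by rewrite /M [leRHS]mulrDl (divfK sgn) mul1r lerDl ltW.
  rewrite powRM ?(ltW u10) ?(ltW H0)// [H `^ _]powRN HM.
  have -> : D' * (u1 `^ (- alpha) * (M * n%:R)^-1) =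
      2 * D' * u1 `^ (- alpha) * (2 * n%:R * M)^-1.
    by field; rewrite !gt_eqF.
  have -> : (2 * n%:R)^-1 * sg = M * sg * (2 * n%:R * M)^-1.
    by field; rewrite !gt_eqF.
  by rewrite ler_pM2r// invr_gt0 !mulr_gt0.
have rw : nrm y `^ (- alpha) <= (u1 * H) `^ (- alpha).
  apply: gtr0_ler_powRN; [by rewrite oppr_le0; lra | by rewrite mulr_gt0 |].
  by move: uu1; rewrite /u ltr_pdivlMr// => /ltW.
have nrm0 : 0 <= nrm y `^ (- alpha) by exact: powR_ge0.
have [u_1|u_1] := leP u 1.
  apply: le_trans (HK H y H0 Sy ry); rewrite lee_fin -/u.
  have -> : S u = power_gap nu nu' u by rewrite /saturated min_l.
  rewrite lerD2l; apply: le_trans (_ : - (D' * (u1 * H) `^ (- alpha)) <= _).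
    by rewrite lerN2; move: loss; rewrite /saturated min_l.
  rewrite mulrBr -[leLHS]add0r; apply: lerD.
    by rewrite !mulr_ge0 ?powR_ge0// ltW.
  rewrite lerN2 mulrCA ler_wpM2l//.
  rewrite -[leRHS]mulr1; apply: ler_pM => //; first exact: powR_ge0.
  have E1 : (1 : R) `^ nu' = 1 by rewrite powR1.
  by rewrite -[leRHS]E1 ge0_ler_powR ?nnegrE ?(ltW nu'0) ?(ltW u0).
(* Beyond saturation [power_gap] at u would lie below the saturated value. Replacing H by r lowers
   the profile but moves the ratio to 1, where [power_gap] takes its maximum C0. *)
have mono : (\int[K y]_z (S (m z / nrm y))%:E <= \int[K y]_z (S (m z / H))%:E)%E.
  apply: ge0_le_integral => //.
  - move=> z _; rewrite lee_fin /saturated ltW// power_gap_pos//.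
      by rewrite lt_min ltr01 divr_gt0 ?maxone_gt0.
    by rewrite ge_min lexx orbT.
  - by apply/measurable_EFinP; exact: measurable_saturated.
  - by apply/measurable_EFinP; exact: measurable_saturated.
  - move=> z _; rewrite lee_fin; apply: saturated_mono => //.
      by rewrite divr_gt0// maxone_gt0.
    rewrite ler_pM2l ?maxone_gt0// lef_pV2 ?posrE//.
    by move: u_1; rewrite /u ltr_pdivlMr// mul1r => /ltW.
apply: le_trans mono; apply: le_trans (HK _ y yp Sy ry); rewrite lee_fin divff ?gt_eqF//.
rewrite !powR1 !mulr1.
have -> : S u = C0 by rewrite /saturated min_r// ltW.
have hS : S u = C0 by rewrite /saturated min_r// ltW.
rewrite hS in loss; rewrite lerD2l; apply: le_trans (_ : - (D' * (u1 * H) `^ (- alpha)) <= _).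
  by rewrite lerN2.
rewrite mulrBr -[leLHS]add0r; apply: lerD; first by rewrite mulr_ge0// ltW.
by rewrite lerN2 mulrC ler_wpM2l.
Qed.

Lemma hump_lower a : 1 <= a -> exists B H0 : R, [/\ a <= B, 0 < H0 & forall H y, H0 <= H ->
  B < nrm y -> (a / H) `^ nu / nu <= hump ((a / H) `^ nu / nu) H y].
Proof.
move=> a1; have a0 : 0 < a by lra.
have [u0 /andP[u00 u01] Hu] := power_gap_small nu0 nunu'.
(* The factor 4 in the power nu, halved by [power_gap_small], leaves twice theta at norm B;
   subtracting theta leaves theta. *)
pose B := a * 4 `^ nu^-1.
have four1 : 1 <= 4 `^ nu^-1.
  by rewrite -[leLHS](powRr0 (4 : R)) ler_powR ?ler1n// invr_ge0 ltW.
have aB : a <= B by rewrite ler_peMr// ltW.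
have B0 : 0 < B by lra.
exists B, (B / u0); split => //; first by rewrite divr_gt0.
move=> H y BH By; have H0 : 0 < H by apply: lt_le_trans BH; rewrite divr_gt0.
have BHu : B / H <= u0 by rewrite ler_pdivrMr// mulrC -ler_pdivrMr.
have BH0 : 0 < B / H by rewrite divr_gt0.
rewrite /hump le_max; apply/orP; left; rewrite lerBrDr.
apply: (@le_trans _ _ (S (B / H))); last first.
  apply: saturated_mono => //; rewrite ler_pM2r ?invr_gt0//.
  by apply: le_trans (maxone_ge _); exact: ltW.
have -> : S (B / H) = power_gap nu nu' (B / H) by rewrite /saturated min_l// (le_trans BHu).
apply: le_trans (Hu _ BH0 BHu).
have -> : B / H = (a / H) * 4 `^ nu^-1 by rewrite /B mulrAC.
rewrite (powRM _ (divr_ge0 (ltW a0) (ltW H0)) (powR_ge0 4 _)) -powRrM mulVf ?gt_eqF// powRr1//.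
by rewrite le_eqVlt; apply/orP; left; apply/eqP; field; rewrite gt_eqF.
Qed.

(** The first step escapes beyond B with probability at least p, where the hump is at least theta,
    of order n^(-nu/alpha); the next n steps keep at least half of its mean. *)
Lemma hist_lower_decay a x : 0 <= a -> X x -> a < nrm x ->
  exists c n0, 0 < c /\ forall n, (n0 <= n)%N ->
    ((c * n%:R `^ (- (nu / alpha)))%:E <= P x (hist xi (fun=> above a) n.+1))%E.
Proof.
move=> a0 Xx ax; have /andP[a1 a2] := a12; have h0 := nu0; have h1 := nunu'; have h2 := nu'1.
have [r0 [M [sg [r02 M0 sg0 HK]]]] := hump_kernel.
pose b0 := Num.max a r0.
have b01 : 1 <= b0 by rewrite le_max; apply/orP; right; lra.
have b0p : 0 < b0 by lra.
have ab0 : a <= b0 by rewrite le_max lexx.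
have rb0 : r0 <= b0 by rewrite le_max lexx orbT.
have [B [H1 [bB H10 HB]]] := hump_lower b01.
have [p p0 Hp] := escape B.
have [v0 /andP[v00 v01] Hv] := powR_small nu0 (mulr_gt0 sg0 nu0).
pose H2 := Num.max H1 (b0 / v0).
have H20 : 0 < H2 by rewrite lt_max H10.
have C00 : 0 < C0 by exact: power_gap_pos.
pose c := 2^-1 * (b0 `^ nu / nu) * M `^ (- (nu / alpha)) * p / C0.
(* Large n makes H at least H2, which brings theta below sg and makes [hump_lower] applicable. *)
exists c, (Num.truncn (H2 `^ alpha / M)).+2; split.
  by rewrite !mulr_gt0 ?powR_gt0 ?invr_gt0.
move=> n nn; have n0 : (0 < n)%N by exact: leq_trans nn.
have np : 0 < n%:R :> R by rewrite ltr0n.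
pose H := (M * n%:R) `^ alpha^-1.
have HM : H `^ alpha = M * n%:R.
  by rewrite /H -powRrM mulVf ?powRr1 ?mulr_ge0 ?(ltW M0)// gt_eqF//; lra.
have HH : H2 <= H.
  rewrite leNgt; apply/negP => /(gt0_ltr_powR (lt_trans ltr01 a1)).
  rewrite !nnegrE powR_ge0 (ltW H20) HM => /(_ isT isT).
  rewrite ltNge -ler_pdivrMl// mulrC => /negP; apply.
  by apply: le_trans (ltW (truncnS_gt _)) _; rewrite ler_nat ltnW.
have H0 : 0 < H by exact: lt_le_trans HH.
pose theta := (b0 / H) `^ nu / nu.
have th0 : 0 < theta by rewrite divr_gt0// powR_gt0// divr_gt0.
have thsg : 0 <= theta <= sg.
  rewrite (ltW th0)/= ler_pdivrMr//; apply: Hv; first by rewrite divr_ge0 ?(ltW b0p) ?(ltW H0).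
  rewrite ler_pdivrMr// mulrC -ler_pdivrMr//; apply: le_trans HH.
  by rewrite le_max lexx orbT.
have H1H : H1 <= H by apply: le_trans HH; rewrite le_max lexx.
(* From time 2 on the path is killed inside the ball of radius b0; the hump vanishes there, so this
   costs nothing. *)
pose A (i : nat) : set (R * R) := match i with 0%N => above a | 1%N => above B | _ => above b0 end.
have mA i : measurable (A i) by case: i => [|[|i]]; exact: measurable_above.
have Ai i : (1 <= i)%N -> A i `<=` above b0.
  by case: i => [|[|i]]//= _ y; exact: le_lt_trans.
have Sx : states X x by apply: (above_states a0).
have e01 : 0 <= 1 - (2 * n%:R : R)^-1 <= 1.
  have h : 0 <= (2 * n%:R : R)^-1 <= 1.
    rewrite invr_ge0 mulr_ge0//= invf_le1 ?mulr_gt0// -[leLHS]mulr1 ler_pM// ?ler1n//; lra.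
  by case/andP: h => u v; apply/andP; split; lra.
have step i y : (1 <= i)%N -> X y -> A i y ->
    (((1 - (2 * n%:R)^-1) * hump theta H y)%:E <= \int[K y]_(z in A i.+1) (hump theta H z)%:E)%E.
  move=> i1 Xy Ay; have by0 := Ai i i1 y Ay.
  have Sy : states X y by apply: (above_states (ltW b0p)).
  have ry : r0 <= nrm y by apply: le_trans rb0 _; exact: ltW.
  apply: le_trans (HK theta n H y thsg n0 H0 HM Sy ry) _.
  have -> : A i.+1 = above b0 by case: i i1 {Ay}.
  rewrite le_eqVlt; apply/orP; left; apply/eqP; rewrite [RHS]integral_mkcond.
  apply: eq_integral => z _; rewrite patchE; case: (boolP (z \in _)) => //.
  rewrite notin_setE/= => /negP; rewrite -leNgt => zb.
  by rewrite hump_eq0.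
have C1 y : hump theta H y <= C0 by apply: hump_le => //; exact: ltW.
have := hist_lower_bound mX chain Xx mA n (measurable_hump theta H)
  (hump_ge0 theta H) C1 e01 step.
have mh : measurable (hist xi (fun=> above a) n.+1).
  by apply: (measurable_hist chain) => _; exact: measurable_above.
have sub : (P x (hist xi A (1 + n)) <= P x (hist xi (fun=> above a) n.+1))%E.
  apply: le_measure; rewrite ?inE//; first exact: (measurable_hist chain).
  move=> w Hw i ni; have := Hw i ni; case: i ni => [|i] ni //= hi.
  by have := Ai i.+1 isT _ hi; exact: le_lt_trans.
have occ1 : ((theta * p)%:E <= occ x A 1 (EFin \o hump theta H))%E.
  have mV : measurable_fun setT (EFin \o hump theta H).
    by apply/measurable_EFinP; exact: measurable_hump.
  have V0 y : (0 <= (EFin \o hump theta H) y)%E by rewrite lee_fin hump_ge0.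
  rewrite (occupationS chain 0 Xx mA mV V0).
  have -> : (fun y => \int[K y]_(z in A 1%N) (EFin \o hump theta H) z)%E =
      (fun y => \int[K y]_z ((EFin \o hump theta H) \_ (A 1%N)) z)%E.
    by apply/funext => y; rewrite integral_mkcond.
  have mr : measurable_fun setT ((EFin \o hump theta H) \_ (A 1%N)).
    by apply/(measurable_restrictT _ (mA _)); exact: measurable_funTS.
  have r00 z : (0 <= ((EFin \o hump theta H) \_ (A 1%N)) z)%E by rewrite patchE; case: ifP.
  rewrite (occupation0 chain Xx mA (measurable_kernel_integral K mr r00) _ ax); last first.
    by move=> y; exact: integral_ge0.
  rewrite -integral_mkcond; apply: (@le_trans _ _ (theta%:E * K x (above B))%E).
    by rewrite EFinM lee_wpmul2l ?lee_fin ?(ltW th0)// Hp.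
  rewrite -integral_cst; last exact: measurable_above.
  apply: ge0_le_integral => //.
  - exact: measurable_above.
  - by move=> z _; rewrite lee_fin ltW.
  - by apply: measurable_funTS.
  - by move=> z Bz; rewrite lee_fin; apply: HB.
(* Bernoulli's inequality for n steps with a loss of 1 / (2 n) each. *)
have bern : 2^-1 <= (1 - (2 * n%:R : R)^-1) ^+ n.
  have Hb k : 1 - k%:R * (2 * n%:R : R)^-1 <= (1 - (2 * n%:R : R)^-1) ^+ k.
    elim: k => [|k IH]; first by rewrite mul0r subr0 expr0.
    case/andP: e01 => e0 e1; rewrite exprS.
    apply: (@le_trans _ _ ((1 - (2 * n%:R : R)^-1) * (1 - k%:R * (2 * n%:R : R)^-1))).
      rewrite -natr1; move: (2 * _)^-1 e1 e0 => q q0 q1.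
      have q00 : 0 <= q by lra.
      have : 0 <= k%:R * q * q by rewrite !mulr_ge0.
      by move: (k%:R) => kk; nra.
    by rewrite ler_wpM2l.
  apply: le_trans (Hb n); rewrite le_eqVlt; apply/orP; left; apply/eqP.
  by field; rewrite gt_eqF.
move=> low; have {}low := le_trans low (lee_wpmul2l _ sub).
have low2 : ((2^-1)%:E * (theta * p)%:E <= C0%:E * P x (hist xi (fun=> above a) n.+1))%E.
  apply: le_trans (low _); last by rewrite lee_fin ltW.
  apply: (@le_trans _ _ (((1 - (2 * n%:R : R)^-1) ^+ n)%:E * (theta * p)%:E)%E).
    rewrite -!EFinM lee_fin; apply: ler_wpM2r; last exact: bern.
    by apply: mulr_ge0; exact: ltW.
  by rewrite lee_wpmul2l// lee_fin exprn_ge0//; case/andP: e01.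
move: low2; have : P x (hist xi (fun=> above a) n.+1) \is a fin_num by exact: fin_num_measure.
case: (P x _) => [s| |]// _; rewrite -!EFinM !lee_fin => low2.
rewrite -(ler_pM2l C00); apply: le_trans low2.
rewrite le_eqVlt; apply/orP; left; apply/eqP.
have -> : theta = b0 `^ nu / nu * M `^ (- (nu / alpha)) * n%:R `^ (- (nu / alpha)).
  rewrite /theta powR_div// ?(ltW b0p)// /H -powRrM.
  have -> : alpha^-1 * - nu = - (nu / alpha) by rewrite mulrN mulrC.
  by rewrite powRM ?(ltW M0)//; ring.
by rewrite /c; field; rewrite !gt_eqF.
Qed.

Lemma tau_moment_infinite q a x : nu / alpha < q -> 0 <= a -> X x -> a < nrm x ->
  (\int[P x]_w poweR (tau xi a w) q = +oo)%E.
Proof.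
move=> qnu a0 Xx ax; have /andP[a1 a2] := a12; have h0 := nu0.
have s0 : 0 < nu / alpha by rewrite divr_gt0//; lra.
have q0 : 0 < q by exact: lt_trans qnu.
have [c [n0 [c0 Hc]]] := hist_lower_decay a0 Xx ax.
apply: eq_infty => r; pose e := q - nu / alpha; have e0 : 0 < e by rewrite subr_gt0.
pose n := maxn n0 (Num.truncn ((`|r| / c) `^ e^-1)).+1.
have nn : (n0 <= n)%N by rewrite leq_maxl.
have n1 : (0 < n)%N by rewrite (leq_trans _ (leq_maxr _ _)).
have np : 0 < n%:R :> R by rewrite ltr0n.
apply: le_trans (tau_moment_ge (measurable_xi chain) a (P x) n.+1 q0).
apply: (@le_trans _ _ ((n.+1%:R `^ q)%:E * (c * n%:R `^ (- (nu / alpha)))%:E)%E); last first.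
  by rewrite lee_wpmul2l ?lee_fin ?powR_ge0// Hc.
rewrite -EFinM lee_fin; apply: (@le_trans _ _ (c * n%:R `^ e)).
  apply: le_trans (ler_norm r) _; rewrite mulrC -ler_pdivrMr//.
  have rc : 0 <= `|r| / c by rewrite divr_ge0// ltW.
  have -> : `|r| / c = ((`|r| / c) `^ e^-1) `^ e.
    by rewrite -powRrM mulVf ?gt_eqF// powRr1.
  rewrite ge0_ler_powR ?nnegrE ?powR_ge0 ?(ltW e0)//.
  by apply: le_trans (ltW (truncnS_gt _)) _; rewrite ler_nat leq_maxr.
have -> : n%:R `^ e = n%:R `^ q * n%:R `^ (- (nu / alpha)).
  by rewrite -powRD// (gt_eqF np) implybT.
rewrite [leRHS]mulrCA ler_wpM2l ?(ltW c0)// ler_wpM2r ?powR_ge0//.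
by rewrite ge0_ler_powR ?nnegrE ?ler_nat ?(ltW q0).
Qed.

End Profile.
End InfiniteMoments.

(** * Transience *)

Section Transience.
Context {R : realType} {d : measure_display} {Omega : measurableType d}.
Variables (X : set (R * R)) (P : R * R -> probability Omega R)
  (xi : nat -> Omega -> R * R) (K : R.-pker (R * R)%type ~> (R * R)%type).
Hypothesis mX : measurable X.
Hypothesis chain : is_markov_chain X P xi K.
Hypothesis leave_origin : X origin ->
  (P origin [set w | vsub (xi 1%N w) (xi 0%N w) = origin] < 1)%E.
Variables (pR cR cT alpha b : R).
Hypotheses (a12 : 1 < alpha < 2).
Hypothesis drift : forall nu, -1 < nu < 1 -> nu != 0 -> alpha - nu < b ->
  exists Dr, kernel_drift_spec X K pR cR cT alpha nu Dr.
Hypothesis escape : forall t : R, exists2 p : R, 0 < p & forall x, states X x ->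
  (p%:E <= K x [set z | (t < nrm z)%R])%E.
Local Notation lim_drift := (drift_exp alpha (pR * cR) ((1 - pR) * cT)).
Local Notation above a := [set y : R * R | a < nrm y].
Local Notation below a := [set y : R * R | nrm y <= a].
Let mn := @measurable_nrm R.

Lemma measurable_below (a : R) : measurable (below a).
Proof.
rewrite (_ : below a = ~` above a); first by apply: measurableC; exact: measurable_above.
by apply/seteqP; split => y /=; rewrite leNgt => /negP.
Qed.

(** A punctured ball: the assumptions on the jumps say nothing about a start at the origin. *)
Definition annulus (k : R) : set (R * R) := above 0 `&` below k.

Lemma measurable_annulus k : measurable (annulus k).
Proof. by apply: measurableI; [exact: measurable_above | exact: measurable_below]. Qed.

Section Visits.
Variable nu : R.
Hypotheses (nu0 : nu < 0) (nu1 : -1 < nu) (anb : alpha - nu < b) (F0 : 0 < lim_drift nu).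
Local Notation m z := (maxone (nrm z)).

Lemma annulus_visits x k : X x -> 0 < k ->
  (\sum_(0 <= n <oo) P x (xi n @^-1` annulus k) < +oo)%E.
Proof.
move=> Xx k0; have n0 := nu0; have n1 := nu1; have /andP[a1 a2] := a12.
have n11 : -1 < nu < 1 by lra.
have [Dr [DrE _ Drlim]] := drift n11 (ltr0_neq0 nu0) anb.
have F2 : 0 < lim_drift nu / 2 by rewrite divr_gt0.
have [r0 r02 Hr] := Drlim _ F2.
have r0p : 0 < r0 by lra.
have [p p0 Hp] := escape (2 * r0).
(* Capped at its value on the sphere of radius r0, f is maximal inside the ball and cannot increase
   from there, including from the origin; outside it is the decreasing power. *)
pose f (y : R * R) : R := Num.min (m y `^ nu) (r0 `^ nu).
have mm : measurable_fun setT (fun z : R * R => m z `^ nu) by exact: measurable_maxone_nrm.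
have mf : measurable_fun setT f by exact: measurable_minr.
have f0 y : 0 <= f y by rewrite le_min !powR_ge0.
pose gap : R := r0 `^ nu - (2 * r0) `^ nu.
have gap0 : 0 < gap.
  by rewrite subr_gt0; apply: gtr0_ltr_powRN => //; lra.
pose kk := Num.max k r0.
have kkp : 0 < kk by rewrite lt_max k0.
pose e1 : R := - nu * (lim_drift nu / 2) * kk `^ (nu - alpha).
have e10 : 0 < e1 by rewrite !mulr_gt0 ?powR_gt0// oppr_gt0.
(* The loss per visit: e1 by the drift when r0 <= r <= k, and p times gap inside radius r0, where a
   jump beyond 2 r0 has probability at least p and lowers f by at least gap. *)
pose c : R := Num.min e1 (p * gap).
have c0 : 0 < c by rewrite lt_min e10 mulr_gt0.
apply: (sum_visits_lty mX chain (V := f) (c := c) Xx (measurable_annulus k) mf f0 c0).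
move=> y Xy.
have Kf_le : (\int[K y]_z (f z)%:E <= (r0 `^ nu)%:E)%E.
  apply: (@le_trans _ _ (\int[K y]_z (cst (r0 `^ nu)%:E z))%E); last first.
    by rewrite integral_cst// [X in (_ * X)%E]prob_kernel mule1.
  apply: ge0_le_integral => //.
  - by move=> z _; rewrite lee_fin.
  - exact/measurable_EFinP.
  - by move=> z _; rewrite lee_fin ge_min lexx orbT.
have [y0|y0] := pselect (y = origin).
  rewrite indicE memNset; last first.
    by move=> [] /=; rewrite y0 /nrm/= expr0n/= addr0 sqrtr0 ltxx.
  rewrite mulr0 adde0; apply: le_trans Kf_le _; rewrite lee_fin /f le_min lexx andbT.
  rewrite y0 /nrm/= expr0n/= addr0 sqrtr0; apply: gtr0_ler_powRN; [exact: ltW | exact: maxone_gt0 |].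
  by rewrite /maxone ge_max; apply/andP; split; lra.
have Sy : states X y by [].
have i01 : c * \1_(annulus k) y <= c by rewrite ler_piMr ?(ltW c0)// indicE; case: (_ \in _).
have [ry|ry] := leP r0 (nrm y).
  have y2 : 2 <= nrm y by lra.
  have yp : 0 < nrm y by lra.
  have fy : f y = nrm y `^ nu.
    by rewrite /f maxone_id; [rewrite min_l//; apply: gtr0_ler_powRN => //; exact: ltW | lra].
  have : (\int[K y]_z (f z)%:E <= \int[K y]_z (m z `^ nu)%:E)%E.
    apply: ge0_le_integral => //.
    - by move=> z _; rewrite lee_fin.
    - exact/measurable_EFinP.
    - exact/measurable_EFinP.
    - by move=> z _; rewrite lee_fin ge_min lexx.
  rewrite (DrE _ Sy y2) fy.
  have : (0 <= \int[K y]_z (f z)%:E)%E by apply: integral_ge0 => z _; rewrite lee_fin.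
  move: (\int[K y]_z (f z)%:E)%E => [v| |]//; rewrite -EFinD !lee_fin => _ hv.
  have Dl : lim_drift nu / 2 <= Dr y.
    have := Hr y Sy ry; rewrite ler_norml => /andP[h _]; lra.
  have Ep : nrm y `^ nu * nrm y `^ (- alpha) = nrm y `^ (nu - alpha).
    by rewrite -powRD// (gt_eqF yp) implybT.
  have -> : nrm y `^ nu = nrm y `^ nu * (1 + nu * nrm y `^ (- alpha) * Dr y) +
      - nu * Dr y * nrm y `^ (nu - alpha) by rewrite -Ep; ring.
  apply: lerD => //; case: (boolP (y \in annulus k)) => [|yk]; last first.
    rewrite indicE (negbTE yk) mulr0 !mulr_ge0 ?powR_ge0//; first lra.
    by apply: le_trans Dl; exact: ltW.
  rewrite inE => -[_ /= yk]; apply: (le_trans i01); apply: (@le_trans _ _ e1).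
    by rewrite /c ge_min lexx.
  have nn : 0 < - nu by rewrite oppr_gt0.
  rewrite /e1; apply: ler_pM; [|exact: powR_ge0|by rewrite ler_pM2l|].
    by rewrite mulr_ge0// ltW.
  by apply: gtr0_ler_powRN => //; [lra | rewrite le_max yk].
have fy : f y = r0 `^ nu.
  rewrite /f min_r//; apply: gtr0_ler_powRN; [exact: ltW | exact: maxone_gt0 |].
  by rewrite /maxone ge_max; apply/andP; split; lra.
rewrite fy.
have H1 : (\int[K y]_z (f z)%:E + (c * \1_(annulus k) y)%:E <=
    \int[K y]_z (f z)%:E + gap%:E * K y (above (2 * r0)%R))%E.
  apply: leeD => //; apply: (@le_trans _ _ (gap%:E * p%:E)%E); last first.
    by rewrite lee_wpmul2l ?lee_fin ?(ltW gap0)// Hp.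
  rewrite -EFinM lee_fin; apply: (le_trans i01).
  by rewrite /c ge_min mulrC lexx orbT.
apply: (le_trans H1) => {H1}.
have ma := measurable_above (2 * r0).
have mi : measurable_fun setT (fun z : R * R => gap * \1_(above (2 * r0)) z).
  by apply: measurable_funM => //; exact: measurable_indic.
have -> : (gap%:E * K y (above (2 * r0)%R) = \int[K y]_z (gap * \1_(above (2 * r0)%R) z)%R%:E)%E.
  under eq_integral do rewrite EFinM.
  have m1 : measurable_fun setT (fun z : R * R => (\1_(above (2 * r0)) z : R)%:E).
    by apply/measurable_EFinP; exact: measurable_indic.
  have n1' (z : R * R) : setT z -> (0 <= (\1_(above (2 * r0)) z : R)%:E)%E.
    by rewrite lee_fin indicE.
  have g0 : (0 <= gap%:E)%E by rewrite lee_fin ltW.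
  rewrite (ge0_integralZl (K y) measurableT m1 n1' g0).
  by rewrite integral_indic// setIT.
rewrite -ge0_integralD//; last 4 first.
- by move=> z _; rewrite lee_fin.
- exact/measurable_EFinP.
- by move=> z _; rewrite lee_fin mulr_ge0 ?(ltW gap0)// indicE.
- exact/measurable_EFinP.
apply: (@le_trans _ _ (\int[K y]_z (cst (r0 `^ nu)%:E z))%E); last first.
  by rewrite integral_cst// [X in (_ * X)%E]prob_kernel mule1.
apply: ge0_le_integral => //.
- by move=> z _; rewrite -EFinD lee_fin addr_ge0// mulr_ge0 ?(ltW gap0)// indicE.
- by apply: emeasurable_funD; exact/measurable_EFinP.
- move=> z _; rewrite -EFinD lee_fin indicE; case: (boolP (z \in _)) => [|_].
    rewrite inE/= mulr1 => zr.
    rewrite -lerBrDr /gap subKr.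
    rewrite /f ge_min; apply/orP; left; apply: gtr0_ler_powRN; [exact: ltW | lra |].
    by apply: le_trans (maxone_ge _); exact: ltW.
  by rewrite mulr0 addr0 ge_min lexx orbT.
Qed.

(** Each visit to the origin is followed, with a fixed positive probability, by a state in some
    annulus, and the visits to that annulus are already summable. *)
Lemma origin_visits x : X x -> (\sum_(0 <= n <oo) P x (xi n @^-1` below 0%R) < +oo)%E.
Proof.
move=> Xx; have mb := measurable_below 0.
have nrm0 y : nrm y <= 0 -> y = origin.
  move=> h; apply: contrapT => /nrm_gt0; by rewrite ltNge h.
have [X0|X0] := pselect (X origin); last first.
  rewrite eseries0 ?ltry// => n _ _.
  have [_ /(_ x Xx)[_ [HX _]]] := chain.
  have mxX : measurable (xi n @^-1` X) by exact: (measurable_xi_preimage chain).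
  apply/eqP; rewrite -measure_le0; apply: (@le_trans _ _ (P x (~` (xi n @^-1` X)))).
    apply: le_measure; rewrite ?inE; [exact: (measurable_xi_preimage chain) | exact: measurableC |].
    by move=> w /= /nrm0 h; rewrite h.
  by rewrite probability_setC// HX subee.
have lawK (B : set (R * R)) : measurable B -> K origin B = P origin (xi 1%N @^-1` B).
  move=> mB; have mi : measurable_fun setT (fun z : R * R => (\1_B z : R)%:E).
    by apply/measurable_EFinP; exact: measurable_indic.
  have := kernel_law chain X0 mi; rewrite integral_indic// setIT => ->; last first.
    by move=> y; rewrite lee_fin indicE.
  rewrite -[in RHS](setIT (xi 1%N @^-1` B)) -integral_indic//.
  exact: (measurable_xi_preimage chain).
(* Otherwise the annuli, which exhaust the punctured plane, would all be null, and the chain would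
   stay at the origin almost surely. *)
have [k [k0 Kk]] : exists k : R, 0 < k /\ (0 < K origin (annulus k))%E.
  apply: contrapT => H.
  have Z k : K origin (annulus k%:R) = 0%E.
    have [->|kp] := posnP k.
      rewrite (_ : annulus 0 = set0) ?measure0// -subset0 => y [/= h1 h2].
      by move: h1; rewrite ltNge h2.
    apply/eqP; rewrite eq_le measure_ge0 andbT leNgt; apply/negP => h.
    by apply: H; exists k%:R; rewrite ltr0n.
  have U0 : K origin (above 0) = 0%E.
    have mU : measurable (above (0 : R)) by exact: measurable_above.
    apply/(negligibleP _ mU).
    have -> : above 0 = \bigcup_k annulus k%:R.
      apply/seteqP; split => y /=; last by move=> [k _ []].
      move=> h; exists (Num.truncn (nrm y)).+1 => //; split => //=.
      by rewrite ltW// truncnS_gt.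
    apply: negligible_bigcup => k; exists (annulus k%:R); split => //.
    exact: measurable_annulus.
  have := leave_origin X0; rewrite ltNge => /negP; apply.
  have mu0 : measurable [set w | vsub (xi 1%N w) (xi 0%N w) = origin].
    rewrite (_ : [set w | _] = (fun w => nrm (vsub (xi 1%N w) (xi 0%N w))) @^-1` `]-oo, 0]%classic).
      rewrite -[X in measurable X]setTI.
      have m1 i : measurable_fun setT (fun w => (xi i w).1).
        exact: measurableT_comp measurable_fst (measurable_xi chain i).
      have m2 i : measurable_fun setT (fun w => (xi i w).2).
        exact: measurableT_comp measurable_snd (measurable_xi chain i).
      suff mv : measurable_fun setT (fun w => nrm (vsub (xi 1%N w) (xi 0%N w))) by exact: mv.
      by rewrite /nrm /vsub/=; measurability.
    apply/seteqP; split => w /=; rewrite in_itv/=; last exact: nrm0.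
    by move=> ->; rewrite /nrm/= expr0n/= addr0 sqrtr0.
  have H1 : P origin (xi 1%N @^-1` below 0%R) = 1%E.
    have -> : xi 1%N @^-1` below 0 = ~` (xi 1%N @^-1` above 0%R).
      by apply/seteqP; split => w /=; rewrite leNgt => /negP.
    rewrite probability_setC; last by apply: (measurable_xi_preimage chain); exact: measurable_above.
    by rewrite -lawK ?U0 ?sube0//; exact: measurable_above.
  rewrite -H1; have mB0 := measurable_xi_preimage chain 1 mb.
  have -> : P origin (xi 1%N @^-1` below 0%R) =
      (\int[P origin]_w (\1_(xi 1%N @^-1` below 0%R) w)%:E)%E.
    by rewrite integral_indic// setIT.
  have -> : P origin [set w | vsub (xi 1%N w) (xi 0%N w) = origin] =
      (\int[P origin]_w (\1_[set w | vsub (xi 1%N w) (xi 0%N w) = origin] w)%:E)%E.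
    by rewrite integral_indic// setIT.
  apply: ae_ge0_le_integral => //.
  - by apply/measurable_EFinP; exact: measurable_indic.
  - by apply/measurable_EFinP; exact: measurable_indic.
  apply: filterS (start_ae chain X0) => w h _; rewrite lee_fin !indicE.
  case: (boolP (w \in xi 1%N @^-1` _)) => [|_]; last by case: (_ \in _).
  by rewrite inE /= => /nrm0 h1; rewrite mem_set//= h h1 /vsub/= !subrr.
have mk := measurable_annulus k.
have V := annulus_visits Xx k0.
have p1 : K origin (annulus k) \is a fin_num.
  by rewrite lawK//; apply: fin_num_measure; exact: (measurable_xi_preimage chain).
move: Kk p1; case E : (K origin (annulus k)) => [p| |]// p0 _; rewrite lte_fin in p0.
have step n : (P x (xi n @^-1` below 0%R) <= (p^-1)%:E * P x (xi n.+1 @^-1` annulus k))%E.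
  have m0 : measurable (xi n @^-1` below 0%R) by exact: (measurable_xi_preimage chain).
  rewrite (xiS_law chain n Xx mk).
  have pe : (0 <= (p^-1)%:E)%E by rewrite lee_fin invr_ge0 ltW.
  apply: (@le_trans _ _ ((p^-1)%:E * \int[P x]_(w in xi n @^-1` below 0%R) p%:E)%E).
    by rewrite integral_cst// muleA -EFinM mulVf ?gt_eqF// mul1e.
  rewrite lee_wpmul2l//.
  have mKx : measurable_fun setT (fun w => K (xi n w) (annulus k)).
    apply: (measurableT_comp (f := fun y => K y (annulus k))); last exact: (measurable_xi chain).
    exact: measurable_kernel.
  apply: (@le_trans _ _ (\int[P x]_(w in xi n @^-1` below 0%R) K (xi n w) (annulus k))%E).
    apply: ge0_le_integral => //.
    - by move=> w _; rewrite lee_fin ltW.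
    - exact: measurable_funTS.
    - by move=> w /= /nrm0 ->; rewrite E.
  by apply: ge0_subset_integral.
apply: (@le_lt_trans _ _ ((p^-1)%:E * \sum_(0 <= n <oo) P x (xi n @^-1` annulus k))%E); last first.
  by rewrite lte_mul_pinfty// lee_fin invr_ge0 ltW.
apply: lime_le; first exact: is_cvg_nneseries.
apply: nearW => n; apply: (@le_trans _ _ ((p^-1)%:E * \sum_(0 <= i < n) P x (xi i.+1 @^-1` annulus k))%E).
  by rewrite ge0_sume_distrr//; apply: lee_sum => i _; exact: step.
rewrite lee_wpmul2l ?lee_fin ?invr_ge0 ?(ltW p0)//.
apply: (@le_trans _ _ (\sum_(0 <= i < n.+1) P x (xi i @^-1` annulus k))%E).
  by rewrite [leRHS]big_nat_recl//= leeDr.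
by apply: nneseries_lim_ge.
Qed.

Lemma chain_transient : transient X P xi.
Proof.
move=> x Xx; apply: nrm_cvgy_ae => k.
have mb : measurable (below k%:R) by exact: measurable_below.
have S : (\sum_(0 <= n <oo) P x (xi n @^-1` below k%:R) < +oo)%E.
  have k1 : 0 < k%:R + 1 :> R by rewrite ltr_wpDl.
  apply: (@le_lt_trans _ _ (\sum_(0 <= n <oo) (P x (xi n @^-1` annulus (k%:R + 1)%R) + P x (xi n @^-1` below 0%R))%E)%E).
    apply: lee_nneseries => // n _.
    have ma : measurable (xi n @^-1` annulus (k%:R + 1)%R).
      by apply: (measurable_xi_preimage chain); exact: measurable_annulus.
    have m0 : measurable (xi n @^-1` below 0%R).
      by apply: (measurable_xi_preimage chain); exact: measurable_below.
    apply: le_trans (measureU2 (P x) ma m0); apply: le_measure; rewrite ?inE.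
    - exact: (measurable_xi_preimage chain).
    - exact: measurableU.
    - move=> w /= h; case: (leP (nrm (xi n w)) 0) => h0; [right|left] => //.
      by split => //=; rewrite (le_trans h)// lerDl.
  rewrite nneseriesD//; apply: lte_add_pinfty; last exact: origin_visits.
  exact: annulus_visits.
have := visits_finite_ae (measurable_xi chain) mb S.
apply: filterS => w [N HN]; exists N => n Nn.
by rewrite ltNge; apply/negP; exact: HN.
Qed.

End Visits.
End Transience.

Theorem theorem2p9 (R : realType) (d : measure_display) (Omega : measurableType d)
  (X : set (R * R)) (P : R * R -> probability Omega R)
  (xi : nat -> Omega -> R * R) (K : R.-pker (R * R)%type ~> (R * R)%type)
  (chi : Omega -> bool) (thR thT : Omega -> R)
  (pR cR cT alpha beta : R) :
  (* state space: infinite, unbounded, measurable subset of R^2 *)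
  measurable X -> ~ finite_set X -> (forall M : R, exists x, X x /\ M < nrm x) ->
  (* time-homogeneous Markov chain on X *)
  is_markov_chain X P xi K ->
  (* P_0[theta = 0] < 1 *)
  (X origin -> (P origin [set w | vsub (xi 1%N w) (xi 0%N w) = origin] < 1)%E) ->
  (* the jump decomposition theta = chi u_x thR + (1 - chi) v_x thT *)
  measurable [set w | chi w] -> measurable_fun setT thR -> measurable_fun setT thT ->
  (forall x, X x -> x <> origin ->
    {ae P x, forall w, vsub (xi 1%N w) (xi 0%N w) =
       vadd (smul ((chi w)%:R * thR w) (uvec x))
            (smul ((1 - (chi w)%:R) * thT w) (vvec x))}) ->
  (* thR and thT are independent of chi *)
  (forall x, X x -> x <> origin -> forall (b : bool) (B : set R), measurable B ->
     P x ([set w | chi w = b] `&` thR @^-1` B) =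
       (P x [set w | chi w = b] * P x (thR @^-1` B))%E /\
     P x ([set w | chi w = b] `&` thT @^-1` B) =
       (P x [set w | chi w = b] * P x (thT @^-1` B))%E) ->
  (* (A) *)
  0 < pR < 1 ->
  (forall x, X x -> x <> origin ->
     P x [set w | chi w] = pR%:E /\ P x [set w | ~~ chi w] = (1 - pR)%:E) ->
  (* (B) *)
  (forall x, X x -> x <> origin ->
     (P x).-integrable setT (EFin \o thR) /\ (\int[P x]_w (thR w)%:E = 0)%E /\
     (P x).-integrable setT (EFin \o thT) /\ (\int[P x]_w (thT w)%:E = 0)%E) ->
  (* (C) *)
  1 < alpha < 2 -> 0 < cR ->
  (forall eps : R, 0 < eps -> exists Y : R, forall y, Y < y ->
     forall x, X x -> x <> origin ->
       `| y `^ alpha * fine (P x [set w | y < pospart (thR w)]) - cR | <= eps) ->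
  (* (D) *)
  alpha < beta ->
  (exists M : R, forall x, X x -> x <> origin ->
     (\int[P x]_w ((negpart (thR w)) `^ beta)%:E <= M%:E)%E) ->
  (* (E) *)
  (forall x, X x -> x <> origin -> forall y : R, 0 <= y ->
     P x [set w | y < negpart (thT w)] = P x [set w | y < pospart (thT w)]) ->
  0 < cT ->
  (forall eps : R, 0 < eps -> exists Y : R, forall y, Y < y ->
     forall x, X x -> x <> origin ->
       `| y `^ alpha * fine (P x [set w | y < pospart (thT w)]) - cT | <= eps) ->
  let pT := 1 - pR in
  let S := pR * cR + 2 * pT * cT * cos (pi * alpha / 2) in
  let F := fun nu : R =>
    pR * cR * (Gamma (alpha - nu) * Gamma (1 - alpha) / Gamma (1 - nu)) +
    pT * cT * (Gamma ((alpha - nu) / 2) * Gamma (1 - alpha / 2) / Gamma (1 - nu / 2)) in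
  (0 < S ->
     null_recurrent X P xi /\
     exists nu : R, (0 < nu < 1 /\ F nu = 0) /\
       (forall nu' : R, 0 < nu' < 1 -> F nu' = 0 -> nu' = nu) /\
       exists a0 : R, forall a, a0 <= a -> forall x, X x -> a < nrm x ->
         forall q : R, 0 < q ->
           (q < nu / alpha -> (\int[P x]_w poweR (tau xi a w) q < +oo)%E) /\
           (nu / alpha < q -> (\int[P x]_w poweR (tau xi a w) q = +oo)%E)) /\
  (S < 0 -> transient X P xi).
Proof.
move=> mX _ _ chain leave0 mchi mthR mthT jumpE indep pR01 Pchi mean a12 cR0 tailR ab momR
  symT cT0 tailT pT S F.
have /andP[p0 p1] := pR01; have /andP[a1 a2] := a12.
have meanR x : states X x -> (P x).-integrable setT (EFin \o thR) /\
    (\int[P x]_w (thR w)%:E = 0)%E.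
  by move=> [Xx x0]; have [h1 [h2 _]] := mean x Xx x0.
have tailR' e : 0 < e -> exists Y : R, forall y, Y < y -> forall x, states X x ->
    `| y `^ alpha * fine (P x [set w | y < pospart (thR w)]) - cR | <= e.
  by move=> /tailR[Y HY]; exists Y => y Yy x [Xx x0]; exact: HY.
have tailT' e : 0 < e -> exists Y : R, forall y, Y < y -> forall x, states X x ->
    `| y `^ alpha * fine (P x [set w | y < pospart (thT w)]) - cT | <= e.
  by move=> /tailT[Y HY]; exists Y => y Yy x [Xx x0]; exact: HY.
have momR' : exists M : R, forall x, states X x ->
    (\int[P x]_w ((negpart (thR w)) `^ beta)%:E <= M%:E)%E.
  by have [M HM] := momR; exists M => x [Xx x0]; exact: HM.
have symT' x : states X x -> forall y : R, 0 <= y ->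
    P x [set w | y < negpart (thT w)] = P x [set w | y < pospart (thT w)].
  by move=> [Xx x0]; exact: symT.
have drift := kernel_drift chain mchi mthR mthT jumpE indep pR01 Pchi meanR a12 cR0 tailR'
  ab momR' symT' cT0 tailT'.
have escape := kernel_escape chain mchi mthR mthT jumpE indep pR01 Pchi cR0 tailR'.
have [lam [L [lam0 L2 contraction]]] := kernel_contraction chain mchi mthR mthT jumpE indep
  pR01 Pchi meanR a12 cR0 tailR' ab momR'.
have [_ ab' _] := moment_exponent a12 ab.
pose A := pR * cR; pose B := (1 - pR) * cT.
have A0 : 0 < A by exact: mulr_gt0.
have B0 : 0 < B by rewrite mulr_gt0// subr_gt0.
have [I I0 E0] := drift_exp0 A B a12.
have SE : drift_exp alpha A B 0 = - S * I.
  by rewrite E0; congr (- _ * _); rewrite /S /A /B /pT; ring.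
split=> [S0|S0]; last first.
  have D0 : 0 < drift_exp alpha A B 0 by rewrite SE mulr_gt0// oppr_gt0.
  (* Bounds how far nu may go below 0: it must exceed -1, and alpha - nu must stay below the moment
     exponent. *)
  pose e := Num.min 1 (Num.min beta 2 - alpha).
  have e0 : 0 < e by rewrite lt_min ltr01 subr_gt0.
  have [nu /andP[en nu0] Fnu] := drift_exp_gt0_left a12 D0 e0.
  move: en; rewrite ltrNl lt_min => /andP[nu1 nub].
  apply: (chain_transient mX chain leave0 a12 drift escape nu0 _ _ Fnu); first lra.
  by move: nub; rewrite ltrBrDl.
have D0 : drift_exp alpha A B 0 < 0 by rewrite SE nmulr_rlt0// oppr_lt0.
have [nu /andP[nu0 nu1] Fnu] := drift_exp_root a12 (ltW A0) B0 D0.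
have FE p : 0 < p < 1 -> F p = drift_exp alpha A B p.
  move=> /andP[pp0 pp1]; rewrite drift_exp.unlock /F GammaM_rad//.
  have -> : (alpha - p) / 2 = alpha / 2 - p / 2 by rewrite mulrBl.
  by rewrite GammaM_tan ?mulrN//; lra.
have Fneg p : p < nu -> drift_exp alpha A B p < 0.
  by move=> pnu; rewrite -Fnu; exact: lt_drift_exp (ltW A0) B0 pnu nu1.
have Fpos p : nu < p -> p < 1 -> 0 < drift_exp alpha A B p.
  by move=> nup pp1; rewrite -Fnu; exact: lt_drift_exp (ltW A0) B0 nup pp1.
have ap : 0 < alpha by lra.
have L0 : 0 <= L by lra.
have inf q a x : 0 < q -> nu / alpha < q -> L <= a -> X x -> a < nrm x ->
    (\int[P x]_w poweR (tau xi a w) q = +oo)%E.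
  move=> q0; rewrite ltr_pdivrMr// => nuq La Xx ax.
  (* The exponent n1 lies strictly between nu and u, so its drift is positive and n1 / alpha < q; n2
     is the auxiliary larger exponent of the saturated profile. *)
  pose u := Num.min (q * alpha) 1; have nuu : nu < u by rewrite lt_min nuq.
  have u1 : u <= 1 by rewrite ge_min lexx orbT.
  have uq : u <= q * alpha by rewrite ge_min lexx.
  pose n1 := (nu + u) / 2; pose n2 := (n1 + 1) / 2.
  have n10 : 0 < n1 by rewrite /n1; lra.
  have n12 : n1 < n2 by rewrite /n2 /n1; lra.
  have n21 : n2 < 1 by rewrite /n2 /n1; lra.
  have F1 : 0 < drift_exp alpha A B n1 by apply: Fpos; rewrite /n1; lra.
  apply: (tau_moment_infinite mX chain a12 ab' drift escape n10 n12 n21 F1) => //.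
    by rewrite ltr_pdivrMr//; apply: lt_le_trans uq; rewrite /n1; lra.
  exact: le_trans La.
split.
  split.
    have n01 : 0 < nu / 2 < 1 by apply/andP; split; lra.
    apply: (chain_recurrent mX chain a12 ab' drift lam0 L2 contraction n01).
    by apply: Fneg; lra.
  (* Null recurrence is the case q = 1 of the infinite moments, since nu < 1 < alpha. *)
  exists L => a La x Xx ax; rewrite -(inf 1 a x)//; last by rewrite ltr_pdivrMr//; lra.
  apply: eq_integral => w _; have [[n -> _]|[-> _]] := tauP xi a w.
    by rewrite poweR_EFin powRr1.
  by rewrite poweRyr.
exists nu; split; first by rewrite FE ?nu0.
split.
  move=> nu' nu'01; rewrite (FE _ nu'01) => Fnu'; have /andP[_ nu'1] := nu'01.
  apply/eqP; rewrite eq_le !leNgt; apply/andP; split; apply/negP.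
    by move=> /Fpos/(_ nu'1); rewrite Fnu' ltxx.
  by move=> /Fneg; rewrite Fnu' ltxx.
exists L => a La x Xx ax q q0; split=> [qnu|nuq]; last exact: inf.
(* Any exponent strictly between q alpha and nu has negative drift and still n1 / alpha > q; the
   radius L stays the same for all of them. *)
pose n1 := (q * alpha + nu) / 2.
move: qnu; rewrite ltr_pdivlMr// => qnu; have qa0 : 0 < q * alpha by rewrite mulr_gt0.
have n01 : 0 < n1 < 1 by rewrite /n1; apply/andP; split; lra.
apply: (tau_moment_finite mX chain a12 ab' drift lam0 L2 contraction n01) => //.
  by apply: Fneg; rewrite /n1; lra.
by rewrite ltr_pdivlMr// /n1; lra.
Qed.
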